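(* Let $m\ge 1$. Then: (1) $\mathrm{GL}_\infty(\mathbb S_m)=U(K)\ltimes E_\infty(\mathbb S_m)$, and $E_\infty(\mathbb S_m)=\ker(\overline{\det})$. More precisely, $\overline{\det}:\mathrm{GL}_\infty(\mathbb S_m)\to K^*$ is a surjective group homomorphism, and every $a\in \mathrm{GL}_\infty(\mathbb S_m)$ is the unique product $a=\mu(\lambda)\,e$ with $\lambda=\overline{\det}(a)\in K^*$ and $e=\mu(\overline{\det}(a))^{-1}a\in E_\infty(\mathbb S_m)$. (2) $\mathrm{K}_1(\mathbb S_m)\simeq K^*$.
   Context: $K$ is a field with unit group $K^*$. For $m\ge1$, $\mathbb S_m$ is the $K$-algebra generated by $x_1,\dots,x_m,y_1,\dots,y_m$ subject to the defining relations $y_ix_i=1$ for all $i$, and $[x_i,y_j]=[x_i,x_j]=[y_i,y_j]=0$ for all $i\neq j$ (where $[a,b]=ab-ba$). For $1\le i\le m$ let $E_{00}(i):=1-x_iy_i$; let $\mathfrak a_m$ be the ideal of $\mathbb S_m$ generated by $E_{00}(1),\dots,E_{00}(m)$. Then $\mathbb S_m/\mathfrak a_m\simeq L_m:=K[x_1^{\pm1},\dots,x_m^{\pm1}]$ (Laurent polynomial algebra, $x_i\mapsto x_i$, $y_i\mapsto x_i^{-1}$). For a ring $A$, $\mathrm{GL}_\infty(A)=\bigcup_d \mathrm{GL}_d(A)$ is the group of invertible $\mathbb N\times\mathbb N$ matrices over $A$ differing from the identity in finitely many entries, and $E_\infty(A)$ is its subgroup generated by the elementary matrices $1+aE_{ij}$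 ($a\in A$, $i\ne j$); $\mathrm{K}_1(A)=\mathrm{GL}_\infty(A)/E_\infty(A)$. $\overline{\det}:\mathrm{GL}_\infty(\mathbb S_m)\to L_m^*$ is the composition of the map $\mathrm{GL}_\infty(\mathbb S_m)\to \mathrm{GL}_\infty(L_m)$ induced by $\mathbb S_m\to\mathbb S_m/\mathfrak a_m=L_m$ with the determinant $\mathrm{GL}_\infty(L_m)\to L_m^*$. For $\lambda\in K^*$, $\mu(\lambda):=\mathrm{diag}(\lambda,1,1,\dots)$ and $U(K):=\{\mu(\lambda):\lambda\in K^*\}\simeq K^*$. *)

(* Defs.v *)
From HB Require Import structures.
From mathcomp Require Import all_boot all_order all_algebra.
Set Implicit Arguments. Unset Strict Implicit. Unset Printing Implicit Defensive.
Import Order.TTheory GRing.Theory.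
Local Open Scope ring_scope.

Definition Sm_relations (R : pzRingType) (m : nat) (x y : 'I_m -> R) : Prop :=
  (forall i, y i * x i = 1) /\
  (forall i j, i != j ->
     [/\ x i * y j = y j * x i, x i * x j = x j * x i & y i * y j = y j * y i]).

(* S together with x, y : 'I_m -> S is (a model of) the K-algebra S_m,
   i.e. it is the K-algebra presented by the generators x_i, y_i and the
   relations above: the relations hold, and for every K-algebra R with a
   family satisfying the relations there is a unique K-algebra morphism
   S -> R sending x_i, y_i to that family. *)
Definition is_Sm (K : fieldType) (m : nat) (S : algType K)
    (x y : 'I_m -> S) : Prop :=
  Sm_relations x y /\
  forall (R : algType K) (a b : 'I_m -> R), Sm_relations a b ->
    exists f : {lrmorphism S -> R},
      (forall i, f (x i) = a i /\ f (y i) = b i) /\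
      (forall g : {lrmorphism S -> R},
         (forall i, g (x i) = a i /\ g (y i) = b i) -> forall s, g s = f s).

(* L with X : 'I_m -> L is (a model of) L_m = K[X_1^{+-1},...,X_m^{+-1}],
   i.e. the commutative K-algebra freely generated by the units X_i. *)
Definition is_Laurent (K : fieldType) (m : nat) (L : comUnitAlgType K)
    (X : 'I_m -> L) : Prop :=
  (forall i, X i \is a GRing.unit) /\
  forall (R : comUnitAlgType K) (u : 'I_m -> R),
    (forall i, u i \is a GRing.unit) ->
    exists f : {lrmorphism L -> R},
      (forall i, f (X i) = u i) /\
      (forall g : {lrmorphism L -> R},
         (forall i, g (X i) = u i) -> forall l, g l = f l).

(* Elements of GL_infinity(A) are represented by invertible n x n matrices
   (GL_n(A) embedded in GL_infinity(A) via a |-> diag(a, 1, 1, ...)). *)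
Definition invertible_mx (A : pzRingType) (n : nat) (a : 'M[A]_n) : Prop :=
  exists b : 'M[A]_n, a *m b = 1%:M /\ b *m a = 1%:M.

Definition elementary_mx (A : pzRingType) (n : nat) (e : 'M[A]_n) : Prop :=
  exists (i j : 'I_n) (c : A), i != j /\ e = 1%:M + c *: delta_mx i j.

Inductive Eprod (A : pzRingType) (n : nat) : 'M[A]_n -> Prop :=
  | Eprod1 : Eprod (1%:M : 'M[A]_n)
  | EprodM (e a : 'M[A]_n) : elementary_mx e -> Eprod a -> Eprod (e *m a).

Definition in_Einf (A : pzRingType) (n : nat) (a : 'M[A]_n) : Prop :=
  exists k : nat, Eprod (block_mx a 0 0 1%:M : 'M[A]_(n + k)).

Definition mu (K : fieldType) (S : algType K) (n : nat) (l : K) : 'M[S]_n.+1 :=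
  \matrix_(i, j) (if i == j then (if i == ord0 then l%:A else 1) else 0).

Definition detbar (K : fieldType) (S : algType K) (L : comUnitAlgType K)
    (pi : S -> L) (n : nat) (a : 'M[S]_n) : L :=
  \det (map_mx pi a).

(* Main.v *)
Require Import Defs.
From HB Require Import structures.
From mathcomp Require Import all_boot all_order all_algebra.
From mathcomp Require Import boolp generic_quotient finmap zify.
From mathcomp.multinomials Require Import monalg.
Set Implicit Arguments. Unset Strict Implicit. Unset Printing Implicit Defensive.
Import GRing.Theory.
Local Open Scope ring_scope.
Local Open Scope quotient_scope.

(* Write T(A) for the Toeplitz ring A<x, y | y x = 1> (x, y commuting with A), so
   that S_m is T applied m times to K, realised as the monoid ring of the m-th
   power of the bicyclic monoid; let [chi] denote the class of an invertible
   matrix in K_1.  By induction on m, for all fields K at once, every class of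
   K_1(S_m) comes from K^*; the determinant over L_m then detects it.

   For the step put A = S_m over K, R = A[t, 1/t] = T(A)/(e) with e = 1 - x y,
   and let F = K(t).

   - K_1(R) -> K_1(S_m over F) is injective.  Let a in GL(R) be a product of
     elementary matrices over S_m(F).  Let R act on M = R[s, 1/s] through t -> s,
     with M a free right R-module through t.  Division with remainder by the
     polynomials f(s) lifts the elementary factors to operators on M, whose product
     theta satisfies theta = a (1 + C0) with C0 of finite rank.  With X = s - t, Y
     the division by X and E = 1 - X Y the evaluation s -> t, the map
     phi(theta) = X theta Y + E is multiplicative and theta^-1 phi(theta) is a
     finite-rank perturbation of 1.  Its class in K_1(R) vanishes on lifts of
     elementary matrices and on 1 + C0, and equals -[a] on a, hence [a] = 0.

   - So for g in GL(T(A)) the image in K_1(R) is that of some l t^k, by the induction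
     hypothesis over F, and k = 0 by an index argument after mapping A to K.
     Thus, up to l and elementary matrices, g = 1 + (a matrix over the ideal (e)),
     which the identity [1 + u v] = [1 + v u] moves into the corner e T(A) e = e A.
     There the induction hypothesis over K applies, and the remaining class
     [1 + (u - 1) e] is trivial because [[x, e], [0, y]] conjugates diag(c, 1)
     into diag(c x y + e, 1). *)

(** * Elementary matrices and the group K_1 *)

Notation "a <+> b" := (block_mx a 0 0 b) (at level 50, left associativity) : mxsum_scope.
Delimit Scope mxsum_scope with mxsum.
Local Open Scope mxsum_scope.

Section ElementaryProducts.
Variable A : pzRingType.

Lemma Eprod_mul n (a b : 'M[A]_n) : Eprod a -> Eprod b -> Eprod (a *m b).
Proof.
move=> Ea Eb; elim: Ea => [|e c He _ IH]; first by rewrite mul1mx.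
by rewrite -mulmxA; apply: EprodM.
Qed.

Lemma elementary_Eprod n (e : 'M[A]_n) : elementary_mx e -> Eprod e.
Proof. by move=> He; rewrite -[e]mulmx1; apply: EprodM => //; apply: Eprod1. Qed.

Lemma elementary_mulV n (i j : 'I_n) (c : A) : i != j ->
  (1%:M + c *: delta_mx i j) *m (1%:M + (- c) *: delta_mx i j) = 1%:M.
Proof.
move=> ij; rewrite mulmxDl mul1mx mulmxDr mulmx1.
have -> : c *: delta_mx i j *m (- c *: delta_mx i j) = 0 :> 'M[A]_n.
  apply/matrixP=> k l; rewrite !mxE big1 // => h _; rewrite !mxE.
  case: (eqVneq h j) => [->|]; last by rewrite andbF mulr0 mul0r.
  by rewrite (eq_sym j) (negbTE ij) /= !mulr0.
by rewrite addr0 scaleNr addrNK.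
Qed.

Lemma Eprod_inv n (a : 'M[A]_n) : Eprod a ->
  exists b : 'M[A]_n, [/\ Eprod b, a *m b = 1%:M & b *m a = 1%:M].
Proof.
elim=> [|e c [i [j [t [ij ->]]]] _ [b [Eb cb bc]]].
  by exists 1%:M; rewrite mulmx1; split=> //; apply: Eprod1.
exists (b *m (1%:M + (- t) *: delta_mx i j)); split.
- by apply: Eprod_mul => //; apply: elementary_Eprod; exists i, j, (- t).
- by rewrite mulmxA -[X in X *m _]mulmxA cb mulmx1 elementary_mulV.
- rewrite mulmxA -[X in X *m _]mulmxA -{2}[t]opprK elementary_mulV //.
  by rewrite mulmx1.
Qed.

Lemma block_unit_upperD m n (u v : 'M[A]_(m, n)) :
  block_mx 1%:M (u + v) 0 1%:M = block_mx 1%:M u 0 1%:M *m block_mx 1%:M v 0 1%:M.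
Proof. by rewrite mulmx_block !mul1mx !mulmx1 !mul0mx !mulmx0 !addr0 add0r addrC. Qed.

Lemma block_unit_lowerD m n (u v : 'M[A]_(n, m)) :
  block_mx 1%:M 0 (u + v) 1%:M = block_mx 1%:M 0 u 1%:M *m block_mx 1%:M 0 v 1%:M.
Proof. by rewrite mulmx_block !mul1mx !mulmx1 !mul0mx !mulmx0 !addr0 add0r. Qed.

Lemma Eprod_upper m n (u : 'M[A]_(m, n)) : Eprod (block_mx 1%:M u 0 1%:M).
Proof.
pose Q (u : 'M[A]_(m, n)) := Eprod (block_mx 1%:M u 0 1%:M).
have QD v w : Q v -> Q w -> Q (v + w).
  by move=> Qv Qw; rewrite /Q block_unit_upperD; apply: Eprod_mul.
have Q0 : Q 0 by rewrite /Q -scalar_mx_block; apply: Eprod1.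
rewrite -/(Q u) [u]matrix_sum_delta.
apply: (big_ind Q) => // i _; apply: (big_ind Q) => // j _.
apply: elementary_Eprod; exists (lshift n i), (rshift m j), (u i j); split.
  by rewrite eq_lrshift.
apply/matrixP=> k l; rewrite !mxE.
case: (split_ordP k) => k' ->; rewrite !mxE; case: (split_ordP l) => l' ->;
  rewrite !mxE ?(inj_eq (@lshift_inj _ _)) ?(inj_eq (@rshift_inj _ _)) //
    ?eq_lrshift ?eq_rlshift ?andbF /= ?mulr0 ?mulr0n ?addr0 ?add0r //.
Qed.

Lemma Eprod_lower m n (u : 'M[A]_(n, m)) : Eprod (block_mx 1%:M 0 u 1%:M).
Proof.
pose Q (u : 'M[A]_(n, m)) := Eprod (block_mx 1%:M 0 u 1%:M).
have QD v w : Q v -> Q w -> Q (v + w).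
  by move=> Qv Qw; rewrite /Q block_unit_lowerD; apply: Eprod_mul.
have Q0 : Q 0 by rewrite /Q -scalar_mx_block; apply: Eprod1.
rewrite -/(Q u) [u]matrix_sum_delta.
apply: (big_ind Q) => // i _; apply: (big_ind Q) => // j _.
apply: elementary_Eprod; exists (rshift m i), (lshift n j), (u i j); split.
  by rewrite eq_rlshift.
apply/matrixP=> k l; rewrite !mxE.
case: (split_ordP k) => k' ->; rewrite !mxE; case: (split_ordP l) => l' ->;
  rewrite !mxE ?(inj_eq (@lshift_inj _ _)) ?(inj_eq (@rshift_inj _ _)) //
    ?eq_lrshift ?eq_rlshift ?andbF /= ?mulr0 ?mulr0n ?addr0 ?add0r //.
Qed.

Lemma mulmx_dsum m n (a c : 'M[A]_m) (b d : 'M[A]_n) :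
  (a <+> b) *m (c <+> d) = (a *m c) <+> (b *m d).
Proof. by rewrite mulmx_block !mul0mx !mulmx0 !addr0 !add0r. Qed.

Lemma dsum1 m n : 1%:M <+> 1%:M = 1%:M :> 'M[A]_(m + n).
Proof. by rewrite -scalar_mx_block. Qed.

Lemma Eprod_dsum1 n k (a : 'M[A]_n) : Eprod a -> Eprod (a <+> 1%:M : 'M[A]_(n + k)).
Proof.
elim=> [|e b [i [j [c [ij ->]]]] _ IH]; first by rewrite dsum1; apply: Eprod1.
rewrite -[X in _ <+> X]mulmx1 -mulmx_dsum; apply: EprodM => //.
exists (lshift k i), (lshift k j), c; split.
  by rewrite (inj_eq (@lshift_inj _ _)).
apply/matrixP=> p q; rewrite !mxE.
case: (split_ordP p) => p' ->; rewrite !mxE; case: (split_ordP q) => q' ->;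
  rewrite !mxE ?(inj_eq (@lshift_inj _ _)) ?(inj_eq (@rshift_inj _ _)) //
    ?eq_lrshift ?eq_rlshift ?andbF /= ?mulr0 ?mulr0n ?addr0 ?add0r //.
Qed.

(** With [b] the inverse of [a], the first three factors multiply to the block matrix with rows
    [(0, a)] and [(-b, 0)]; the same word in [-1], [1], [-1] then rotates it to the diagonal. *)
Lemma Eprod_dsum_inv n (a b : 'M[A]_n) : a *m b = 1%:M -> b *m a = 1%:M ->
  Eprod (a <+> b).
Proof.
move=> ab ba.
have -> : a <+> b = block_mx 1%:M a 0 1%:M *m block_mx 1%:M 0 (- b) 1%:M
    *m block_mx 1%:M a 0 1%:M
    *m (block_mx 1%:M (- 1%:M) 0 1%:M *m block_mx 1%:M 0 1%:M 1%:M
        *m block_mx 1%:M (- 1%:M) 0 1%:M).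
  rewrite !mulmx_block !(mul1mx, mulmx1, mul0mx, mulmx0, addr0, add0r, mulmxN, mulNmx).
  rewrite ab ba !(subrr, addNr, addr0, add0r, mul0mx, mulmx0, mul1mx, mulmx1, oppr0, opprK).
  by rewrite mulmxN mulmx1 opprK.
by do !apply: Eprod_mul; first [apply: Eprod_upper|apply: Eprod_lower].
Qed.


(** Entries of the infinite matrix diag([a], 1, 1, ...), indexed by [nat], so that matrices of
    different sizes are compared without casts. *)
Definition mxext n (a : 'M[A]_n) (i j : nat) : A :=
  if insub i is Some i' then
    (if insub j is Some j' then a i' j' else (i == j)%:R) else (i == j)%:R.

(** The leading [N] by [N] corner of diag([a], 1, 1, ...). For [N < n] it truncates [a], hence the
    bounds [n <= N] below. *)
Definition pad N n (a : 'M[A]_n) : 'M[A]_N := \matrix_(i, j) mxext a i j.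

Lemma mxext_ord n (a : 'M[A]_n) (i j : 'I_n) : mxext a i j = a i j.
Proof. by rewrite /mxext !valK. Qed.

Lemma mxext_out n (a : 'M[A]_n) (i j : nat) :
  ~~ ((i < n) && (j < n))%N -> mxext a i j = (i == j)%:R.
Proof.
by rewrite /mxext negb_and; do 2?case: insubP => //= ? -> // _.
Qed.

Lemma pad_dsum n k (a : 'M[A]_n) : pad (n + k) a = a <+> 1%:M.
Proof.
apply/matrixP=> p q; rewrite !mxE.
case: (split_ordP p) => p' ->; rewrite !mxE; case: (split_ordP q) => q' ->;
  rewrite ?mxE /=.
- by rewrite mxext_ord.
- rewrite mxext_out; last by rewrite /= (ltnNge (n + _)%N) leq_addr ?andbF.
  by rewrite ltn_eqF // (leq_trans (ltn_ord p')) // leq_addr.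
- rewrite mxext_out; last by rewrite /= (ltnNge (n + _)%N) leq_addr ?andbF.
  by rewrite gtn_eqF // (leq_trans (ltn_ord q')) // leq_addr.
- rewrite mxext_out; last by rewrite /= (ltnNge (n + _)%N) leq_addr ?andbF.
  by rewrite eqn_add2l.
Qed.

Lemma pad_id n (a : 'M[A]_n) : pad n a = a.
Proof. by apply/matrixP=> i j; rewrite mxE mxext_ord. Qed.

Lemma mxext_pad N n (a : 'M[A]_n) : (n <= N)%N -> mxext (pad N a) =2 mxext a.
Proof.
move=> nN i j; case: (boolP ((i < N) && (j < N))%N) => [/andP[iN jN]|H].
  by rewrite (mxext_ord (pad N a) (Ordinal iN) (Ordinal jN)) mxE.
rewrite !mxext_out //; apply: contra H => /andP[i_n j_n].
by rewrite !(leq_trans _ nN).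
Qed.

Lemma padK N N' n (a : 'M[A]_n) : (n <= N)%N -> pad N' (pad N a) = pad N' a.
Proof. by move=> nN; apply/matrixP=> i j; rewrite !mxE mxext_pad. Qed.

Lemma leq_exists_add n N : (n <= N)%N -> exists k, N = (n + k)%N.
Proof. by move=> nN; exists (N - n)%N; rewrite subnKC. Qed.

Lemma padM N n (a b : 'M[A]_n) : (n <= N)%N -> pad N (a *m b) = pad N a *m pad N b.
Proof.
by case/leq_exists_add=> k ->; rewrite !pad_dsum mulmx_dsum mulmx1.
Qed.

Lemma pad1 N n : pad N (1%:M : 'M[A]_n) = 1%:M.
Proof.
apply/matrixP=> i j; rewrite !mxE.
case: (boolP ((i < n) && (j < n))%N) => [/andP[iN jN]|H].
  by rewrite (mxext_ord _ (Ordinal iN) (Ordinal jN)) mxE.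
by rewrite mxext_out.
Qed.

Lemma pad_Eprod N n (a : 'M[A]_n) : (n <= N)%N -> Eprod a -> Eprod (pad N a).
Proof. by case/leq_exists_add=> k -> Ea; rewrite pad_dsum; apply: Eprod_dsum1. Qed.

(** Equality modulo E_oo(A) for matrices of possibly different sizes, the elementary factor acting
    on the left in a common size [N]. *)
Definition k1rel n m (a : 'M[A]_n) (b : 'M[A]_m) : Prop :=
  exists N (e : 'M[A]_N), [/\ (n <= N)%N, (m <= N)%N, Eprod e & pad N a = e *m pad N b].

Lemma k1rel_ge N0 n m (a : 'M[A]_n) (b : 'M[A]_m) : k1rel a b ->
  exists N (e : 'M[A]_N),
   [/\ (n <= N)%N, (m <= N)%N, (N0 <= N)%N, Eprod e & pad N a = e *m pad N b].
Proof.
case=> N [e [nN mN Ee eq]]; have le : (N <= N + N0)%N by apply: leq_addr.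
exists (N + N0)%N, (pad (N + N0) e); split=> //.
- exact: leq_trans le.
- exact: leq_trans le.
- exact: leq_addl.
- exact: pad_Eprod.
- by rewrite -(padK _ a nN) eq padM // padK.
Qed.

Lemma k1rel_refl n (a : 'M[A]_n) : k1rel a a.
Proof. by exists n, 1%:M; split=> //; [apply: Eprod1|rewrite mul1mx]. Qed.

Lemma k1rel_sym n m (a : 'M[A]_n) (b : 'M[A]_m) : k1rel a b -> k1rel b a.
Proof.
case=> N [e [nN mN Ee eq]]; have [f [Ef ef fe]] := Eprod_inv Ee.
by exists N, f; split=> //; rewrite eq mulmxA fe mul1mx.
Qed.

Lemma k1rel_trans n m p (b : 'M[A]_m) (a : 'M[A]_n) (c : 'M[A]_p) :
  k1rel a b -> k1rel b c -> k1rel a c.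
Proof.
case=> N [e [nN mN Ee eq]] /(k1rel_ge N)[N' [e' [mN' pN' NN' Ee' eq']]].
exists N', (pad N' e *m e'); split=> //; first exact: leq_trans NN'.
  by apply: Eprod_mul => //; apply: pad_Eprod.
by rewrite -(padK _ a nN) eq padM // padK // eq' mulmxA.
Qed.

Lemma k1rel_ext n m (a : 'M[A]_n) (b : 'M[A]_m) : mxext a =2 mxext b -> k1rel a b.
Proof.
move=> ab; exists (n + m)%N, 1%:M; split; rewrite ?leq_addr ?leq_addl //.
  exact: Eprod1.
by rewrite mul1mx; apply/matrixP=> i j; rewrite !mxE ab.
Qed.

(* Stably, conjugation by [a] is conjugation by the elementary [a <+> a^-1]. *)
Lemma Eprod_conj n (a b e : 'M[A]_n) : a *m b = 1%:M -> b *m a = 1%:M ->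
  Eprod e -> Eprod ((a *m e *m b) <+> 1%:M : 'M[A]_(n + n)).
Proof.
move=> ab ba Ee.
have -> : (a *m e *m b) <+> 1%:M = (a <+> b) *m (e <+> 1%:M) *m (b <+> a).
  by rewrite !mulmx_dsum mulmx1 ba.
apply: Eprod_mul; last exact: Eprod_dsum_inv.
by apply: Eprod_mul; [apply: Eprod_dsum_inv|apply: Eprod_dsum1].
Qed.

(** From [a = e a'] and [b = f b'] one gets [a b = e (a' f a'^-1) a' b']. The size doubles because
    the conjugate of [f] is shown elementary after adding an identity block. *)
Lemma k1rel_mul n (a a' b b' : 'M[A]_n) : invertible_mx a' ->
  k1rel a a' -> k1rel b b' -> k1rel (a *m b) (a' *m b').
Proof.
case=> c [ac ca] [N [e [nN _ Ee eq]]] /(k1rel_ge N)[N' [f [nN' _ NN' Ef eq']]].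
have le : (N' <= N' + N')%N by apply: leq_addr.
exists (N' + N')%N, (pad _ e *m (pad N' a' *m f *m pad N' c <+> 1%:M)); split.
- exact: leq_trans le.
- exact: leq_trans le.
- apply: Eprod_mul; first by apply: pad_Eprod => //; apply: leq_trans le.
  by apply: Eprod_conj; rewrite // -padM // ?ac ?ca pad1.
- have -> : pad (N' + N') (a *m b) = pad (N' + N') (pad N' a *m pad N' b).
    by rewrite -padM // padK.
  have E : pad N' a = pad N' e *m pad N' a' by rewrite -(padK _ a nN) eq padM // padK.
  rewrite E eq' -pad_dsum.
  have -> : pad (N' + N') (a' *m b') = pad (N' + N') (pad N' a' *m pad N' b').
    by rewrite -padM // padK.
  rewrite -(padK (N' + N') e NN') -!(padM (N := N' + N') (n := N')) //; congr (pad _ _).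
  rewrite -!mulmxA; congr (_ *m (_ *m (_ *m _))).
  by rewrite mulmxA -padM // ca pad1 mul1mx.
Qed.

(** The commutator of [a] and [b], extended by an identity block, is a product of three matrices
    diag([u], [u^-1]), with [u] equal to [a], [b] and [a^-1 b^-1]. *)
Lemma k1relC n (a b : 'M[A]_n) : invertible_mx a -> invertible_mx b ->
  k1rel (a *m b) (b *m a).
Proof.
case=> a' [aa' a'a] [b' [bb' b'b]]; have le : (n <= n + n)%N by apply: leq_addr.
exists (n + n)%N, ((a <+> a') *m (b <+> b') *m ((a' *m b') <+> (b *m a))).
split=> //.
  do !apply: Eprod_mul; apply: Eprod_dsum_inv => //.
    by rewrite mulmxA -[X in X *m _]mulmxA b'b mulmx1.
  by rewrite mulmxA -[X in X *m _]mulmxA aa' mulmx1.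
rewrite !pad_dsum !mulmx_dsum mulmx1; congr (_ <+> _).
  by rewrite !mulmxA -[_ *m b' *m b]mulmxA b'b mulmx1 -[_ *m a' *m a]mulmxA a'a mulmx1.
by rewrite !mulmxA -[_ *m b' *m b]mulmxA b'b mulmx1 a'a.
Qed.

Lemma k1rel_pad N n (a : 'M[A]_n) : (n <= N)%N -> k1rel (pad N a) a.
Proof. by move=> nN; apply: k1rel_ext; apply: mxext_pad. Qed.

Lemma invertible_pad N n (a : 'M[A]_n) : (n <= N)%N ->
  invertible_mx a -> invertible_mx (pad N a).
Proof. by move=> nN [b [ab ba]]; exists (pad N b); rewrite -!padM // ab ba pad1. Qed.

Lemma k1rel_padM N1 N2 n m n' m' (a : 'M[A]_n) (b : 'M[A]_m)
    (a' : 'M[A]_n') (b' : 'M[A]_m') :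
  (n <= N1)%N -> (m <= N1)%N -> (n' <= N2)%N -> (m' <= N2)%N ->
  invertible_mx a' -> k1rel a a' -> k1rel b b' ->
  k1rel (pad N1 a *m pad N1 b) (pad N2 a' *m pad N2 b').
Proof.
move=> nN mN nN' mN' inva' aa' bb'; pose N0 := (N1 + N2)%N.
have le1 : (N1 <= N0)%N by apply: leq_addr.
have le2 : (N2 <= N0)%N by apply: leq_addl.
apply: (k1rel_trans (b := pad N0 (pad N1 a *m pad N1 b))).
  by apply/k1rel_sym/k1rel_pad.
apply: (k1rel_trans (b := pad N0 (pad N2 a' *m pad N2 b'))); last exact: k1rel_pad.
rewrite !padM // !padK //; apply: k1rel_mul.
- by apply: invertible_pad => //; apply: leq_trans le2.
- apply: (k1rel_trans (b := a)); first by apply: k1rel_pad; apply: leq_trans le1.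
  by apply: (k1rel_trans aa'); apply/k1rel_sym/k1rel_pad; apply: leq_trans le2.
- apply: (k1rel_trans (b := b)); first by apply: k1rel_pad; apply: leq_trans le1.
  by apply: (k1rel_trans bb'); apply/k1rel_sym/k1rel_pad; apply: leq_trans le2.
Qed.

Lemma in_Einf_k1rel n (a : 'M[A]_n) : in_Einf a <-> k1rel a (1%:M : 'M[A]_n).
Proof.
split=> [[k Ek]|[N [e [+ _ Ee]]]].
  exists (n + k)%N, (a <+> 1%:M); split; rewrite ?leq_addr //.
  by rewrite pad1 mulmx1 pad_dsum.
rewrite pad1 mulmx1 => /leq_exists_add[k eqN]; subst N.
by rewrite pad_dsum => eq; exists k; rewrite eq.
Qed.

End ElementaryProducts.

(** * K_1 as an abelian group, and the class of an invertible matrix *)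

Section K1Group.
Variable A : pzRingType.

(** The inverse is part of the data, so that negation in K_1 is given by exchanging the two
    components. *)
Definition invpair (x : {n : nat & ('M[A]_n * 'M[A]_n)%type}) : bool :=
  ((tagged x).1 *m (tagged x).2 == 1%:M) && ((tagged x).2 *m (tagged x).1 == 1%:M).

Definition GLpre := {x : {n : nat & ('M[A]_n * 'M[A]_n)%type} | invpair x}.

HB.instance Definition _ := Choice.on GLpre.

Definition GLmx (x : GLpre) : 'M[A]_(tag (val x)) := (tagged (val x)).1.

Definition GLrel (x y : GLpre) : bool := `[< k1rel (GLmx x) (GLmx y) >].

Lemma GLrel_refl : reflexive GLrel.
Proof. by move=> x; apply/asboolP; apply: k1rel_refl. Qed.
Lemma GLrel_sym : symmetric GLrel.
Proof.
by move=> x y; apply/idP/idP => h; apply: asboolT; apply: k1rel_sym (asboolW h).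
Qed.
Lemma GLrel_trans : transitive GLrel.
Proof.
by move=> y x z xy yz; apply: asboolT; apply: k1rel_trans (asboolW xy) (asboolW yz).
Qed.

Canonical GLequiv := EquivRel GLrel GLrel_refl GLrel_sym GLrel_trans.

Definition K1 := {eq_quot GLequiv}.
HB.instance Definition _ := Choice.on K1.
HB.instance Definition _ := EqQuotient.on K1.

Definition mkGL n (a b : 'M[A]_n) (h : invpair (Tagged _ (a, b))) : GLpre := Sub _ h.

Lemma mkGL_proof n (a b : 'M[A]_n) : a *m b = 1%:M -> b *m a = 1%:M ->
  invpair (Tagged (fun n => ('M[A]_n * 'M[A]_n)%type) (a, b)).
Proof. by rewrite /invpair /= => -> ->; rewrite !eqxx. Qed.


Lemma pi_K1P (x y : GLpre) : \pi_K1 x = \pi_K1 y <-> k1rel (GLmx x) (GLmx y).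
Proof.
split=> [/eqP|h]; first by rewrite eqmodE => /asboolP.
by apply/eqP; rewrite eqmodE; apply/asboolP.
Qed.

Definition GLsize (x : GLpre) : nat := tag (val x).
Definition GLinv (x : GLpre) : 'M[A]_(GLsize x) := (tagged (val x)).2.

Lemma GLmxV (x : GLpre) : GLmx x *m GLinv x = 1%:M.
Proof. by case/andP: (valP x) => /eqP. Qed.
Lemma GLVmx (x : GLpre) : GLinv x *m GLmx x = 1%:M.
Proof. by case/andP: (valP x) => _ /eqP. Qed.
Lemma GLmx_inv (x : GLpre) : invertible_mx (GLmx x).
Proof. by exists (GLinv x); rewrite GLmxV GLVmx. Qed.

Definition GLzero : GLpre := @mkGL 0 1%:M 1%:M (mkGL_proof (mulmx1 _) (mulmx1 _)).
Definition GLopp (x : GLpre) : GLpre := mkGL (mkGL_proof (GLVmx x) (GLmxV x)).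

Section Add.
Variables x y : GLpre.
Let N := maxn (GLsize x) (GLsize y).

Fact GLadd_proof1 :
  (pad N (GLmx x) *m pad N (GLmx y)) *m (pad N (GLinv y) *m pad N (GLinv x)) = 1%:M.
Proof.
rewrite mulmxA -[X in X *m _]mulmxA -padM ?leq_maxr // GLmxV pad1 mulmx1.
by rewrite -padM ?leq_maxl // GLmxV pad1.
Qed.

Fact GLadd_proof2 :
  (pad N (GLinv y) *m pad N (GLinv x)) *m (pad N (GLmx x) *m pad N (GLmx y)) = 1%:M.
Proof.
rewrite mulmxA -[X in X *m _]mulmxA -padM ?leq_maxl // GLVmx pad1 mulmx1.
by rewrite -padM ?leq_maxr // GLVmx pad1.
Qed.

Definition GLadd : GLpre := mkGL (mkGL_proof GLadd_proof1 GLadd_proof2).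
End Add.

Lemma GLaddE N x y : (GLsize x <= N)%N -> (GLsize y <= N)%N ->
  k1rel (GLmx (GLadd x y)) (pad N (GLmx x) *m pad N (GLmx y)).
Proof.
move=> xN yN; apply: k1rel_padM; rewrite ?leq_maxl ?leq_maxr //;
  do ?exact: k1rel_refl; exact: GLmx_inv.
Qed.

Definition K1add (u v : K1) : K1 := \pi_K1 (GLadd (repr u) (repr v)).
Definition K1opp (u : K1) : K1 := \pi_K1 (GLopp (repr u)).
Definition K1zero : K1 := \pi_K1 GLzero.

Lemma pi_add x y : \pi_K1 (GLadd x y) = K1add (\pi_K1 x) (\pi_K1 y).
Proof.
apply/pi_K1P; apply: k1rel_padM; rewrite ?leq_maxl ?leq_maxr //;
  try exact: GLmx_inv; by apply/pi_K1P; rewrite reprK.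
Qed.

Lemma K1addC : commutative K1add.
Proof.
elim/quotW=> x; elim/quotW=> y; rewrite -!pi_add; apply/pi_K1P.
pose N := (GLsize x + GLsize y)%N.
have xN : (GLsize x <= N)%N by apply: leq_addr.
have yN : (GLsize y <= N)%N by apply: leq_addl.
apply: (k1rel_trans (GLaddE xN yN)).
apply: (k1rel_trans _ (k1rel_sym (GLaddE yN xN))).
by apply: k1relC; apply: invertible_pad => //; apply: GLmx_inv.
Qed.

Lemma K1addA : associative K1add.
Proof.
elim/quotW=> x; elim/quotW=> y; elim/quotW=> z.
rewrite -(pi_add y z) -(pi_add x y) -(pi_add x) -(pi_add _ z); apply/pi_K1P.
pose N := (GLsize x + GLsize y + GLsize z)%N.
have xN : (GLsize x <= N)%N by rewrite /N -addnA leq_addr.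
have yN : (GLsize y <= N)%N by rewrite /N addnAC leq_addl.
have zN : (GLsize z <= N)%N by apply: leq_addl.
have yzN : (GLsize (GLadd y z) <= N)%N by rewrite geq_max yN.
have xyN : (GLsize (GLadd x y) <= N)%N by rewrite geq_max xN.
apply: (k1rel_trans (GLaddE xN yzN)).
apply: (k1rel_trans _ (k1rel_sym (GLaddE xyN zN))).
rewrite /= !padM ?geq_max ?xN ?yN ?zN // !padK ?leq_maxl ?leq_maxr // mulmxA.
exact: k1rel_refl.
Qed.

Lemma K1add0 : left_id K1zero K1add.
Proof.
elim/quotW=> x; rewrite /K1zero -(pi_add GLzero x); apply/pi_K1P.
apply: (k1rel_trans (@GLaddE _ GLzero x (leq0n _) (leqnn (GLsize x)))).
by rewrite pad1 mul1mx pad_id; apply: k1rel_refl.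
Qed.

Lemma K1addN : left_inverse K1zero K1opp K1add.
Proof.
move=> u; rewrite -[X in K1add _ X]reprK -(pi_add (GLopp (repr u)) (repr u)).
apply/pi_K1P.
apply: (k1rel_trans (@GLaddE _ (GLopp (repr u)) (repr u) (leqnn _) (leqnn (GLsize (repr u))))).
have H : k1rel (GLinv (repr u) *m GLmx (repr u)) (GLmx GLzero).
  rewrite GLVmx; have := @k1rel_pad A (GLsize (repr u)) 0 1%:M (leq0n _).
  by rewrite pad1.
by rewrite !pad_id; exact: H.
Qed.

HB.instance Definition _ := GRing.isZmodule.Build K1 K1addA K1addC K1add0 K1addN.

(* Junk value [0] on matrices that are not invertible. *)
Definition chi n (a : 'M[A]_n) : K1 :=
  match pselect (invertible_mx a) with
  | left h => \pi_K1 (mkGL (let: conj p q := projT2 (cid h) in mkGL_proof p q))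
  | right _ => 0
  end.


Lemma chi_spec n (a : 'M[A]_n) : invertible_mx a ->
  exists x : GLpre, chi a = \pi_K1 x /\ k1rel (GLmx x) a.
Proof.
rewrite /chi; case: pselect => // h _; eexists; split; first reflexivity.
exact: k1rel_refl.
Qed.

Lemma chi_eqP n m (a : 'M[A]_n) (b : 'M[A]_m) : invertible_mx a -> invertible_mx b ->
  chi a = chi b <-> k1rel a b.
Proof.
move=> /chi_spec[x [-> xa]] /chi_spec[y [-> yb]]; rewrite pi_K1P.
split=> h; first exact: (k1rel_trans (k1rel_sym xa) (k1rel_trans h yb)).
exact: (k1rel_trans xa (k1rel_trans h (k1rel_sym yb))).
Qed.

Lemma invertible_mulmx n (a b : 'M[A]_n) :
  invertible_mx a -> invertible_mx b -> invertible_mx (a *m b).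
Proof.
move=> [a' [aa' a'a]] [b' [bb' b'b]]; exists (b' *m a'); split.
  by rewrite mulmxA -[X in X *m _]mulmxA bb' mulmx1.
by rewrite mulmxA -[X in X *m _]mulmxA a'a mulmx1.
Qed.

Lemma invertible_mx1 n : invertible_mx (1%:M : 'M[A]_n).
Proof. by exists 1%:M; rewrite mulmx1. Qed.

Lemma invertible_Eprod n (e : 'M[A]_n) : Eprod e -> invertible_mx e.
Proof. by case/Eprod_inv=> b [_ ? ?]; exists b. Qed.

Lemma chiM n (a b : 'M[A]_n) : invertible_mx a -> invertible_mx b ->
  chi (a *m b) = chi a + chi b.
Proof.
move=> inva invb; have [z [-> zab]] := chi_spec (invertible_mulmx inva invb).
have [x [-> xa]] := chi_spec inva; have [y [-> yb]] := chi_spec invb.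
rewrite -[RHS]/(K1add _ _) -(pi_add x y); apply/pi_K1P; apply: (k1rel_trans zab).
rewrite -[a]pad_id -[b]pad_id.
by apply: k1rel_padM; rewrite ?leq_maxl ?leq_maxr //;
   [apply: GLmx_inv|apply: k1rel_sym..].
Qed.

Lemma chi1 n : chi (1%:M : 'M[A]_n) = 0.
Proof.
have := chiM (@invertible_mx1 n) (@invertible_mx1 n).
by rewrite mulmx1 => /eqP; rewrite -subr_eq0 opprD addrA subrr sub0r oppr_eq0 => /eqP.
Qed.

Lemma chi_eq0 n (a : 'M[A]_n) : invertible_mx a -> chi a = 0 <-> in_Einf a.
Proof.
move=> inva; rewrite -(chi1 n) in_Einf_k1rel; apply: chi_eqP => //.
exact: invertible_mx1.
Qed.

Lemma chi_Eprod n (e : 'M[A]_n) : Eprod e -> chi e = 0.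
Proof.
move=> Ee; apply/chi_eq0; first exact: invertible_Eprod.
by exists 0; apply: Eprod_dsum1.
Qed.

Lemma chi_EprodMl n (e a : 'M[A]_n) : Eprod e -> invertible_mx a ->
  chi (e *m a) = chi a.
Proof. by move=> Ee inva; rewrite chiM ?(chi_Eprod Ee) ?add0r //; apply: invertible_Eprod. Qed.

Lemma chi_EprodMr n (e a : 'M[A]_n) : Eprod e -> invertible_mx a ->
  chi (a *m e) = chi a.
Proof. by move=> Ee inva; rewrite chiM ?(chi_Eprod Ee) ?addr0 //; apply: invertible_Eprod. Qed.

Lemma chiV n (a b : 'M[A]_n) : a *m b = 1%:M -> b *m a = 1%:M -> chi b = - chi a.
Proof.
move=> ab ba; apply/eqP; rewrite -addr_eq0 -chiM ?ba ?chi1 //.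
  by exists a.
by exists b.
Qed.

Lemma invertible_dsum n m (a : 'M[A]_n) (b : 'M[A]_m) :
  invertible_mx a -> invertible_mx b -> invertible_mx (a <+> b).
Proof.
move=> [a' [aa' a'a]] [b' [bb' b'b]]; exists (a' <+> b').
by rewrite !mulmx_dsum aa' bb' a'a b'b dsum1.
Qed.

Lemma chi_dsum1 n k (a : 'M[A]_n) : invertible_mx a ->
  chi (a <+> 1%:M : 'M[A]_(n + k)) = chi a.
Proof.
move=> inva; apply/chi_eqP => //; first exact: (invertible_dsum inva (invertible_mx1 k)).
by rewrite -pad_dsum; apply: k1rel_pad; apply: leq_addr.
Qed.

(** * The swap identity [1 + u v] = [1 + v u] *)

Section Whitehead.
Variables (m n : nat) (u : 'M[A]_(m, n)) (v : 'M[A]_(n, m)).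

Lemma invertible_swap : invertible_mx (1%:M + u *m v) -> invertible_mx (1%:M + v *m u).
Proof.
case=> c [ac ca]; exists (1%:M - v *m c *m u); split.
  rewrite mulmxBr mulmx1 mulmxDl mul1mx.
  have -> : v *m u *m (v *m c *m u) = v *m (u *m v *m c) *m u by rewrite !mulmxA.
  have -> : u *m v *m c = 1%:M - c by rewrite -ac mulmxDl mul1mx addrAC subrr add0r.
  by rewrite mulmxBr mulmx1 mulmxBl [X in _ - X]addrC subrK addrK.
rewrite mulmxBl mul1mx mulmxDr mulmx1.
have -> : v *m c *m u *m (v *m u) = v *m (c *m (u *m v)) *m u by rewrite !mulmxA.
have -> : c *m (u *m v) = 1%:M - c by rewrite -ca mulmxDr mulmx1 addrAC subrr add0r.
by rewrite mulmxBr mulmx1 mulmxBl [X in _ - X]addrC subrK addrK.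
Qed.

Lemma chi_swap_dsum : invertible_mx (1%:M + u *m v) ->
  chi (1%:M + u *m v) = chi (1%:M <+> (1%:M + v *m u) : 'M[A]_(m + n)).
Proof.
move=> inva; have invb := invertible_swap inva.
(* Both sides equal the block matrix with rows [(1, u)] and [(-v, 1)]. *)
have E : block_mx 1%:M u 0 1%:M *m (((1%:M + u *m v) <+> 1%:M) *m block_mx 1%:M 0 (- v) 1%:M)
       = block_mx 1%:M 0 (- v) 1%:M *m ((1%:M <+> (1%:M + v *m u)) *m block_mx 1%:M u 0 1%:M).
  rewrite !mulmx_block !(mul1mx, mulmx1, mul0mx, mulmx0, addr0, add0r, mulmxN, mulNmx).
  by rewrite addrK addrCA addNr addr0.
have Eu := Eprod_upper u; have Ev := Eprod_lower (- v).
have I1 := invertible_dsum inva (invertible_mx1 n).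
have I2 := invertible_dsum (invertible_mx1 m) invb.
have J1 := invertible_mulmx I1 (invertible_Eprod Ev).
have J2 := invertible_mulmx I2 (invertible_Eprod Eu).
rewrite -(chi_dsum1 n inva) -(chi_EprodMr Ev I1) -(chi_EprodMl Eu J1) E.
by rewrite chi_EprodMl // chi_EprodMr.
Qed.
End Whitehead.

Lemma chi_1dsum_eq n (c : 'M[A]_n) : invertible_mx c ->
  chi (1%:M <+> c : 'M[A]_(n + n)) = chi c.
Proof.
have E : 1%:M + (c - 1%:M) *m 1%:M = c by rewrite mulmx1 addrC subrK.
move=> invc; rewrite -{2}E (chi_swap_dsum (u := c - 1%:M)) ?E //.
by rewrite mul1mx addrC subrK.
Qed.

Lemma chi_1dsum_cast k k' n (c : 'M[A]_n) : k = k' ->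
  chi (1%:M <+> c : 'M[A]_(k + n)) = chi (1%:M <+> c : 'M[A]_(k' + n)).
Proof. by move=> ->. Qed.

(** The matrices [p] and [q] exchange the two blocks. The swap identity turns this exchange into an
    equality of classes, at the price of an identity block as large as [a]; [chi_1dsum_eq] removes
    that block. *)
Lemma chi_1dsum k n (c : 'M[A]_n) : invertible_mx c ->
  chi (1%:M <+> c : 'M[A]_(k + n)) = chi c.
Proof.
move=> invc; pose a : 'M[A]_(k + n) := 1%:M <+> c; pose b : 'M[A]_(n + k) := c <+> 1%:M.
pose p : 'M[A]_(n + k, k + n) := block_mx 0 1%:M 1%:M 0.
pose q : 'M[A]_(k + n, n + k) := block_mx 0 1%:M 1%:M 0.
have pq : p *m q = 1%:M.
  by rewrite mulmx_block !(mul1mx, mulmx1, mul0mx, mulmx0, addr0, add0r) dsum1.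
have qp : q *m p = 1%:M.
  by rewrite mulmx_block !(mul1mx, mulmx1, mul0mx, mulmx0, addr0, add0r) dsum1.
have paq : 1%:M + p *m (a - 1%:M) *m q = b.
  rewrite mulmxBr mulmxBl mulmx1 pq addrC subrK.
  by rewrite !mulmx_block !(mul1mx, mulmx1, mul0mx, mulmx0, addr0, add0r).
have inva : invertible_mx a by apply: invertible_dsum => //; apply: invertible_mx1.
have invb : invertible_mx b by apply: invertible_dsum => //; apply: invertible_mx1.
have := @chi_swap_dsum _ _ (p *m (a - 1%:M)) q; rewrite paq => /(_ invb).
rewrite mulmxA qp mul1mx [1%:M + _]addrC subrK => E.
rewrite -[RHS](chi_dsum1 k invc) -/b E.
by rewrite (chi_1dsum_cast _ (addnC n k)) chi_1dsum_eq.
Qed.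

(** The two matrices are invertible simultaneously, and otherwise both classes take the default
    value 0. *)
Lemma chi_swap m n (u : 'M[A]_(m, n)) (v : 'M[A]_(n, m)) :
  chi (1%:M + u *m v) = chi (1%:M + v *m u).
Proof.
case: (pselect (invertible_mx (1%:M + u *m v))) => [inva|ninva].
  by rewrite chi_swap_dsum // chi_1dsum //; apply: invertible_swap.
rewrite {1}/chi; case: pselect => // _; rewrite /chi; case: pselect => // invb.
by case: ninva; apply: invertible_swap.
Qed.

Lemma chi_lower m n (a : 'M[A]_m) (c : 'M[A]_(n, m)) (d : 'M[A]_n) :
  invertible_mx a -> invertible_mx d -> chi (block_mx a 0 c d) = chi a + chi d.
Proof.
move=> inva invd; have [a' [aa' a'a]] := inva.
have -> : block_mx a 0 c d
    = block_mx 1%:M 0 (c *m a') 1%:M *m ((a <+> 1%:M) *m (1%:M <+> d)).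
  rewrite !mulmx_block !(mul1mx, mulmx1, mul0mx, mulmx0, addr0, add0r).
  by rewrite -mulmxA a'a mulmx1.
have I1 := invertible_dsum inva (invertible_mx1 n).
have I2 := invertible_dsum (invertible_mx1 m) invd.
rewrite (chi_EprodMl (Eprod_lower _) (invertible_mulmx I1 I2)).
by rewrite chiM // chi_dsum1 // chi_1dsum.
Qed.

Lemma invertible_lower m n (a : 'M[A]_m) (c : 'M[A]_(n, m)) (d : 'M[A]_n) :
  invertible_mx a -> invertible_mx d -> invertible_mx (block_mx a 0 c d).
Proof.
move=> [a' [aa' a'a]] [d' [dd' d'd]]; exists (block_mx a' 0 (- (d' *m c *m a')) d').
rewrite !mulmx_block !(mul0mx, mulmx0, addr0, add0r) aa' dd' a'a d'd.
rewrite mulmxN !mulmxA dd' mul1mx subrr -dsum1; split=> //.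
by rewrite mulNmx -(mulmxA _ a') a'a mulmx1 addNr.
Qed.

End K1Group.

(** * Functoriality in the ring *)

Lemma Eprod_map (A B : pzRingType) (f : {rmorphism A -> B}) n (e : 'M[A]_n) :
  Eprod e -> Eprod (map_mx f e).
Proof.
elim=> [|c a [i [j [t [ij ->]]]] _ IH]; first by rewrite map_mx1; apply: Eprod1.
rewrite map_mxM; apply: EprodM => //; exists i, j, (f t); split=> //.
by rewrite map_mxD map_mx1 map_mxZ map_delta_mx.
Qed.

Lemma invertible_map (A B : pzRingType) (f : {rmorphism A -> B}) n (a : 'M[A]_n) :
  invertible_mx a -> invertible_mx (map_mx f a).
Proof. by move=> [b [ab ba]]; exists (map_mx f b); rewrite -!map_mxM ab ba map_mx1. Qed.

Lemma map_pad (A B : pzRingType) (f : {rmorphism A -> B}) N n (a : 'M[A]_n) :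
  map_mx f (pad N a) = pad N (map_mx f a).
Proof.
apply/matrixP=> i j; rewrite !mxE /mxext.
by do 2?case: insubP => *; rewrite ?mxE ?rmorph_nat.
Qed.

Lemma chi_map_eq (A B : pzRingType) (f : {rmorphism A -> B}) n m
    (a : 'M[A]_n) (b : 'M[A]_m) : invertible_mx a -> invertible_mx b ->
  chi a = chi b -> chi (map_mx f a) = chi (map_mx f b).
Proof.
move=> inva invb /(chi_eqP inva invb)[N [e [nN mN Ee eq]]].
apply/chi_eqP; try exact: invertible_map.
exists N, (map_mx f e); split=> //; first exact: Eprod_map.
by rewrite -!map_pad eq map_mxM.
Qed.

(** * Monoid rings *)

(* The operations are locked because a failing conversion test between ring
   elements would otherwise unfold them down to finite maps. *)
Fact mring_key : unit. Proof. by []. Qed.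

Definition mring (R : pzRingType) (G : monoidType) := {malg R[G]}.
HB.instance Definition _ (R : pzRingType) (G : monoidType) := Choice.on (mring R G).

Section MonoidRing.
Variables (R : pzRingType) (G : monoidType).
Implicit Types (u v w : mring R G) (a b : R) (g h : G).

Definition madd : mring R G -> mring R G -> mring R G :=
  locked_with mring_key (fun u v : {malg R[G]} => u + v).
Definition mopp : mring R G -> mring R G :=
  locked_with mring_key (fun u : {malg R[G]} => - u).
Definition mU : G -> R -> mring R G := locked_with mring_key (fun g a => << a *g g >>).
Definition mc : mring R G -> G -> R := locked_with mring_key (fun (u : {malg R[G]}) g => u@_g).

Fact maddE (u v : {malg R[G]}) : madd u v = u + v. Proof. by rewrite /madd locked_withE. Qed.
Fact moppE (u : {malg R[G]}) : mopp u = - u. Proof. by rewrite /mopp locked_withE. Qed.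
Fact mUE g a : mU g a = << a *g g >>. Proof. by rewrite /mU locked_withE. Qed.
Fact mcE (u : {malg R[G]}) g : mc u g = u@_g. Proof. by rewrite /mc locked_withE. Qed.

Fact maddA : associative madd. Proof. by move=> u v w; rewrite !maddE addrA. Qed.
Fact maddC : commutative madd. Proof. by move=> u v; rewrite !maddE addrC. Qed.
Fact madd0 : left_id (mU 1%g 0) madd.
Proof. by move=> u; rewrite maddE mUE monalgU0 add0r. Qed.
Fact maddN : left_inverse (mU 1%g 0) mopp madd.
Proof. by move=> u; rewrite maddE moppE mUE monalgU0 addNr. Qed.
HB.instance Definition _ := GRing.isZmodule.Build (mring R G) maddA maddC madd0 maddN.

Lemma mring_eq u v : (forall g, mc u g = mc v g) -> u = v.
Proof. by move=> H; apply/malgP => g; have := H g; rewrite !mcE. Qed.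

Lemma mcU g a h : mc (mU g a) h = if g == h then a else 0.
Proof. by rewrite mUE mcE mcoeffU; case: eqP; rewrite ?mulr1n ?mulr0n. Qed.
Lemma mcD u v g : mc (u + v) g = mc u g + mc v g.
Proof. by rewrite -[u + v]/(madd u v) maddE !mcE mcoeffD. Qed.
Lemma mc0 g : mc 0 g = 0. Proof. by rewrite -[0]/(mU 1%g 0) mcU; case: eqP. Qed.
Lemma mcN u g : mc (- u) g = - mc u g.
Proof. by rewrite -[- u]/(mopp u) moppE !mcE mcoeffN. Qed.
Lemma mUD g a b : mU g (a + b) = mU g a + mU g b.
Proof. by rewrite -[RHS]/(madd _ _) maddE !mUE monalgUD. Qed.
Lemma mU0 g : mU g 0 = 0.
Proof. by apply: mring_eq => h; rewrite mcU mc0; case: eqP. Qed.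
Lemma mUN g a : mU g (- a) = - mU g a.
Proof. by rewrite -[RHS]/(mopp _) moppE !mUE monalgUN. Qed.
Lemma mc_sum g I (r : seq I) (F : I -> mring R G) :
  mc (\sum_(i <- r) F i) g = \sum_(i <- r) mc (F i) g.
Proof. by apply: (big_morph (fun u => mc u g)) => [u v|]; [apply: mcD|apply: mc0]. Qed.

Lemma mring_ind (P : mring R G -> Prop) :
  (forall u v, P u -> P v -> P (u + v)) -> (forall g a, P (mU g a)) -> forall u, P u.
Proof.
move=> PD PU u; rewrite [u]monalgE; apply: (big_ind P) => [|v w Pv Pw|g _].
- by have := PU 1%g 0; rewrite mUE monalgU0.
- by rewrite -maddE; apply: PD.
- by rewrite -mUE.
Qed.

Section LinearExtension.
Variables (V : zmodType) (f : G -> R -> V).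
Hypothesis fD : forall g a b, f g (a + b) = f g a + f g b.

(** Extends [f] additively from the terms to the whole ring; the product and the morphisms out of a
    monoid ring are defined through it. *)
Definition mlin u : V := \sum_(g <- msupp u) f g (mc u g).

Lemma mlin_f0 g : f g 0 = 0.
Proof. by apply: (addrI (f g 0)); rewrite -fD !addr0. Qed.

Lemma mlin_supp u (d : {fset G}) : (msupp u `<=` d)%fset ->
  mlin u = \sum_(g <- d) f g (mc u g).
Proof.
move=> sub; apply: big_fset_incl => // g _ gu.
by rewrite mcE mcoeff_outdom // mlin_f0.
Qed.

Lemma mlinD u v : mlin (u + v) = mlin u + mlin v.
Proof.
have sub : (msupp ((u + v)%R : mring R G) `<=` msupp u `|` msupp v)%fset.
  by rewrite -[(u + v)%R]/(madd u v) maddE msuppD_le.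
rewrite (mlin_supp sub).
rewrite (mlin_supp (fsubsetUl (msupp u) (msupp v))).
rewrite (mlin_supp (fsubsetUr (msupp u) (msupp v))) -big_split /=.
by apply: eq_bigr => g _; rewrite mcD fD.
Qed.

Lemma mlinU g a : mlin (mU g a) = f g a.
Proof.
by rewrite (@mlin_supp _ [fset g]%fset) ?big_seq_fset1 ?mcU ?eqxx // mUE msuppU_le.
Qed.

End LinearExtension.

Definition mmul : mring R G -> mring R G -> mring R G := locked_with mring_key
  (fun u v => mlin (fun g a => mlin (fun h b => mU (g * h)%g (a * b)) v) u).
Fact mmulE u v : mmul u v = mlin (fun g a => mlin (fun h b => mU (g * h)%g (a * b)) v) u.
Proof. by rewrite /mmul locked_withE. Qed.

Fact mmul_inner g a : forall h b b', mU (g * h)%g (a * (b + b')) =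
  mU (g * h)%g (a * b) + mU (g * h)%g (a * b').
Proof. by move=> *; rewrite mulrDr mUD. Qed.

Fact mmul_outer v : forall g a a', mlin (fun h b => mU (g * h)%g ((a + a') * b)) v =
  mlin (fun h b => mU (g * h)%g (a * b)) v + mlin (fun h b => mU (g * h)%g (a' * b)) v.
Proof.
move=> g a a'; rewrite /mlin -big_split; apply: eq_bigr => h _ /=.
by rewrite mulrDl mUD.
Qed.

Lemma mmulDl : left_distributive mmul +%R.
Proof. by move=> u v w; rewrite !mmulE (mlinD (mmul_outer w)). Qed.

Lemma mmulDr : right_distributive mmul +%R.
Proof.
move=> u v w; elim/mring_ind: u => [u u' e e'|g a].
  by rewrite !mmulDl e e' addrACA.
by rewrite !mmulE !(mlinU (mmul_outer _)) (mlinD (mmul_inner g a)).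
Qed.

Lemma mmulUU g a h b : mmul (mU g a) (mU h b) = mU (g * h)%g (a * b).
Proof. by rewrite !mmulE (mlinU (mmul_outer _)) (mlinU (mmul_inner g a)). Qed.

Lemma mmulA : associative mmul.
Proof.
move=> u v w; elim/mring_ind: u => [u u' e e'|g a]; first by rewrite !mmulDl e e'.
elim/mring_ind: v => [v v' e e'|h b]; first by rewrite !(mmulDl, mmulDr) e e'.
elim/mring_ind: w => [w w' e e'|k c]; first by rewrite !mmulDr e e'.
by rewrite !mmulUU mulrA mulgA.
Qed.

Lemma mmul1u : left_id (mU 1%g 1) mmul.
Proof.
elim/mring_ind=> [u v e e'|g a]; first by rewrite mmulDr e e'.
by rewrite mmulUU mul1r mul1g.
Qed.

Lemma mmulu1 : right_id (mU 1%g 1) mmul.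
Proof.
elim/mring_ind=> [u v e e'|g a]; first by rewrite mmulDl e e'.
by rewrite mmulUU mulr1 mulg1.
Qed.

HB.instance Definition _ := GRing.Zmodule_isPzRing.Build (mring R G)
  mmulA mmul1u mmulu1 mmulDl mmulDr.

Lemma mU_mul g a h b : mU g a * mU h b = mU (g * h)%g (a * b).
Proof. exact: mmulUU. Qed.

Lemma mU_one : mU 1%g 1 = 1. Proof. by []. Qed.

Lemma mc_mul_mC u a g : mc (u * mU 1%g a) g = mc u g * a.
Proof.
elim/mring_ind: u => [u v e e'|h b]; first by rewrite mulrDl !mcD e e' mulrDl.
by rewrite mU_mul !mcU mulg1; case: eqP; rewrite ?mul0r.
Qed.

Lemma mring_central u : (forall g a, u * mU g a = mU g a * u) -> forall v, u * v = v * u.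
Proof.
by move=> H v; elim/mring_ind: v => [v w e e'|//]; rewrite mulrDl mulrDr e e'.
Qed.

Fact mC_additive : zmod_morphism (mU 1%g).
Proof. by move=> a b; rewrite mUD mUN. Qed.
Fact mC_monoid : monoid_morphism (mU 1%g).
Proof. by split=> // a b; rewrite mU_mul mulg1. Qed.
HB.instance Definition _ := GRing.isZmodMorphism.Build R (mring R G) (mU 1%g) mC_additive.
HB.instance Definition _ := GRing.isMonoidMorphism.Build R (mring R G) (mU 1%g) mC_monoid.

Definition mC : {rmorphism R -> mring R G} := mU 1%g.

Section Lift.
Variables (S : pzRingType) (f : {rmorphism R -> S}) (phi : G -> S).
Hypotheses (phi1 : phi 1%g = 1) (phiM : forall g h, phi (g * h)%g = phi g * phi h).
Hypothesis fphi : forall a g, f a * phi g = phi g * f a.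

(** The universal property of the monoid ring: as the images of the coefficients and of the monoid
    commute, this is a ring morphism, packaged as [mhom]. *)
Definition mlift u : S := mlin (fun g a => f a * phi g) u.

Fact mlift_inner : forall g a b, f (a + b) * phi g = f a * phi g + f b * phi g.
Proof. by move=> *; rewrite rmorphD mulrDl. Qed.

Fact mlift_additive : zmod_morphism mlift.
Proof.
move=> u v; apply: (canRL (addrK _)).
by rewrite -(mlinD mlift_inner) subrK.
Qed.

Lemma mliftU g a : mlift (mU g a) = f a * phi g. Proof. exact: mlinU mlift_inner _ _. Qed.

Fact mlift_monoid : monoid_morphism mlift.
Proof.
have mD u v : mlift (u + v) = mlift u + mlift v by exact: (mlinD mlift_inner).
split=> [|u v]; first by rewrite mliftU rmorph1 phi1 mulr1.
elim/mring_ind: u => [u u' e e'|g a]; first by rewrite mulrDl !mD e e' mulrDl.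
elim/mring_ind: v => [v v' e e'|h b]; first by rewrite mulrDr !mD e e' mulrDr.
rewrite mU_mul !mliftU rmorphM phiM -!mulrA; congr (_ * _).
by rewrite [RHS]mulrA -fphi mulrA.
Qed.

HB.instance Definition _ := GRing.isZmodMorphism.Build (mring R G) S mlift mlift_additive.
HB.instance Definition _ := GRing.isMonoidMorphism.Build (mring R G) S mlift mlift_monoid.

Definition mhom : {rmorphism mring R G -> S} := mlift.

Lemma mhomU g a : mhom (mU g a) = f a * phi g. Proof. exact: mliftU. Qed.

End Lift.

End MonoidRing.

Section MonoidRingNz.
Variables (R : nzRingType) (G : monoidType).
Fact mring_nz : (1 : mring R G) != 0.
Proof.
apply/negP=> /eqP/(congr1 (fun u => mc u 1%g)); rewrite -mU_one mcU eqxx mc0.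
by move/eqP; rewrite oner_eq0.
Qed.
HB.instance Definition _ := GRing.PzSemiRing_isNonZero.Build (mring R G) mring_nz.
End MonoidRingNz.

Section MonoidAlgebra.
Variables (K : comNzRingType) (G : monoidType).
Implicit Types (u v : mring K G) (a b : K).
Definition mscale a u : mring K G := mU 1%g a * u.
Fact mC_central a u : mU 1%g a * u = u * mU 1%g a.
Proof. by apply: mring_central => g b; rewrite !mU_mul mul1g mulg1 mulrC. Qed.
Fact mscaleA a b u : mscale a (mscale b u) = mscale (a * b) u.
Proof. by rewrite /mscale mulrA mU_mul mulg1. Qed.
Fact mscale1 : left_id 1 mscale. Proof. by move=> u; rewrite /mscale mU_one mul1r. Qed.
Fact mscaleDr : right_distributive mscale +%R.
Proof. by move=> a u v; rewrite /mscale mulrDr. Qed.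
Fact mscaleDl v : {morph mscale^~ v : a b / a + b}.
Proof. by move=> a b; rewrite /mscale mUD mulrDl. Qed.
HB.instance Definition _ := GRing.Zmodule_isLmodule.Build K (mring K G)
  mscaleA mscale1 mscaleDr mscaleDl.
Fact mscaleAl a u v : a *: (u * v) = (a *: u) * v.
Proof. by rewrite /GRing.scale /= /mscale mulrA. Qed.
HB.instance Definition _ := GRing.Lmodule_isLalgebra.Build K (mring K G) mscaleAl.
Fact mscaleAr a u v : a *: (u * v) = u * (a *: v).
Proof. by rewrite /GRing.scale /= /mscale mulrA mC_central -mulrA. Qed.
HB.instance Definition _ := GRing.Lalgebra_isAlgebra.Build K (mring K G) mscaleAr.
Lemma mscaleE a u : a *: u = mU 1%g a * u. Proof. by []. Qed.
End MonoidAlgebra.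

(** * Localisation: an abstract injectivity criterion on K_1 *)

Section RightLinear.
Variables (R M : pzRingType) (it : {rmorphism R -> M}).

Local Notation "W ^t" := (map_mx it W) (at level 2, format "W ^t").

(** [M] is regarded as a right [R]-module through [it]; [rlin] singles out its endomorphisms and
    [rfun] its linear functionals. *)
Definition rlin (H : M -> M) : Prop :=
  (forall a b, H (a + b) = H a + H b) /\ (forall m r, H (m * it r) = H m * it r).

Definition rfun (c : M -> R) : Prop :=
  (forall a b, c (a + b) = c a + c b) /\ (forall m r, c (m * it r) = c m * r).

(* Right [R]-linear maps [M^n -> M^p], applied to all columns of a matrix at once. *)
Record nop n p := Nop {
  nopf :> forall D, 'M[M]_(n, D) -> 'M[M]_(p, D);
  nopD : forall D (u v : 'M[M]_(n, D)), nopf (u + v) = nopf u + nopf v;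
  nopM : forall D D' (u : 'M[M]_(n, D)) (w : 'M[R]_(D, D')),
    nopf (u *m w^t) = nopf u *m w^t }.

(** Tuples of [p] functionals on [M^n]. As they apply to a whole matrix of columns, [V N U] is a
    square matrix over [R], and [1 + V N U] carries the class of the operator [1 + U V]. *)
Record nfun n p := Nfun {
  nfunf :> forall D, 'M[M]_(n, D) -> 'M[R]_(p, D);
  nfunD : forall D (u v : 'M[M]_(n, D)), nfunf (u + v) = nfunf u + nfunf v;
  nfunM : forall D D' (u : 'M[M]_(n, D)) (w : 'M[R]_(D, D')),
    nfunf (u *m w^t) = nfunf u *m w }.

Lemma add_fun0 (V W : zmodType) (f : V -> W) :
  (forall a b, f (a + b) = f a + f b) -> f 0 = 0.
Proof. by move=> fD; apply: (addrI (f 0)); rewrite -fD !addr0. Qed.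

Lemma add_funN (V W : zmodType) (f : V -> W) :
  (forall a b, f (a + b) = f a + f b) -> forall a, f (- a) = - f a.
Proof.
by move=> fD a; apply: (addrI (f a)); rewrite -fD !subrr (add_fun0 fD).
Qed.

Lemma add_fun_sum (V W : zmodType) (f : V -> W) I (r : seq I) (F : I -> V) :
  (forall a b, f (a + b) = f a + f b) -> f (\sum_(i <- r) F i) = \sum_(i <- r) f (F i).
Proof.
by move=> fD; apply: (big_morph f); [apply: fD|apply: add_fun0].
Qed.

Lemma nop_map_natural n H D D' (u : 'M[M]_(n, D)) (w : 'M[R]_(D, D')) : rlin H ->
  map_mx H (u *m w^t) = map_mx H u *m w^t.
Proof.
case=> HD HM; apply/matrixP=> i j; rewrite !mxE (add_fun_sum _ _ HD).
by apply: eq_bigr => k _; rewrite !mxE HM.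
Qed.

Definition nop_map n H (h : rlin H) : nop n n.
Proof.
exists (fun D v => map_mx H v) => [D u v|D D' u w].
  by apply/matrixP=> i j; rewrite !mxE h.1.
exact: nop_map_natural.
Defined.

Definition nop_id n : nop n n. Proof. by exists (fun D v => v). Defined.

Definition nop_mul n p (a : 'M[M]_(p, n)) : nop n p.
Proof.
by exists (fun D v => a *m v) => [D u v|D D' u w]; rewrite ?mulmxDr ?mulmxA.
Defined.

Definition nop_comp n p q (f : nop p q) (g : nop n p) : nop n q.
Proof.
by exists (fun D v => f D (g D v)) => [D u v|D D' u w]; rewrite ?nopD ?nopM.
Defined.

Definition nop_add n p (f g : nop n p) : nop n p.
Proof.
exists (fun D v => f D v + g D v) => [D u v|D D' u w].
  by rewrite !nopD addrACA.
by rewrite !nopM mulmxDl.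
Defined.

Definition nop_scale n (c : M) : nop n n.
Proof.
by exists (fun D v => c *: v) => [D u v|D D' u w]; rewrite ?scalerDr ?scalemxAl.
Defined.

Definition nfun_comp n p q (f : nfun p q) (g : nop n p) : nfun n q.
Proof.
by exists (fun D v => f D (g D v)) => [D u v|D D' u w];
   rewrite ?nopD ?nopM ?nfunD ?nfunM.
Defined.

Definition nfun_col n p q (f : nfun n p) (g : nfun n q) : nfun n (p + q).
Proof.
exists (fun D v => col_mx (f D v) (g D v)) => [D u v|D D' u w].
  by rewrite !nfunD add_col_mx.
by rewrite !nfunM mul_col_mx.
Defined.

(** Naturality in the number of columns, applied to the two block projections, shows that [f] acts
    column by column. *)
Lemma nfun_row n p D D' (f : nfun n p) (u : 'M[M]_(n, D)) (v : 'M[M]_(n, D')) :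
  f _ (row_mx u v) = row_mx (f _ u) (f _ v).
Proof.
rewrite -[LHS]hsubmxK; congr row_mx.
  have := nfunM f (row_mx u v) (col_mx 1%:M 0 : 'M[R]_(D + D', D)).
  rewrite map_col_mx map_mx1 map_mx0 mul_row_col mulmx1 mulmx0 addr0 => ->.
  by rewrite -[X in _ = X *m _]hsubmxK mul_row_col mulmx1 mulmx0 addr0.
have := nfunM f (row_mx u v) (col_mx 0 1%:M : 'M[R]_(D + D', D')).
rewrite map_col_mx map_mx1 map_mx0 mul_row_col mulmx1 mulmx0 add0r => ->.
by rewrite -[X in _ = X *m _]hsubmxK mul_row_col mulmx1 mulmx0 add0r.
Qed.

Definition nop_bnd n p N (U : 'M[M]_(p, N)) (V : nfun n N) : nop n p.
Proof.
exists (fun D v => U *m (V D v)^t) => [D u v|D D' u w].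
  by rewrite nfunD map_mxD mulmxDr.
by rewrite nfunM map_mxM mulmxA.
Defined.

Section ClassComp.
Variables (n N1 N2 : nat) (U1 : 'M[M]_(n, N1)) (V1 : nfun n N1).
Variables (U2 : 'M[M]_(n, N2)) (V2 : nfun n N2).

(** Data writing the product [(1 + U1 V1) (1 + U2 V2)] as a single [1 + U V]: the columns are [U1]
    and [U2], the functionals [V1 (1 + U2 V2)] and [V2]. *)
Definition comp_col : 'M[M]_(n, N1 + N2) := row_mx U1 U2.
Definition comp_fun : nfun n (N1 + N2) :=
  nfun_col (nfun_comp V1 (nop_add (nop_id n) (nop_bnd U2 V2))) V2.

Lemma comp_classE D (v : 'M[M]_(n, D)) :
  let w := v + U2 *m (V2 D v)^t in
  w + U1 *m (V1 D w)^t = v + comp_col *m (comp_fun D v)^t.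
Proof. by rewrite /= map_col_mx mul_row_col addrA addrAC. Qed.

(** An elementary factor splits off and leaves a block triangular matrix; hence the class of a
    product of perturbations is the sum of the classes. *)
Lemma comp_class_factor : 1%:M + comp_fun _ comp_col =
  block_mx 1%:M (V1 _ U2) 0 1%:M
    *m block_mx (1%:M + V1 _ U1) 0 (V2 _ U1) (1%:M + V2 _ U2).
Proof.
rewrite mulmx_block !(mul1mx, mul0mx, add0r) /comp_col [comp_fun _ _]/=.
rewrite !(nfun_row V2) map_row_mx mul_mx_row add_row_mx nfun_row.
rewrite -[col_mx (row_mx _ _) _]block_mxEv scalar_mx_block add_block_mx !add0r.
congr block_mx; last by rewrite mulmxDr mulmx1 nfunD nfunM.
by rewrite nfunD nfunM addrA.
Qed.

Hypothesis inv1 : invertible_mx (1%:M + V1 _ U1).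
Hypothesis inv2 : invertible_mx (1%:M + V2 _ U2).

Lemma invertible_comp_class : invertible_mx (1%:M + comp_fun _ comp_col).
Proof.
rewrite comp_class_factor; apply: invertible_mulmx; last exact: invertible_lower.
by apply: invertible_Eprod; apply: Eprod_upper.
Qed.

Lemma chi_comp_class :
  chi (1%:M + comp_fun _ comp_col) = chi (1%:M + V1 _ U1) + chi (1%:M + V2 _ U2).
Proof.
rewrite comp_class_factor (chi_EprodMl (Eprod_upper _) (invertible_lower _ inv1 inv2)).
exact: chi_lower.
Qed.

End ClassComp.

(** Finite-rank operators: those factoring through some free module [R^N]. *)
Definition bnd n p (C : forall D, 'M[M]_(n, D) -> 'M[M]_(p, D)) : Prop :=
  exists N (U : 'M[M]_(p, N)) (V : nfun n N), forall D v, C D v = U *m (V D v)^t.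

Lemma bnd_add n p C C' : @bnd n p C -> @bnd n p C' -> bnd (fun D v => C D v + C' D v).
Proof.
move=> [N [U [V e]]] [N' [U' [V' e']]].
exists (N + N')%N, (row_mx U U'), (nfun_col V V') => D v.
by rewrite /= map_col_mx mul_row_col e e'.
Qed.

Lemma bnd_left n p q (f : nop p q) C : @bnd n p C -> @bnd n q (fun D v => f D (C D v)).
Proof. by move=> [N [U [V e]]]; exists N, (f N U), V => D v; rewrite e nopM. Qed.

Lemma bnd_right n p q (f : nop n p) C : @bnd p q C -> @bnd n q (fun D v => C D (f D v)).
Proof. by move=> [N [U [V e]]]; exists N, U, (nfun_comp V f) => D v; rewrite e. Qed.

Lemma bnd_ext n p C C' : (forall D v, C D v = C' D v) -> @bnd n p C -> @bnd n p C'.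
Proof. by move=> eq [N [U [V e]]]; exists N, U, V => D v; rewrite -eq. Qed.

(** Finite rank for a map of [M] itself; [sbnd_bnd] passes to its entrywise action on [M^n]. *)
Definition sbnd (B : M -> M) : Prop :=
  exists N (b : 'I_N -> M) (c : 'I_N -> M -> R),
    (forall i, rfun (c i)) /\ forall m, B m = \sum_i b i * it (c i m).

Definition nfun_coord N (c : 'I_N -> M -> R) (h : forall i, rfun (c i)) : nfun 1 N.
Proof.
exists (fun D v => \matrix_(l, d) c l (v 0 d)) => [D u v|D D' u w].
  by apply/matrixP=> i j; rewrite !mxE (h _).1.
apply/matrixP=> i j; rewrite !mxE (add_fun_sum _ _ (h i).1).
by apply: eq_bigr => k _; rewrite !mxE (h _).2.
Defined.

Lemma sbnd_row B : sbnd B -> @bnd 1 1 (fun D v => map_mx B v).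
Proof.
move=> [N [b [c [hc e]]]]; exists N, (\row_l b l), (nfun_coord hc) => D v.
apply/matrixP=> i j; rewrite !mxE e ord1.
by apply: eq_bigr => l _; rewrite !mxE.
Qed.

Definition nfun_coords n N (c : 'I_N -> M -> R) (h : forall i, rfun (c i)) :
  nfun n #|{: 'I_n * 'I_N}|.
Proof.
exists (fun D (v : 'M[M]_(n, D)) => \matrix_(q, d) c (enum_val q).2 (v (enum_val q).1 d)) => [D u v|D D' u w].
  by apply/matrixP=> i j; rewrite !mxE (h _).1.
apply/matrixP=> i j; rewrite !mxE (add_fun_sum _ _ (h _).1).
by apply: eq_bigr => k _; rewrite !mxE (h _).2.
Defined.

Definition coords_basis n N (b : 'I_N -> M) : 'M[M]_(n, #|{: 'I_n * 'I_N}|) :=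
  \matrix_(i, q) (if (enum_val q).1 == i then b (enum_val q).2 else 0).

Lemma coords_expand n N (b : 'I_N -> M) (c : 'I_N -> M -> R)
    (h : forall i, rfun (c i)) D (v : 'M[M]_(n, D)) :
  coords_basis n b *m (nfun_coords n h D v)^t
  = \matrix_(i, d) \sum_l b l * it (c l (v i d)).
Proof.
apply/matrixP=> i d; rewrite !mxE.
pose F (q : 'I_n * 'I_N) := (if q.1 == i then b q.2 else 0) * it (c q.2 (v q.1 d)).
transitivity (\sum_(q in {: 'I_n * 'I_N}) F q).
  by rewrite [RHS]big_enum_val /=; apply: eq_bigr => q _; rewrite !mxE.
transitivity (\sum_p \sum_l F (p, l)).
  rewrite pair_bigA /=. by apply: eq_big => // -[].
rewrite (bigD1 i) //= [X in _ + X]big1 ?addr0.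
  by apply: eq_bigr => l _; rewrite /F /= eqxx.
by move=> p /negbTE pi; rewrite big1 // => l _; rewrite /F /= pi mul0r.
Qed.

Lemma sbnd_bnd n B : sbnd B -> @bnd n n (fun D v => map_mx B v).
Proof.
move=> [N [b [c [hc e]]]]; exists _, (coords_basis n b), (nfun_coords n hc) => D v.
by rewrite coords_expand; apply/matrixP=> i j; rewrite !mxE e.
Qed.

Lemma bnd0 n p : @bnd n p (fun D v => 0).
Proof.
suff V : nfun n 0 by exists 0, 0, V => D v; rewrite mul0mx.
by exists (fun D v => 0) => [D u v|D D' u w]; rewrite ?addr0 ?mul0mx.
Qed.

Lemma rlin_mul c : rlin (fun m => c * m).
Proof. by split=> *; rewrite ?mulrDr ?mulrA. Qed.

Lemma sbnd_ext B B' : B =1 B' -> sbnd B -> sbnd B'.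
Proof. by move=> eq [N [b [c [hc e]]]]; exists N, b, c; split=> // m; rewrite -eq. Qed.

Lemma sbnd_add B B' : sbnd B -> sbnd B' -> sbnd (fun m => B m + B' m).
Proof.
move=> [N [b [c [hc e]]]] [N' [b' [c' [hc' e']]]].
exists (N + N')%N, (fun i => match split i with inl k => b k | inr k => b' k end).
exists (fun i => match split i with inl k => c k | inr k => c' k end); split.
  by move=> i; case: split.
move=> m; rewrite big_split_ord e e'; congr (_ + _); apply: eq_bigr => i _.
  by rewrite (unsplitK (inl _ i)).
by rewrite (unsplitK (inr _ i)).
Qed.

Lemma sbnd_left H B : rlin H -> sbnd B -> sbnd (fun m => H (B m)).
Proof.
move=> [HD HM] [N [b [c [hc e]]]]; exists N, (fun i => H (b i)), c; split=> // m.
by rewrite e (add_fun_sum _ _ HD); apply: eq_bigr => i _; rewrite HM.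
Qed.

Lemma sbnd_right H B : rlin H -> sbnd B -> sbnd (fun m => B (H m)).
Proof.
move=> [HD HM] [N [b [c [hc e]]]]; exists N, b, (fun i m => c i (H m)); split=> // i.
by split=> *; rewrite ?HD ?HM ?(hc i).1 ?(hc i).2.
Qed.

Lemma sbnd1 b c : rfun c -> sbnd (fun m => b * it (c m)).
Proof. by move=> hc; exists 1, (fun=> b), (fun=> c); split=> // m; rewrite big_ord1. Qed.

Hypothesis dual_basis : forall s : seq M, exists N (b : 'I_N -> M) (c : 'I_N -> M -> R),
  (forall i, rfun (c i)) /\ forall m, m \in s -> m = \sum_i b i * it (c i m).

Lemma dual_basis_mx n k (U : 'M[M]_(n, k)) :
  exists N (b : 'M[M]_(n, N)) (c : nfun n N), U = b *m (c k U)^t.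
Proof.
have [N [b [c [hc e]]]] := dual_basis [seq U p.1 p.2 | p <- enum {: 'I_n * 'I_k}].
exists _, (coords_basis n b), (nfun_coords n hc).
rewrite coords_expand; apply/matrixP=> i j; rewrite mxE; apply: e.
by apply/mapP; exists (i, j); rewrite ?mem_enum.
Qed.

(* A bounded perturbation [1 + U V] of the identity has the class of [1 + V U];
   this does not depend on the chosen factorisation. *)
Lemma chi_bnd_uniq n N N' (U : 'M[M]_(n, N)) (V : nfun n N)
    (U' : 'M[M]_(n, N')) (V' : nfun n N') :
  (forall D v, U *m (V D v)^t = U' *m (V' D v)^t) ->
  chi (1%:M + V N U) = chi (1%:M + V' N' U').
Proof.
(* One family [b], [c] reproduces the columns of both [U] and [U']. Writing [U = b c(U)] and
   swapping gives the class of [1 + c(U V b)], which depends only on the operator [U V]. *)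
move=> eq; have [k [b [c]]] := dual_basis_mx (row_mx U U').
rewrite nfun_row.
rewrite map_row_mx mul_mx_row => /eq_row_mx[eU eU'].
rewrite {1}eU nfunM chi_swap {1}eU' nfunM [RHS]chi_swap.
by rewrite -!nfunM eq.
Qed.

(** If [th] inverts [1 + U V], then [1 - V th U] inverts [1 + V U]. *)
Lemma invertible_class n N (U : 'M[M]_(n, N)) (V : nfun n N) (th : nop n n) :
  (forall D v, th D (v + U *m (V D v)^t) = v) ->
  (forall D v, th D v + U *m (V D (th D v))^t = v) ->
  invertible_mx (1%:M + V N U).
Proof.
move=> thl thr; exists (1%:M - V N (th N U)).
have Vl : V N (th N U) + V N (th N U) *m V N U = V N U.
  by rewrite -nfunM -nopM -nfunD -nopD thl.
have Vr : V N (th N U) + V N U *m V N (th N U) = V N U.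
  by rewrite -nfunM -nfunD thr.
split.
  rewrite mulmxBr mulmx1 mulmxDl mul1mx Vr addrK //.
rewrite mulmxBl mul1mx mulmxDr mulmx1 Vl addrK //.
Qed.

End RightLinear.

(** * The map phi on operators, and the vanishing of classes that die in the localisation *)

Section LocalizationInjective.
Variables (R M Q : pzRingType) (it sg : {rmorphism R -> M}) (ev : {rmorphism M -> R}).
Variables (rho : {rmorphism R -> Q}) (x : M) (y : M -> M) (den : R -> Prop).

Local Notation "W ^t" := (map_mx it W) (at level 2, format "W ^t").
Local Notation "W ^s" := (map_mx sg W) (at level 2, format "W ^s").

Hypotheses (ev_it : cancel it ev) (ev_is : cancel sg ev).
Hypotheses (x_central : forall m, x * m = m * x) (ev_x : ev x = 0).
Hypotheses (y_lin : rlin it y) (yx : forall m, y (x * m) = m).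
Hypothesis xy : forall m, x * y m = m - it (ev m).
Hypothesis dual_basis : forall s : seq M, exists N (b : 'I_N -> M) (c : 'I_N -> M -> R),
  (forall i, rfun it (c i)) /\ forall m, m \in s -> m = \sum_i b i * it (c i m).
Hypothesis rho_inj : injective rho.
Hypothesis den1 : den 1.
Hypothesis denM : forall f g, den f -> den g -> den (f * g).
Hypothesis den_central : forall f, den f -> forall m, sg f * m = m * sg f.
Hypothesis rho_den_central : forall f, den f -> forall h, rho f * h = h * rho f.
Hypothesis den_frac : forall h : Q, exists f b, den f /\ rho f * h = rho b.
Hypothesis den_div : forall f, den f -> exists z : M -> M,
  [/\ rlin it z, forall m, z (sg f * m) = m & sbnd it (fun m => m - sg f * z m)].

Let e := fun m => it (ev m).

Lemma y_it r : y (it r) = 0.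
Proof.
have : y (x * y (it r)) = 0 by rewrite xy ev_it subrr (add_fun0 y_lin.1).
by rewrite yx.
Qed.

Lemma scale_x n D (v : 'M[M]_(n, D)) k (a : 'M[M]_(k, n)) :
  x *: (a *m v) = a *m (x *: v).
Proof.
apply/matrixP=> i j; rewrite !mxE mulr_sumr; apply: eq_bigr => l _.
by rewrite mxE mulrA x_central mulrA.
Qed.

Lemma scale_den f n D (v : 'M[M]_(n, D)) k (a : 'M[M]_(k, n)) : den f ->
  sg f *: (a *m v) = a *m (sg f *: v).
Proof.
move=> df; apply/matrixP=> i j; rewrite !mxE mulr_sumr; apply: eq_bigr => l _.
by rewrite mxE mulrA (den_central df) mulrA.
Qed.

(** [M] is the direct sum of [x M] and the constants [it R]. The operator [phi th] is [th]
    transported to [x M] along multiplication by [x], and the identity on constants. *)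
Definition phi n (th : nop it n n) D (v : 'M[M]_(n, D)) : 'M[M]_(n, D) :=
  x *: th D (map_mx y v) + map_mx e v.

Lemma map_y_phi n (th : nop it n n) D (v : 'M[M]_(n, D)) :
  map_mx y (phi th v) = th D (map_mx y v).
Proof.
apply/matrixP=> i j; rewrite !mxE y_lin.1 yx -[RHS]addr0; congr (_ + _).
by rewrite /e y_it.
Qed.

Lemma map_e_phi n (th : nop it n n) D (v : 'M[M]_(n, D)) :
  map_mx e (phi th v) = map_mx e v.
Proof.
apply/matrixP=> i j; rewrite !mxE /e rmorphD rmorphM ev_x mul0r add0r.
by rewrite ev_it.
Qed.

Lemma phi_comp n (th1 th2 : nop it n n) D (v : 'M[M]_(n, D)) :
  phi (nop_comp th1 th2) v = phi th1 (phi th2 v).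
Proof. by rewrite {2}/phi map_y_phi map_e_phi. Qed.

(** The perturbation [th^-1 phi(th)] of the identity has finite rank and trivial class, expressed
    without the inverse of [th]. *)
Definition phi_trivial n (th : nop it n n) : Prop :=
  exists N (U : 'M[M]_(n, N)) (V : nfun it n N),
  [/\ forall D v, phi th v = th D (v + U *m (V D v)^t),
      invertible_mx (1%:M + V N U) & chi (1%:M + V N U) = 0].

(** Moving [1 + U1 V1] to the right of [th2] replaces [U1], [V1] by [th2^-1 U1], [V1 th2], which
    leaves the matrix [V1 U1] unchanged. *)
Lemma phi_trivial_comp n (th1 th2 th2' : nop it n n) :
  (forall D v, th2 D (th2' D v) = v) -> (forall D v, th2' D (th2 D v) = v) ->
  phi_trivial th1 -> phi_trivial th2 -> phi_trivial (nop_comp th1 th2).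
Proof.
move=> h1 h2 [N1 [U1 [V1 [E1 I1 X1]]]] [N2 [U2 [V2 [E2 I2 X2]]]].
pose W1 := nfun_comp V1 th2; pose T1 := th2' _ U1.
have I1' : invertible_mx (1%:M + W1 _ T1) by rewrite /= h1.
exists (N1 + N2)%N, (comp_col T1 U2), (comp_fun W1 U2 V2); split.
- move=> D v; rewrite phi_comp E2 E1 -comp_classE /=; congr (th1 _ _).
  by rewrite [RHS]nopD nopM h1.
- exact: invertible_comp_class.
- by rewrite chi_comp_class // X2 addr0 /= h1.
Qed.

(** With [h] the fraction [b / f], this says that [th] is multiplication by [h(s)] modulo finite
    rank, the denominator being cleared. *)
Definition lifts n (th : nop it n n) (h : 'M[Q]_n) : Prop :=
  exists f (b : 'M[R]_n), [/\ den f, rho f *: h = map_mx rho b &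
    bnd it (fun D (v : 'M[M]_(n, D)) => th D (sg f *: v) - b^s *m v)].

Lemma scale_rho_mul f n (a b : 'M[Q]_n) : den f ->
  rho f *: (a *m b) = a *m (rho f *: b).
Proof.
move=> df; apply/matrixP=> i j; rewrite !mxE mulr_sumr; apply: eq_bigr => l _.
by rewrite mxE mulrA (rho_den_central df) mulrA.
Qed.

Lemma nopB n p (th : nop it n p) D (u v : 'M[M]_(n, D)) : th D (u - v) = th D u - th D v.
Proof. by rewrite nopD (add_funN (@nopD _ _ _ _ _ th D)). Qed.

Lemma lifts_comp n (th1 th2 : nop it n n) h1 h2 :
  lifts th1 h1 -> lifts th2 h2 -> lifts (nop_comp th1 th2) (h1 *m h2).
Proof.
move=> [f1 [b1 [d1 e1 B1]]] [f2 [b2 [d2 e2 B2]]].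
exists (f1 * f2), (b1 *m b2); split; first exact: denM.
  by rewrite rmorphM -scalerA scale_rho_mul // e2 scalemxAl e1 map_mxM.
(* [th1 th2 f1 f2 - b1 b2 = th1 (th2 f2 - b2) f1 + (th1 f1 - b1) b2], using that denominators are
   central. *)
apply: bnd_ext (bnd_add (bnd_left th1 (bnd_right (nop_scale it n (sg f1)) B2))
                        (bnd_right (nop_mul it b2^s) B1)) => D v /=.
rewrite nopB map_mxM !mulmxA -scale_den // addrA subrK.
congr (th1 _ (th2 _ _) - _).
by rewrite scalerA rmorphM (den_central d1).
Qed.

(** Injectivity of [rho] gives [b = f a], so [(th - a) f] has finite rank. Composing with the
    division [z] removes [f], since [1 - f z] has finite rank too. *)
Lemma lifts_unique n (th : nop it n n) (a : 'M[R]_n) : lifts th (map_mx rho a) ->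
  bnd it (fun D (v : 'M[M]_(n, D)) => th D v - a^s *m v).
Proof.
move=> [f [b [df eb B]]]; have [z [zlin zf zb]] := den_div df.
have {eb} eb : f *: a = b.
  by apply/matrixP=> i j; apply: rho_inj; move/matrixP/(_ i j): eb; rewrite !mxE rmorphM.
have Bz := sbnd_bnd n zb; pose A := nop_mul it (- a^s).
apply: bnd_ext (bnd_add (bnd_right (nop_map n zlin) B)
    (bnd_left (nop_add th A) Bz)) => D v /=.
have -> : map_mx (fun m => m - sg f * z m) v = v - sg f *: map_mx z v.
  by apply/matrixP=> i j; rewrite !mxE.
have -> : b^s *m map_mx z v = a^s *m (sg f *: map_mx z v).
  rewrite -scale_den // scalemxAl -eb; congr (_ *m _).
  by apply/matrixP=> i j; rewrite !mxE rmorphM.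
rewrite nopB mulmxBr !mulNmx opprK.
by rewrite addrACA [_ + (_ - _)]addrC subrK [- _ + (_ + _)]addrC addrK.
Qed.

(** The lift is [th = 1 + H E_ij], and [phi(th) = th (1 + (x H y - H) E_ij)]. This perturbation has
    values in row [i] and reads row [j], so [V U = 0] and its class is trivial. *)
Lemma phi_trivial_elementary n (i j : 'I_n) (h : Q) : i != j ->
  exists th th' : nop it n n,
  [/\ forall D v, th D (th' D v) = v, forall D v, th' D (th D v) = v,
      phi_trivial th & lifts th (1%:M + h *: delta_mx i j)].
Proof.
move=> ij; have [f [b0 [df fh]]] := den_frac h.
have [z [zlin zf zb]] := den_div df.
(* The operator lifting the fraction [h]: division by [f], then multiplication by [b0]. *)
pose H m := sg b0 * z m.
have Hlin : rlin it H.
  by split=> [a b|m r]; rewrite /H ?zlin.1 ?mulrDr // zlin.2 mulrA.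
have dd : delta_mx i j *m delta_mx i j = 0 :> 'M[M]_n by rewrite mul_delta_mx_0 // eq_sym.
have mapd D (G : M -> M) (v : 'M[M]_(n, D)) : (forall a b, G (a + b) = G a + G b) ->
    map_mx G (delta_mx i j *m v) = delta_mx i j *m map_mx G v.
  move=> GD; apply/matrixP=> k l; rewrite !mxE (add_fun_sum _ _ GD).
  apply: eq_bigr => q _; rewrite !mxE; case: andP => _; rewrite ?mul1r ?mul0r //.
  exact: add_fun0.
pose E := nop_mul it (delta_mx i j : 'M[M]_n).
pose th := nop_add (nop_id it n) (nop_comp E (nop_map n Hlin)).
pose th' := nop_add (nop_id it n) (nop_comp (nop_mul it (- delta_mx i j : 'M[M]_n)) (nop_map n Hlin)).
have ddH D (v : 'M[M]_(n, D)) : delta_mx i j *m map_mx H (delta_mx i j *m v) = 0.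
  by rewrite mapd ?mulmxA ?dd ?mul0mx //; apply: Hlin.1.
have HB D (u v : 'M[M]_(n, D)) : map_mx H (u - v) = map_mx H u - map_mx H v.
  exact: (nopB (nop_map n Hlin)).
have HD D (u v : 'M[M]_(n, D)) : map_mx H (u + v) = map_mx H u + map_mx H v.
  exact: (nopD (nop_map n Hlin)).
exists th, th'; split.
- by move=> D v; rewrite /= mulNmx HB mulmxBr ddH subr0 subrK.
- by move=> D v; rewrite /= mulNmx HD mulmxDr ddH addr0 addrK.
(* [z] commutes with [x] up to the finite-rank remainder of the division by [f], and [x y] differs
   from the identity by the rank-one evaluation. *)
- have sB : sbnd it (fun m => x * H (y m) - H m).
    have B1 := sbnd_left (rlin_mul it (- sg b0)) (sbnd_left zlin
                 (sbnd_left (rlin_mul it x) (sbnd_right y_lin zb))).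
    have B2 := sbnd_left (rlin_mul it (- sg b0))
                 (sbnd1 (z 1) (conj (fun a b => rmorphD ev a b)
                    (fun m r => etrans (rmorphM ev m (it r))
                        (congr1 (fun u => ev m * u) (ev_it r))))).
    apply: sbnd_ext (sbnd_add B1 B2) => m /=.
    rewrite /H -zlin.2 mul1r.
    have zm : z m = z (x * y m) + z (it (ev m)) by rewrite -zlin.1 xy subrK.
    have zfx : z (x * (sg f * z (y m))) = x * z (y m).
      by rewrite mulrA x_central -mulrA zf.
    rewrite mulrBr zlin.1 (add_funN zlin.1) zfx zm.
    have -> : x * (sg b0 * z (y m)) = sg b0 * (x * z (y m)).
      by rewrite mulrA x_central -mulrA.
    rewrite !mulNr !mulrDr mulrN !opprD !opprK addrA.
    by congr (_ - _); rewrite addrC.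
  have [N [U0 [V0 e0]]] := sbnd_row sB.
  pose U := (delta_mx i 0 : 'M[M]_(n, 1)) *m U0.
  pose V := nfun_comp V0 (nop_mul it (delta_mx 0 j : 'M[M]_(1, n))).
  have VU : V _ U = 0.
    rewrite /= /U mulmxA mul_delta_mx_0 1?eq_sym // mul0mx.
    exact: (add_fun0 (@nfunD _ _ _ _ _ V0 N)).
  exists N, U, V; rewrite VU addr0 chi1; split=> //; last exact: invertible_mx1.
  move=> D v.
  have -> : U *m (V D v)^t = delta_mx i j *m map_mx (fun m => x * H (y m) - H m) v.
    have -> : delta_mx i j = (delta_mx i 0 : 'M_(n, 1)) *m delta_mx 0 j :> 'M[M]_n.
      by rewrite mul_delta_mx.
    rewrite -mulmxA; rewrite /= -mulmxA -e0; congr (_ *m _).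
    apply/matrixP=> k l; rewrite !mxE (bigD1 j) //= big1 ?addr0; last first.
      by move=> q /negbTE qj; rewrite !mxE qj andbF mul0r.
    rewrite (bigD1 j) //= big1 ?addr0; last first.
      by move=> q /negbTE qj; rewrite !mxE qj andbF mul0r.
    by rewrite !mxE !ord1 !eqxx !mul1r.
  rewrite /= HD mulmxDr ddH addr0 /phi /= scalerDr scale_x addrAC.
  have -> : x *: map_mx y v + map_mx e v = v.
    by apply/matrixP=> k l; rewrite !mxE xy subrK.
  rewrite -addrA; congr (_ + _); rewrite -mulmxDr; congr (_ *m _).
  by apply/matrixP=> k l; rewrite !mxE subrK.
- exists f, (f%:M + b0 *: delta_mx i j); split=> //.
    rewrite map_mxD map_scalar_mx map_mxZ map_delta_mx scalerDr scalerA fh.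
    by rewrite scalemx1.
  apply: bnd_ext (bnd0 it n n) => D v /=.
  rewrite map_mxD map_scalar_mx map_mxZ map_delta_mx mulmxDl mul_scalar_mx opprD addrACA.
  rewrite subrr add0r; apply/esym/eqP; rewrite subr_eq0 -scalemxAl; apply/eqP.
  have -> : map_mx H (sg f *: v) = sg b0 *: v.
    by apply/matrixP=> k l; rewrite !mxE /H zf.
  apply/matrixP=> k l; rewrite !mxE mulr_sumr; apply: eq_bigr => q _.
  by rewrite !mxE; case: andP => _; rewrite ?mul1r ?mul0r ?mulr0.
Qed.

Lemma Eprod_lifts n (h : 'M[Q]_n) : Eprod h ->
  exists th th' : nop it n n,
  [/\ forall D v, th D (th' D v) = v, forall D v, th' D (th D v) = v,
      phi_trivial th & lifts th h].
Proof.
elim=> [|_ a [i [j [c [ij ->]]]] _ [th2 [th2' [l2 r2 t2 f2]]]].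
  exists (nop_id it n), (nop_id it n); split=> //.
    suff V : nfun it n 0.
      have w1 (w : 'M[R]_0) : w = 1%:M by rewrite [w]flatmx0 [RHS]flatmx0.
      exists 0, 0, V; rewrite [1%:M + _]w1 chi1; split=> //.
        move=> D v; rewrite mul0mx addr0.
        by apply/matrixP=> k l; rewrite !mxE xy subrK.
      exact: invertible_mx1.
    by exists (fun D v => 0) => [D u v|D D' u w]; rewrite ?addr0 ?mul0mx.
  exists 1, 1%:M; split=> //; first by rewrite rmorph1 scale1r map_mx1.
  apply: bnd_ext (bnd0 it n n) => D v /=.
  by rewrite rmorph1 scale1r map_mx1 mul1mx subrr.
have [th1 [th1' [l1 r1 t1 f1]]] := phi_trivial_elementary c ij.
exists (nop_comp th1 th2), (nop_comp th2' th1'); split.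
- by move=> D v /=; rewrite l2.
- by move=> D v /=; rewrite r1.
- exact: phi_trivial_comp t1 t2.
- exact: lifts_comp.
Qed.

Theorem chi_localization n (a : 'M[R]_n) : invertible_mx a ->
  Eprod (map_mx rho a) -> chi a = 0.
Proof.
case=> a' [aa' a'a] /Eprod_lifts[th [th' [l r [N1 [U1 [V1 [E1 I1 X1]]]] /lifts_unique B]]].
have as's : a^s *m a'^s = 1%:M by rewrite -map_mxM aa' map_mx1.
have a's_as : a'^s *m a^s = 1%:M by rewrite -map_mxM a'a map_mx1.
(* Since [a(s)^-1 th - 1] has finite rank, [th = a(s) (1 + U V)]. *)
have [N [U [V E]]] := bnd_left (nop_mul it a'^s) B.
have thE D (v : 'M[M]_(n, D)) : th D v = a^s *m (v + U *m (V D v)^t).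
  by rewrite mulmxDr -E /= mulmxA as's mul1mx addrC subrK.
have I0 : invertible_mx (1%:M + V N U).
  apply: (@invertible_class _ _ _ _ _ U V (nop_comp th' (nop_mul it a^s))) => D v /=.
    by rewrite -thE r.
  have := l _ (a^s *m v); rewrite thE => /(congr1 (mulmx a'^s)).
  by rewrite !mulmxA a's_as !mul1mx.
pose P : 'M[M]_n := a'^s - 1%:M.
have evM D D' (u : 'M[M]_(n, D)) (w : 'M[R]_(D, D')) :
    map_mx ev (u *m w^t) = map_mx ev u *m w.
  by rewrite map_mxM; congr (_ *m _); apply/matrixP=> k m; rewrite !mxE ev_it.
pose Ve : nfun it n n := Nfun (fun D (u v : 'M[M]_(n, D)) => map_mxD ev u v) evM.
pose Vy := nfun_comp V (nop_map n y_lin).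
pose U2 := row_mx P (x *: U); pose V2 := nfun_col Ve Vy.
(* Both sides compute [a(s)^-1 phi(th)]: the left from [phi(th) = th (1 + U1 V1)], the right by
   expanding [x a(s) (1 + U V) y + e] with [x y = 1 - e]. *)
have key D (v : 'M[M]_(n, D)) : v + comp_col U U1 *m (comp_fun V U1 V1 D v)^t
    = v + U2 *m (V2 D v)^t.
  rewrite -comp_classE /=.
  have /(congr1 (mulmx a'^s)) := E1 _ v.
  rewrite thE mulmxA a's_as mul1mx => <-.
  rewrite /phi thE mulmxDr scale_x mulmxA a's_as mul1mx.
  rewrite map_col_mx mul_row_col /P mulmxBl mul1mx.
  have -> : (map_mx ev v)^t = map_mx e v by apply/matrixP=> k m; rewrite !mxE.
  rewrite scalerDr scalemxAl.
  have -> : x *: map_mx y v = v - map_mx e v.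
    by apply/matrixP=> k m; rewrite !mxE xy.
  rewrite -!addrA; congr (_ + _); rewrite [RHS]addrCA; congr (_ + _).
  by rewrite addrC.
have /(chi_bnd_uniq dual_basis) : forall D v,
    comp_col U U1 *m (comp_fun V U1 V1 D v)^t = U2 *m (V2 D v)^t.
  by move=> D v; apply: (addrI v); apply: key.
rewrite chi_comp_class // X1 addr0.
(* Evaluation sends [a(s)^-1] to [a^-1] and kills [x], so the matrix is triangular with diagonal
   blocks [a^-1] and [1 + V U]. The class of [1 + V U] stands on both sides and cancels, leaving
   that of [a^-1] zero. *)
have -> : 1%:M + V2 _ U2 = block_mx a' 0 (Vy _ P) (1%:M + V _ U).
  have -> : V2 _ U2 = col_mx (Ve _ U2) (Vy _ U2) by [].
  rewrite /U2 !nfun_row.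
  rewrite -[col_mx (row_mx _ _) _]block_mxEv scalar_mx_block add_block_mx !add0r.
  congr block_mx.
  - rewrite /= /P map_mxB map_mx1 addrC subrK.
    by apply/matrixP=> k m; rewrite 2!mxE; exact: ev_is.
  - by apply/matrixP=> k m; rewrite /= !mxE [ev _]rmorphM ev_x mul0r.
  - congr (_ + V _ _) => /=.
    by apply/matrixP=> k m; rewrite !mxE yx.
rewrite chi_lower //; last by exists a.
move/eqP; rewrite eq_sym -subr_eq0 addrK => /eqP a'0.
by apply: oppr_inj; rewrite oppr0 -a'0 (chiV aa' a'a).
Qed.

End LocalizationInjective.

(** * Division in Laurent polynomial rings *)

(** The additive group of [int] written as a multiplicative monoid, so that [mring A zmon] is the
    Laurent polynomial ring over [A]. *)
Definition zmon : Type := int.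
HB.instance Definition _ := Choice.on zmon.
Fact zmon_mulA : associative (fun k l : zmon => (k + l : int)). Proof. exact: addrA. Qed.
Fact zmon_mul1 : left_id (0 : int) (fun k l : zmon => (k + l : int)). Proof. exact: add0r. Qed.
Fact zmon_mulr1 : right_id (0 : int) (fun k l : zmon => (k + l : int)). Proof. exact: addr0. Qed.
HB.instance Definition _ := isMonoid.Build zmon zmon_mulA zmon_mul1 zmon_mulr1.

Lemma zmonM (k l : zmon) : (k * l)%g = (k + l : int) :> zmon. Proof. by []. Qed.
Lemma zmon1 : (1%g : zmon) = (0 : int). Proof. by []. Qed.

Section LaurentDivision.
Variable R : pzRingType.
Local Notation M := (mring R zmon).
Local Notation sp := (fun k : int => mU (k : zmon) (1 : R)).

Lemma mc_mU_mul (l : zmon) (a : R) (q : M) (j : zmon) :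
  mc (mU l a * q) j = a * mc q (j - l : int).
Proof.
elim/mring_ind: q => [u v e e'|k b]; first by rewrite mulrDr !mcD e e' mulrDr.
rewrite mU_mul !mcU zmonM (fun_if (fun r => a * r)) mulr0.
by have -> : (k == (j - l : int)) = ((l + k : int) == j :> int) by rewrite -subr_eq0 -[RHS]subr_eq0; congr (_ == _); lia.
Qed.

Lemma sp_central (k : zmon) (q : M) : mU k 1 * q = q * mU k 1.
Proof. by apply: mring_central => l a; rewrite !mU_mul mulr1 mul1r !zmonM addrC. Qed.

Lemma mring_bound (q : M) : exists B : nat, forall k : int, (B <= `|k|)%N -> mc q (k : zmon) = 0.
Proof.
elim/mring_ind: q => [u v [B e] [B' e']|k a].
  exists (maxn B B') => k; rewrite geq_max mcD => /andP[Bk B'k].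
  by rewrite e // e' // addr0.
exists `|k : int|.+1%N => l; rewrite mcU; case: eqP => // ->; by rewrite ltnn.
Qed.

Lemma mring_bound_sum (u : M) (B : nat) :
  (forall k : int, (B <= absz k)%N -> mc u (k : zmon) = 0) ->
  u = \sum_(i < B + B) mU ((i%:Z - B%:Z : int) : zmon) (mc u (i%:Z - B%:Z : int)).
Proof.
move=> bB; apply: mring_eq => k; rewrite mc_sum.
case: (boolP ((- B%:Z <= k :> int) && ((k : int) < B%:Z))) => kB; last first.
  rewrite bB; last by lia.
  rewrite big1 // => i _; rewrite mcU; case: eqP => // ek.
  by move: kB; rewrite -ek; have := ltn_ord i; lia.
have iB : (absz ((k : int) + B%:Z)%R < B + B)%N by lia.
have ik : (absz ((k : int) + B%:Z))%:Z - B%:Z = k :> int by lia.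
rewrite (bigD1 (Ordinal iB)) //= big1 ?addr0 ?mcU ?ik ?eqxx // => i ni.
rewrite mcU; case: eqP => // ek; move: ni; rewrite -val_eqE /=; lia.
Qed.

Variables (d : nat) (c : nat -> R) (cd' c0' : R).
Hypotheses (cdV : c d * cd' = 1) (cVd : cd' * c d = 1).
Hypotheses (c0V : c 0 * c0' = 1) (cV0 : c0' * c 0 = 1).

Definition lpoly : M := \sum_(l < d.+1) mU (l%:Z : zmon) (c l).
Local Notation f := lpoly.

Lemma mc_lpoly (q : M) (j : int) :
  mc (f * q) (j : zmon) = \sum_(l < d.+1) c l * mc q (j - l%:Z : int).
Proof. by rewrite mulr_suml mc_sum; apply: eq_bigr => l _; rewrite mc_mU_mul. Qed.

Definition spanned (r : M) : Prop :=
  forall j : int, ~~ ((0 <= j) && (j < d%:Z)) -> mc r (j : zmon) = 0.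

(** As the leading coefficient is a unit, the coefficient of [f q] at [k + d] determines that of [q]
    at [k >= 0] from the higher ones; as the constant coefficient is one, the coefficient at [k < 0]
    is determined from the lower ones. The induction variable [n] bounds the distance to the bound
    [B] on the support. *)
Lemma div_unique (q : M) : spanned (f * q) -> q = 0.
Proof.
move=> sq; have [B bB] := mring_bound q.
have pos n (k : int) : 0 <= k -> (B <= `|k| + n)%N -> mc q (k : zmon) = 0.
  elim: n k => [|n IH] k k0 Bk; first by apply: bB; rewrite addn0 in Bk.
  have := sq (k + d%:Z); rewrite mc_lpoly big_ord_recr big1 /=; last first.
    by move=> l _; rewrite IH ?mulr0 //; have := ltn_ord l; lia.
  rewrite add0r addrK => H; rewrite -[mc q _]mul1r -cVd -mulrA H ?mulr0 //; lia.
have neg n (k : int) : k < 0 -> (B <= `|k| + n)%N -> mc q (k : zmon) = 0.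
  elim: n k => [|n IH] k k0 Bk; first by apply: bB; rewrite addn0 in Bk.
  have := sq k; rewrite mc_lpoly big_ord_recl big1 /=; last first.
    by move=> l _; rewrite IH ?mulr0 //; rewrite /bump /=; lia.
  rewrite addr0 subr0 => H; rewrite -[mc q _]mul1r -cV0 -mulrA H ?mulr0 //; lia.
apply: mring_eq => k; rewrite mc0; case: (boolP ((k : int) < 0)) => k0.
  by apply: (neg B) => //; apply: leq_addl.
by apply: (pos B); [lia|apply: leq_addl].
Qed.

Let P (m : M) := exists q r : M, m = f * q + r /\ spanned r.

Fact div_exists_add m m' : P m -> P m' -> P (m + m').
Proof.
move=> [q [r [-> sr]]] [q' [r' [-> sr']]]; exists (q + q'), (r + r'); split.
  by rewrite mulrDr addrACA.
by move=> j jd; rewrite mcD sr // sr' // addr0.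
Qed.

Fact div_exists_const a : P (mU 1%g a).
Proof.
case: (posnP d) => d0.
  exists (mU 1%g (cd' * a)), 0; split; last by move=> j _; rewrite mc0.
  rewrite addr0 /lpoly; move: cdV; rewrite d0 => cdV0.
  by rewrite big_ord1 mU_mul mulrA cdV0 mul1r.
exists 0, (mU 1%g a); rewrite mulr0 add0r; split=> // j; rewrite mcU.
by case: eqP => // <-; rewrite zmon1; lia.
Qed.

(** The shifted remainder acquires a term in degree [d], cancelled by [f w] because the leading
    coefficient is a unit. *)
Fact div_exists_up m : P m -> P (sp 1 * m).
Proof.
move=> [q [r [-> sr]]]; pose w := cd' * mc r (d%:Z - 1 : int).
exists (sp 1 * q + mU 1%g w), (sp 1 * r - f * mU 1%g w); split.
  rewrite !mulrDr !mulrA sp_central -!addrA; congr (_ + _).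
  by rewrite addrCA subrr addr0.
move=> j jd; rewrite mcD mcN mc_mU_mul mul1r mc_mul_mC.
have -> : mc f (j : zmon) = if j == d%:Z then c d else 0.
  rewrite -[f]mulr1 mc_lpoly big_ord_recr big1 /=; last first.
    move=> l _; rewrite -mU_one mcU; case: eqP; rewrite ?mulr0 // zmon1.
    by have := ltn_ord l; lia.
  rewrite -mU_one mcU add0r zmon1.
  have -> : (0 == j - d%:Z) = (j == d%:Z) by rewrite -[RHS]subr_eq0 eq_sym.
  by case: eqP; rewrite ?mulr1 ?mulr0.
case: eqP => [->|jnd]; first by rewrite /w mulrA cdV mul1r subrr.
rewrite mul0r subr0 sr //; lia.
Qed.

(** The shifted remainder acquires a term in degree [-1], cancelled by [f w t^-1] because the
    constant coefficient is a unit. *)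
Fact div_exists_down m : P m -> P (sp (-1) * m).
Proof.
move=> [q [r [-> sr]]]; pose w := c0' * mc r (0 : int).
exists (sp (-1) * q + mU ((-1 : int) : zmon) w), (sp (-1) * r - f * mU ((-1 : int) : zmon) w); split.
  rewrite !mulrDr !mulrA sp_central -!addrA; congr (_ + _).
  by rewrite addrCA subrr addr0.
move=> j jd; rewrite mcD mcN mc_mU_mul mul1r mc_lpoly big_ord_recl big1 /=; last first.
  move=> l _; rewrite mcU; case: eqP; rewrite ?mulr0 // /bump /=.
  by have := ltn_ord l; lia.
rewrite addr0 subr0 mcU; case: eqP => [<-|jn].
  by rewrite /w mulrA c0V mul1r -[X in mc r X]/((-1) - (-1) : int) subrr.
rewrite mulr0 subr0 sr //; lia.
Qed.

Lemma div_exists m : P m.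
Proof.
elim/mring_ind: m => [u v|k a]; first exact: div_exists_add.
case: (intP k) => [|n|n].
- exact: div_exists_const.
- elim: n => [|n IH].
    by have := div_exists_up (div_exists_const a); rewrite mU_mul mul1r.
  have := div_exists_up IH; rewrite mU_mul mul1r zmonM.
  by have -> : 1 + n.+1%:Z = n.+2%:Z by lia.
- elim: n => [|n IH].
    by have := div_exists_down (div_exists_const a); rewrite mU_mul mul1r.
  have := div_exists_down IH; rewrite mU_mul mul1r zmonM.
  by have -> : -1 - n.+1%:Z = - n.+2%:Z by lia.
Qed.

(** The quotient is picked by choice; uniqueness makes it additive and linear for multiplication by
    constants on the right. *)
Lemma lpoly_division : exists z : M -> M, [/\ rlin (mC R zmon) z,
  forall m : M, z (f * m) = m & forall m : M, spanned (m - f * z m)].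
Proof.
have H (m : M) : exists q : M, spanned (m - f * q).
  by have [q [r [-> sr]]] := div_exists m; exists q; rewrite addrAC subrr add0r.
have [z hz] := choice H.
have zu (m q : M) : spanned (m - f * q) -> z m = q.
  move=> sq; apply/eqP; rewrite -subr_eq0; apply/eqP/div_unique => j jd.
  have -> : f * (z m - q) = (m - f * q) - (m - f * z m).
    by rewrite mulrBr opprB [RHS]addrC addrA subrK.
  rewrite mcD mcN; apply: etrans (subrr 0).
  by congr (_ - _); [apply: sq|apply: hz].
exists z; split=> //; last by move=> m; apply: zu; rewrite subrr => j _; rewrite mc0.
split=> [m m'|m r]; apply: zu => j jd.
  rewrite mulrDr opprD addrACA mcD; apply: etrans (addr0 0).
  by congr (_ + _); apply: hz.
by rewrite mulrA -mulrBl (mc_mul_mC (m - f * z m) r) hz // mul0r.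
Qed.

Lemma spanned_sum r : spanned r ->
  r = \sum_(i < d) sp i%:Z * mC R zmon (mc r (i%:Z : int)).
Proof.
move=> sr; apply: mring_eq => j; rewrite mc_sum.
case: (boolP ((0 <= j :> int) && ((j : int) < d%:Z))) => jd; last first.
  rewrite sr // big1 // => i _; rewrite mU_mul mulg1 mul1r mcU.
  by case: eqP => // ij; move: jd; rewrite -ij; have := ltn_ord i; lia.
case: j jd => [n|n] jd; last by lia.
have nd : (n < d)%N by lia.
rewrite (bigD1 (Ordinal nd)) //= big1 ?addr0 ?mU_mul ?mulg1 ?mul1r ?mcU ?eqxx // => i.
rewrite mU_mul mulg1 mul1r mcU -val_eqE /= => ne.
by case: eqP => // -[] /eqP; rewrite (negbTE ne).
Qed.

Lemma lpoly_division_sbnd : exists z : M -> M, [/\ rlin (mC R zmon) z,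
  forall m : M, z (f * m) = m & sbnd (mC R zmon) (fun m : M => m - f * z m)].
Proof.
have [z [zl zf zs]] := lpoly_division; exists z; split=> //.
exists d, (fun i => sp i%:Z), (fun i (m : M) => mc (m - f * z m) (i%:Z : int)); split=> [i|m].
  split=> [m m'|m r]; first by rewrite zl.1 mulrDr opprD addrACA [LHS]mcD.
  by rewrite zl.2 mulrA -mulrBl (mc_mul_mC (m - f * z m) r).
exact: spanned_sum.
Qed.

End LaurentDivision.

(** * Passing from A[t, 1/t] to A over K(t) *)

Lemma fraction_clear (D : idomainType) (a : {fraction D}) :
  exists p n : D, p != 0 /\ FracField.tofrac p * a = FracField.tofrac n.
Proof.
elim/quotW: a => r; exists \d_r, \n_r; split; first exact: denom_ratioP.
unlock FracField.tofrac; rewrite -[LHS]FracField.pi_mul.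
apply/eqmodP; rewrite /= FracField.equivfE.
by rewrite !numden_Ratio ?oner_eq0 ?mul1r ?mulf_neq0 ?oner_eq0 ?denom_ratioP // mulr1 mulrC.
Qed.

Lemma det_elementary (A : comPzRingType) n (e : 'M[A]_n) : elementary_mx e -> \det e = 1.
Proof.
case=> i [j [c [ij ->]]].
(* Row [i] of the elementary matrix is row [i] of the identity plus [c] times row [j]. In [B] row
   [i] repeats row [j], so that [B] contributes 0. *)
pose B : 'M[A]_n := \matrix_(k, l) (if k == i then (j == l)%:R else (k == l)%:R).
rewrite (@determinant_multilinear _ _ _ 1%:M B i 1 c).
- rewrite det1 mulr1 (@determinant_alternate _ _ B i j) ?mulr0 ?addr0 // => l.
  by rewrite !mxE eqxx (eq_sym j i) (negbTE ij).
- by apply/rowP=> l; rewrite !mxE !eqxx mul1r /= (eq_sym l j).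
- by apply/matrixP=> k l; rewrite !mxE (eq_sym (lift i k) i) (negbTE (neq_lift i k)) /= mulr0 addr0.
- by apply/matrixP=> k l; rewrite !mxE (eq_sym (lift i k) i) (negbTE (neq_lift i k)) /= mulr0 addr0.
Qed.

Lemma det_Eprod (A : comPzRingType) n (e : 'M[A]_n) : Eprod e -> \det e = 1.
Proof.
by elim=> [|a b /det_elementary ea _ IH]; rewrite ?det1 // det_mulmx ea IH mulr1.
Qed.

Lemma det_pad (A : comPzRingType) N n (a : 'M[A]_n) : (n <= N)%N -> \det (pad N a) = \det a.
Proof. by case/leq_exists_add=> k ->; rewrite pad_dsum det_ublock det1 mulr1. Qed.

Lemma chi_det (A : comPzRingType) n m (a : 'M[A]_n) (b : 'M[A]_m) :
  invertible_mx a -> invertible_mx b -> chi a = chi b -> \det a = \det b.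
Proof.
move=> inva invb /(chi_eqP inva invb)[N [e [nN mN Ee eq]]].
by rewrite -(det_pad a nN) eq det_mulmx det_Eprod // mul1r det_pad.
Qed.

Lemma chi_dsum (A : pzRingType) n m (a : 'M[A]_n) (b : 'M[A]_m) :
  invertible_mx a -> invertible_mx b -> chi (a <+> b) = chi a + chi b.
Proof. exact: chi_lower. Qed.

(** The kernel statement is applied to [a <+> b^-1], stabilised until its image is a product of
    elementary matrices of its own size. *)
Lemma chi_map_inj (A B : pzRingType) (f : {rmorphism A -> B}) :
  (forall n (a : 'M[A]_n), invertible_mx a -> Eprod (map_mx f a) -> chi a = 0) ->
  forall n m (a : 'M[A]_n) (b : 'M[A]_m), invertible_mx a -> invertible_mx b ->
  chi (map_mx f a) = chi (map_mx f b) -> chi a = chi b.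
Proof.
move=> H n m a b inva invb; have [b' [bb' b'b]] := invb.
have invb' : invertible_mx b' by exists b.
move=> fab; have invw := invertible_dsum inva invb'.
have fw : chi (map_mx f (a <+> b')) = 0.
  rewrite map_block_mx !map_mx0 chi_dsum; try exact: invertible_map.
  rewrite fab (@chiV _ _ (map_mx f b) (map_mx f b')) ?subrr // -map_mxM ?bb' ?b'b map_mx1 //.
have /(chi_eq0 (invertible_map f invw))[k Ek] := fw.
have := H _ (a <+> b' <+> 1%:M : 'M_(n + m + k)).
rewrite (map_block_mx f (a <+> b')) !map_mx0 map_mx1 => /(_ _ Ek).
rewrite chi_dsum1 // chi_dsum // (chiV bb' b'b) => E.
apply/eqP; rewrite -subr_eq0; apply/eqP/E.
by apply: invertible_dsum => //; apply: invertible_mx1.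
Qed.

Lemma poly_dvd_Xn (K : fieldType) (p q : {poly K}) N : p * q = 'X^N ->
  exists (l : K) (k : nat), l != 0 /\ p = l%:P * 'X^k.
Proof.
move=> pq; have : p %| ('X - 0%:P) ^+ N by rewrite subr0 -pq dvdp_mulr.
case/dvdp_exp_XsubCP=> k _ /eqpf_eq[l l0 ->]; exists l, k; split=> //.
by rewrite subr0 mul_polyC.
Qed.

(** * Laurent polynomials over a monoid ring, and the classes of their invertible matrices *)

Section LaurentExtension.
Variables (K : fieldType) (G : monoidType) (F : fieldType).
Variable iF : {rmorphism {poly K} -> F}.
Hypothesis iF_inj : forall p, iF p = 0 -> p = 0.
Hypothesis iF_frac : forall a : F, exists p n : {poly K}, p != 0 /\ iF p * a = iF n.

Local Notation A := (mring K G).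
Local Notation R := (mring A zmon).
Local Notation M := (mring R zmon).
Local Notation Q := (mring F G).
Local Notation it := (mC R zmon).

Let tR (k : int) : R := mU (k : zmon) 1.
Let sM (k : int) : M := mU (k : zmon) 1.

Lemma tRD k l : tR (k + l) = tR k * tR l. Proof. by rewrite mU_mul mulr1. Qed.
Lemma sMD k l : sM (k + l) = sM k * sM l. Proof. by rewrite mU_mul mulr1. Qed.

Definition cAM : {rmorphism A -> M} := mC R zmon \o mC A zmon.
(** [M] has two variables: [it] embeds [R] through [t], [sgM] renames [t] to [s], and [evM] sets
    [s = t]. *)
Definition sgM : {rmorphism R -> M} :=
  @mhom _ _ _ cAM (fun k : zmon => sM k) erefl sMD (fun a k => esym (sp_central k _)).
Definition evM : {rmorphism M -> R} :=
  @mhom _ _ _ idfun (fun k : zmon => tR k) erefl tRD (fun a k => esym (sp_central k _)).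

Lemma tF_neq0 : iF 'X != 0.
Proof. by apply/negP=> /eqP/iF_inj/eqP; rewrite polyX_eq0. Qed.

Definition cKF : {rmorphism K -> F} := iF \o polyC.
Definition cKQ : {rmorphism K -> Q} := mC F G \o cKF.

Fact coefQM (g h : G) : mU (g * h)%g (1 : F) = mU g 1 * mU h 1.
Proof. by rewrite mU_mul mulr1. Qed.

Definition coefQ : {rmorphism A -> Q} :=
  @mhom _ _ _ cKQ (fun g => mU g (1 : F)) erefl coefQM (fun a g => mC_central _ _).

Fact tFD (k l : zmon) : mC F G (iF 'X ^ ((k * l)%g : int)) =
  mC F G (iF 'X ^ (k : int)) * mC F G (iF 'X ^ (l : int)).
Proof. by rewrite -rmorphM expfzDr ?tF_neq0. Qed.

Definition rhoQ : {rmorphism R -> Q} :=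
  @mhom _ _ _ coefQ (fun k : zmon => mC F G (iF 'X ^ (k : int))) erefl tFD
    (fun a k => esym (mC_central _ _)).

Definition cKR : {rmorphism K -> R} := mC A zmon \o mC K G.

Lemma cKR_central k (r : R) : cKR k * r = r * cKR k.
Proof.
by apply: mring_central => l a; rewrite /= !mU_mul mul1g mulg1 mC_central.
Qed.

Fact tR_comm : commr_rmorph cKR (tR 1).
Proof. by move=> k; rewrite /GRing.comm cKR_central. Qed.

Definition pt : {rmorphism {poly K} -> R} := horner_morph tR_comm.

Lemma tRX n : tR 1 ^+ n = tR n%:Z.
Proof.
by elim: n => [//|n IH]; rewrite exprS IH -tRD; congr (tR _); lia.
Qed.

Lemma pt_sum p : pt p = \sum_(i < size p) mU (i%:Z : zmon) (mU 1%g p`_i).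
Proof.
rewrite -{1}[p]coefK poly_def rmorph_sum; apply: eq_bigr => i _.
rewrite -mul_polyC rmorphM rmorphXn /= horner_morphC horner_morphX tRX.
by rewrite mU_mul mulr1 mul1g.
Qed.

Lemma sgM_U k a : sgM (mU k a) = mU k (mC A zmon a).
Proof. by rewrite mhomU /= mU_mul mulr1 mul1g. Qed.

Lemma sgM_pt p : sgM (pt p) = \sum_(i < size p) mU (i%:Z : zmon) (cKR p`_i).
Proof. by rewrite pt_sum rmorph_sum; apply: eq_bigr => i _; rewrite /= sgM_U. Qed.

Lemma sgM_pt_central p m : sgM (pt p) * m = m * sgM (pt p).
Proof.
rewrite sgM_pt mulr_suml mulr_sumr; apply: eq_bigr => i _; apply: mring_central => k r.
by rewrite !mU_mul cKR_central !zmonM addrC.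
Qed.

Lemma rhoQ_U k a : rhoQ (mU k a) = coefQ a * mC F G (iF 'X ^ (k : int)).
Proof. exact: mhomU. Qed.

Lemma coefQ_U g k : coefQ (mU g k) = mU g (cKF k).
Proof. by rewrite mhomU /= mU_mul mulr1 mul1g. Qed.

Lemma rhoQ_pt p : rhoQ (pt p) = mC F G (iF p).
Proof.
rewrite pt_sum rmorph_sum -[X in mC F G (iF X)]coefK poly_def !rmorph_sum; apply: eq_bigr => i _.
rewrite rhoQ_U coefQ_U -[mU _ _]/(mC F G _) -rmorphM /=; congr (mU _ _).
by rewrite -mul_polyC rmorphM rmorphXn.
Qed.

Lemma mc_coefQ a g : mc (coefQ a) g = cKF (mc a g).
Proof.
elim/mring_ind: a => [u v e e'|h k]; first by rewrite rmorphD !mcD rmorphD e e'.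
by rewrite coefQ_U !mcU; case: eqP; rewrite ?rmorph0.
Qed.

(** For each [g], multiplication by [t^B] turns the coefficients at [g] into a polynomial over [K]
    that vanishes under [iF]. *)
Lemma rhoQ_inj : injective rhoQ.
Proof.
suff H u : rhoQ u = 0 -> u = 0.
  move=> u v /eqP; rewrite -subr_eq0 -rmorphB => /eqP/H/eqP.
  by rewrite subr_eq0 => /eqP.
have [B bB] := mring_bound u; have uB := mring_bound_sum bB; move=> u0.
suff c0 i : (i < B + B)%N -> mc u (i%:Z - B%:Z : int) = 0.
  by rewrite uB big1 // => i _; rewrite c0 ?ltn_ord // mU0.
move=> iB; apply: mring_eq => g; rewrite mc0.
pose p := \poly_(j < B + B) mc (mc u (j%:Z - B%:Z : int)) g.
suff p0 : p = 0 by have := congr1 (fun q : {poly K} => q`_i) p0; rewrite coef_poly iB coef0.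
apply: iF_inj; have := congr1 (fun v => mc v g * iF 'X ^ B%:Z) u0.
rewrite mc0 mul0r => <-; rewrite [X in rhoQ X]uB rmorph_sum mc_sum mulr_suml.
rewrite /p poly_def rmorph_sum; apply: eq_bigr => j _.
rewrite rhoQ_U mc_mul_mC mc_coefQ -mul_polyC rmorphM rmorphXn -mulrA; congr (_ * _).
by rewrite -expfzDr ?tF_neq0 // subrK.
Qed.

(** A nonzero constant term makes both extreme coefficients units, as Laurent division demands.
    Powers of [t] in a denominator are units of [R] and move to the numerator. *)
Definition denR (f : R) : Prop := exists p : {poly K}, p`_0 != 0 /\ f = pt p.

Lemma poly_split_X (p : {poly K}) : p != 0 ->
  exists (j : nat) (q : {poly K}), q`_0 != 0 /\ p = q * 'X^j.
Proof.
move=> pn0; have [j [q]] := multiplicity_XsubC p 0; rewrite pn0 /= subr0 => rq ->.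
by exists j, q; split=> //; move: rq; rewrite /root horner_coef0.
Qed.

Lemma denR_frac h : exists f b, denR f /\ rhoQ f * h = rhoQ b.
Proof.
suff [p [b [pn0 E]]] : exists (p : {poly K}) (b : R), p != 0 /\ mC F G (iF p) * h = rhoQ b.
  have [j [q [q0 Ep]]] := poly_split_X pn0.
  exists (pt q), (tR (- j%:Z) * b); split; first by exists q.
  rewrite rmorphM -E mulrA rhoQ_pt rhoQ_U rmorph1 mul1r -rmorphM Ep (rmorphM iF) (rmorphXn iF).
  congr (mC F G _ * _); rewrite mulrCA -[iF 'X ^+ j]/(iF 'X ^ j%:Z).
  by rewrite -expfzDr ?tF_neq0 // addNr expr0z mulr1.
elim/mring_ind: h => [h h' [p [b [pn0 E]]] [p' [b' [pn0' E']]]|g a].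
  exists (p * p'), (pt p' * b + pt p * b'); split; first by rewrite mulf_neq0.
  rewrite rmorphD !rmorphM -E -E' !rhoQ_pt mulrDr !mulrA; congr (_ * _ + _).
  by rewrite [RHS]mC_central.
have [p [n [pn0 E]]] := iF_frac a.
exists p, (pt n * mC A zmon (mU g 1)); split=> //.
rewrite rmorphM rhoQ_pt rhoQ_U coefQ_U /= expr0z -[mU 1%g 1]/(1 : Q) mulr1.
by rewrite !mU_mul E rmorph1 mulr1.
Qed.

Lemma denR_div f : denR f -> exists z : M -> M,
  [/\ rlin it z, forall m, z (sgM f * m) = m & sbnd it (fun m => m - sgM f * z m)].
Proof.
case=> p [p0 ->]; have pn0 : p != 0 by apply: contraNneq p0 => ->; rewrite coef0.
have cV k : k != 0 -> cKR k * cKR k^-1 = 1 /\ cKR k^-1 * cKR k = 1.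
  by move=> kn0; rewrite -!rmorphM divff // mulVf // rmorph1.
have ld : p`_(size p).-1 != 0 by rewrite -/(lead_coef p) lead_coef_eq0.
have [cd cd'] := cV _ ld; have [c0 c0'] := cV _ p0.
have [z hz] := @lpoly_division_sbnd R (size p).-1 (fun i => cKR p`_i) _ _ cd cd' c0 c0'.
exists z; rewrite sgM_pt; move: hz; rewrite /lpoly prednK // size_poly_gt0 //.
Qed.

Let xM : M := sM 1 - it (tR 1).

Lemma evM_it : cancel it evM.
Proof. by move=> r; rewrite mhomU mulr1. Qed.

Lemma evM_sg : cancel sgM evM.
Proof.
elim/mring_ind=> [u v e e'|k a]; first by rewrite !rmorphD e e'.
by rewrite sgM_U mhomU /= mU_mul mulr1 mul1g.
Qed.

Lemma xM_central m : xM * m = m * xM.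
Proof.
rewrite mulrBl mulrBr; congr (_ - _); first by rewrite sp_central.
by apply: mring_central => k r; rewrite !mU_mul mul1g mulg1 sp_central.
Qed.

Lemma evM_x : evM xM = 0.
Proof. by rewrite rmorphB evM_it mhomU mul1r subrr. Qed.

(** [s - t] has degree one in [s], with unit coefficients [-t] and [1]. The remainder is thus a
    constant, which [evM] identifies because it kills [s - t]. *)
Lemma xM_div : exists y : M -> M, [/\ rlin it y, forall m, y (xM * m) = m &
  forall m, xM * y m = m - it (evM m)].
Proof.
pose c i : R := if i is 0 then - tR 1 else 1.
have t1 : tR 1 * tR (-1) = 1 by rewrite -tRD subrr.
have t2 : tR (-1) * tR 1 = 1 by rewrite -tRD addNr.
have c0 : c 0 * - tR (-1) = 1 by rewrite mulrNN.
have c0' : - tR (-1) * c 0 = 1 by rewrite mulrNN.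
have [y [yl yf ys]] := @lpoly_division R 1 c 1 _ (mulr1 1) (mulr1 1) c0 c0'.
have xE : lpoly 1 c = xM.
  by rewrite /lpoly big_ord_recl big_ord1 /= mUN addrC.
rewrite xE in yf ys; exists y; split=> // m.
have E : m - xM * y m = it (mc (m - xM * y m) (0 : int)).
  by rewrite {1}(spanned_sum (ys m)) big_ord1 mul1r.
have {}E : m - xM * y m = it (evM m).
  rewrite E; congr (it _); rewrite -[LHS]evM_it -E rmorphB rmorphM evM_x mul0r subr0 //.
by rewrite -E opprB addrC subrK.
Qed.

Lemma M_dual_basis (s : seq M) : exists N (b : 'I_N -> M) (c : 'I_N -> M -> R),
  (forall i, rfun it (c i)) /\ forall m, m \in s -> m = \sum_i b i * it (c i m).
Proof.
have [B bB] : exists B : nat, forall m : M, m \in s ->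
    forall k : int, (B <= absz k)%N -> mc m (k : zmon) = 0.
  elim: s => [|m s [B bB]]; first by exists 0.
  have [B' bB'] := mring_bound m; exists (maxn B B') => m'; rewrite inE.
  case/orP=> [/eqP->|m's] k; rewrite geq_max => /andP[Bk B'k]; first exact: bB'.
  exact: bB.
exists (B + B)%N, (fun i => sM (i%:Z - B%:Z)), (fun i (m : M) => mc m (i%:Z - B%:Z : int)).
split=> [i|m ms]; first by split=> [m m'|m r]; rewrite ?mcD // mc_mul_mC.
rewrite {1}(mring_bound_sum (bB m ms)); apply: eq_bigr => i _.
by rewrite mU_mul mul1r mulg1.
Qed.

Theorem chi_rhoQ n (a : 'M[R]_n) : invertible_mx a -> Eprod (map_mx rhoQ a) -> chi a = 0.
Proof.
have [y [yl yx xy]] := xM_div.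
apply: (chi_localization (den := denR) evM_it evM_sg xM_central evM_x yl yx xy M_dual_basis
   rhoQ_inj _ _ _ _ denR_frac denR_div).
- by exists 1; rewrite coef1 oner_neq0 rmorph1.
- move=> _ _ [p [p0 ->]] [q [q0 ->]]; exists (p * q); rewrite rmorphM; split=> //.
  by rewrite coef0M mulf_neq0.
- by move=> _ [p [_ ->]]; apply: sgM_pt_central.
- by move=> _ [p [_ ->]] h; rewrite rhoQ_pt mC_central.
Qed.

Lemma chi_rhoQ_inj n m (a : 'M[R]_n) (b : 'M[R]_m) : invertible_mx a -> invertible_mx b ->
  chi (map_mx rhoQ a) = chi (map_mx rhoQ b) -> chi a = chi b.
Proof. exact: (chi_map_inj chi_rhoQ). Qed.

Definition augF : {rmorphism Q -> F} :=
  @mhom F G F idfun (fun=> 1) erefl (fun _ _ => esym (mulr1 1))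
    (fun a g => etrans (mulr1 a) (esym (mul1r a))).

Lemma laurent_entry (r : R) : exists J (p : {poly K}), iF 'X ^+ J * augF (rhoQ r) = iF p.
Proof.
elim/mring_ind: r => [u v [J [p E]] [J' [p' E']]|k a].
  exists (J + J')%N, ('X^J' * p + 'X^J * p').
  by rewrite !rmorphD !(rmorphM iF) !(rmorphXn iF) -E -E' mulrDr exprD !mulrA [_ ^+ J' * _]mulrC.
elim/mring_ind: a => [u v [J [p E]] [J' [p' E']]|g c].
  exists (J + J')%N, ('X^J' * p + 'X^J * p').
  rewrite mUD !rmorphD !(rmorphM iF) !(rmorphXn iF) -E -E' mulrDr exprD.
  by rewrite !mulrA [_ ^+ J' * _]mulrC.
exists (absz k), (c%:P * 'X^(absz ((k : int) + (absz k)%:Z))).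
rewrite rhoQ_U coefQ_U rmorphM !mhomU /= !mulr1 rmorphM rmorphXn mulrCA; congr (_ * _).
rewrite -[_ ^+ absz k]/(iF 'X ^ (absz k)%:Z) -expfzDr ?tF_neq0 //.
rewrite -[RHS]/(iF 'X ^ (absz _)%:Z); congr (_ ^ _); lia.
Qed.

Lemma laurent_det n (g : 'M[R]_n) : exists J (p : {poly K}),
  iF 'X ^+ J * \det (map_mx augF (map_mx rhoQ g)) = iF p.
Proof.
have [Jf hJ] := choice (fun ij : 'I_n * 'I_n => laurent_entry (g ij.1 ij.2)).
have [pf hp] := choice hJ.
pose J := (\sum_ij Jf ij)%N.
pose P : 'M[{poly K}]_n := \matrix_(i, j) ('X^(J - Jf (i, j)) * pf (i, j)).
exists (J * n)%N, (\det P); rewrite exprM -detZ -det_map_mx; congr (\det _).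
apply/matrixP=> i j; rewrite !mxE rmorphM rmorphXn -(hp (i, j)) mulrA -exprD subnK //.
by rewrite /J (bigD1 (i, j)) //= leq_addr.
Qed.

Hypothesis goodF : forall n (a : 'M[Q]_n), invertible_mx a ->
  exists u : F, u != 0 /\ chi a = chi ((mC F G u)%:M : 'M_1).

(** The scalar [u] provided over [F] is the determinant of the augmented matrix. It and its inverse
    are Laurent polynomials, so [u] is a monomial in [t]; injectivity on classes brings the equality
    back to [R]. *)
Lemma laurent_class n (g : 'M[R]_n) : invertible_mx g ->
  exists (l : K) (k : int),
    l != 0 /\ chi g = chi ((mU (k : zmon) (mC K G l))%:M : 'M[R]_1).
Proof.
move=> invg; have [g' [gg' g'g]] := invg.
have [u [un0 eu]] := goodF (invertible_map rhoQ invg).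
have scal_inv (S : pzRingType) (a b : S) : a * b = 1 -> b * a = 1 ->
    invertible_mx (a%:M : 'M_1).
  by move=> ab ba; exists b%:M; rewrite -!scalar_mxM ab ba.
have invu : invertible_mx ((mC F G u)%:M : 'M_1).
  by apply: (@scal_inv _ _ (mC F G u^-1)); rewrite -rmorphM ?divff ?mulVf ?rmorph1.
have iM1 := invertible_map augF (invertible_map rhoQ invg).
have du : \det (map_mx augF (map_mx rhoQ g)) = u.
  rewrite (chi_det iM1 (invertible_map augF invu)
    (chi_map_eq augF (invertible_map rhoQ invg) invu eu)).
  by rewrite map_scalar_mx det_scalar1 mhomU /= mulr1.
have [J [p Ep]] := laurent_det g; have [J' [p' Ep']] := laurent_det g'.
have dd : \det (map_mx augF (map_mx rhoQ g)) * \det (map_mx augF (map_mx rhoQ g')) = 1.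
  by rewrite -det_mulmx -!map_mxM gg' !map_mx1 det1.
have pp' : p * p' = 'X^(J + J').
  apply/eqP; rewrite -subr_eq0; apply/eqP/iF_inj; rewrite rmorphB rmorphM rmorphXn.
  by rewrite -Ep -Ep' mulrACA dd mulr1 exprD subrr.
have [l [k [ln0 pl]]] := poly_dvd_Xn pp'.
have {du Ep}uE : u = cKF l * iF 'X ^ (k%:Z - J%:Z).
  rewrite du in Ep; apply: (mulfI (expf_neq0 J tF_neq0)); rewrite Ep pl rmorphM rmorphXn.
  rewrite mulrCA -[iF 'X ^+ J]/(iF 'X ^ J%:Z) -expfzDr ?tF_neq0 //.
  by rewrite addrC subrK.
exists l, (k%:Z - J%:Z); split=> //; apply: chi_rhoQ_inj => //.
  apply: (@scal_inv _ _ (mU ((J%:Z - k%:Z : int) : zmon) (mC K G l^-1))).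
    rewrite mU_mul -rmorphM divff // rmorph1 zmonM.
    by rewrite (_ : _ + _ = 0 :> int) //; lia.
  rewrite mU_mul -rmorphM mulVf // rmorph1 zmonM.
  by rewrite (_ : _ + _ = 0 :> int) //; lia.
rewrite eu map_scalar_mx rhoQ_U coefQ_U; congr (chi (_%:M)).
by rewrite -[mU 1%g _]/(mC F G _) -rmorphM uE.
Qed.

End LaurentExtension.

(** * The Toeplitz extension *)

(* [(i, j)] stands for [x^i y^j]; the truncated subtractions implement [y x = 1]. *)
Definition bic : Type := (nat * nat)%type.
HB.instance Definition _ := Choice.on bic.
Definition bic_mul (p q : bic) : bic := (p.1 + (q.1 - p.2), q.2 + (p.2 - q.1))%N.
Fact bic_mulA : associative bic_mul.
Proof. by move=> [a b] [c d] [u v]; congr (_, _) => /=; lia. Qed.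
Fact bic_mul1 : left_id ((0, 0)%N : bic) bic_mul.
Proof. by move=> [a b]; congr (_, _) => /=; lia. Qed.
Fact bic_mulr1 : right_id ((0, 0)%N : bic) bic_mul.
Proof. by move=> [a b]; congr (_, _) => /=; lia. Qed.
HB.instance Definition _ := isMonoid.Build bic bic_mulA bic_mul1 bic_mulr1.

Definition bx (i j : nat) : bic := (i, j).
Lemma bxM i j k l : (bx i j * bx k l)%g = bx (i + (k - j)) (l + (j - k)). Proof. by []. Qed.

Lemma mulg_pair (G H : monoidType) (a b : G) (c d : H) : ((a, c) * (b, d))%g = ((a * b)%g, (c * d)%g).
Proof. by []. Qed.

Section Toeplitz.
Variables (K : fieldType) (G : monoidType).
Local Notation A := (mring K G).
Local Notation R := (mring A zmon).
Local Notation T := (mring K (bic * G)%type).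

Definition mon (i j : nat) (g : G) (c : K) : T := mU ((bx i j, g) : (bic * G)%type) c.

Lemma monM i j g c k l h d :
  mon i j g c * mon k l h d = mon (i + (k - j)) (l + (j - k)) (g * h)%g (c * d).
Proof. by rewrite /mon mU_mul mulg_pair bxM. Qed.

Lemma mon_one : mon 0 0 1%g 1 = 1. Proof. by []. Qed.

Lemma T_ind (P : T -> Prop) : (forall u v, P u -> P v -> P (u + v)) ->
  (forall i j g c, P (mon i j g c)) -> forall u, P u.
Proof. by move=> PD PM u; elim/mring_ind: u => // -[[i j] g] c; apply: PM. Qed.

Definition tx : T := mon 1 0 1%g 1.
Definition ty : T := mon 0 1 1%g 1.
Definition te : T := locked (1 - mon 1 1 1%g 1).
Lemma teE : te = 1 - mon 1 1 1%g 1. Proof. by rewrite /te -lock. Qed.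

Lemma tyx : ty * tx = 1. Proof. by rewrite monM mulg1 mulr1. Qed.
Lemma txy : tx * ty = 1 - te. Proof. by rewrite monM mulg1 mulr1 teE opprB addrC subrK. Qed.

Lemma te_monS i j g c : te * mon i.+1 j g c = 0.
Proof.
rewrite teE mulrBl mul1r monM mul1g mul1r; apply/eqP; rewrite subr_eq0; apply/eqP.
by congr (mon _ _ _ _); lia.
Qed.

Lemma monS_te i j g c : mon i j.+1 g c * te = 0.
Proof.
rewrite teE mulrBr mulr1 monM mulg1 mulr1; apply/eqP; rewrite subr_eq0; apply/eqP.
by congr (mon _ _ _ _); lia.
Qed.

Lemma te_tx : te * tx = 0. Proof. exact: te_monS. Qed.
Lemma ty_te : ty * te = 0. Proof. exact: monS_te. Qed.
Lemma te_te : te * te = te.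
Proof. by rewrite {2}teE mulrBr mulr1 te_monS subr0. Qed.

Fact iA_M (g h : G) : mon 0 0 (g * h)%g 1 = mon 0 0 g 1 * mon 0 0 h 1.
Proof. by rewrite monM mulr1. Qed.

Definition iA : {rmorphism A -> T} :=
  @mhom K G T (mC K (bic * G)%type) (fun g => mon 0 0 g 1) erefl iA_M
   (fun a g => mC_central _ _).

Lemma iA_U g c : iA (mU g c) = mon 0 0 g c.
Proof. by rewrite mhomU /mon mU_mul mulr1 mul1g. Qed.

Lemma te_iA a : te * iA a = iA a * te.
Proof.
elim/mring_ind: a => [u v e e'|g c]; first by rewrite rmorphD mulrDr e e' mulrDl.
rewrite iA_U teE mulrBl mulrBr mul1r mulr1 !monM mulg1 mul1g mulr1 mul1r.
by congr (_ - mon _ _ _ _).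
Qed.

(** Since [e x = 0] and [y e = 0], only the terms of [w] free of [x] and [y] survive in [e w e]. *)
Lemma te_corner w : exists a : A, te * w * te = te * iA a.
Proof.
elim/T_ind: w => [u v [a ea] [b eb]|i j g c].
  by exists (a + b); rewrite mulrDr mulrDl ea eb rmorphD mulrDr.
case: i => [|i]; last by exists 0; rewrite te_monS mul0r rmorph0 mulr0.
case: j => [|j]; last by exists 0; rewrite -mulrA monS_te rmorph0 !mulr0.
by exists (mU g c); rewrite -iA_U -mulrA -te_iA mulrA te_te.
Qed.

Lemma te_iA_inj a : te * iA a = 0 -> a = 0.
Proof.
move=> ea; apply: mring_eq => g; rewrite mc0.
have <- : mc (te * iA a) (bx 0 0, g) = mc a g; last by rewrite ea mc0.
elim/mring_ind: (a) => [u v e e'|h c]; first by rewrite rmorphD mulrDr !mcD e e'.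
rewrite iA_U teE mulrBl mul1r monM mul1g mul1r mcD mcN !mcU !xpair_eqE /= subr0.
by case: eqP.
Qed.

(** This is [(1 - e) + e D]: the matrix [D] placed in the corner [e T e], a copy of [A], and the
    identity on the complement. *)
Definition phie N (D : 'M[A]_N) : 'M[T]_N := 1%:M + te *: map_mx iA (D - 1%:M).

Lemma scale_te_mul n m p (X : 'M[A]_(n, m)) (Y : 'M[A]_(m, p)) :
  (te *: map_mx iA X) *m (te *: map_mx iA Y) = te *: map_mx iA (X *m Y).
Proof.
apply/matrixP=> i j; rewrite !mxE rmorph_sum mulr_sumr; apply: eq_bigr => k _.
by rewrite !mxE rmorphM -mulrA [iA (X i k) * _]mulrA -te_iA !mulrA te_te.
Qed.

Lemma phieM N (D D' : 'M[A]_N) : phie (D *m D') = phie D *m phie D'.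
Proof.
rewrite /phie mulmxDl mul1mx mulmxDr mulmx1 scale_te_mul -!addrA; congr (_ + _).
rewrite -!scalerDr -!map_mxD; congr (te *: map_mx iA _).
rewrite -{1}[D](subrK 1%:M) -{1}[D'](subrK 1%:M); move: (D - _) (D' - _) => X Y.
by rewrite mulmxDl mul1mx mulmxDr mulmx1 addrA addrK addrC [X *m Y + X]addrC.
Qed.

Lemma phie1 N : phie (1%:M : 'M[A]_N) = 1%:M.
Proof. by rewrite /phie subrr map_mx0 scaler0 addr0. Qed.

Lemma phie_Eprod N (D : 'M[A]_N) : Eprod D -> Eprod (phie D).
Proof.
elim=> [|e a [i [j [c [ij ->]]]] _ IH]; first by rewrite phie1; apply: Eprod1.
rewrite phieM; apply: EprodM => //; exists i, j, (te * iA c); split=> //.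
rewrite /phie addrAC subrr add0r map_mxZ map_delta_mx; congr (_ + _).
by rewrite scalerA.
Qed.

Lemma phie_invertible N (D : 'M[A]_N) : invertible_mx D -> invertible_mx (phie D).
Proof. by case=> D' [DD' D'D]; exists (phie D'); rewrite -!phieM DD' D'D phie1. Qed.

Lemma te_phie N (D : 'M[A]_N) i k : te * phie D i k = iA (D i k) * te.
Proof.
rewrite !mxE mulrDr mulrA te_te -mulrDr -te_iA; congr (te * _).
by rewrite rmorphB rmorph_nat addrC subrK.
Qed.

Lemma phie_te N (D : 'M[A]_N) i k : phie D i k * te = te * iA (D i k).
Proof.
rewrite !mxE mulrDl -mulrA -te_iA mulrA te_te.
have -> : (i == k)%:R * te = te * (i == k)%:R by rewrite mulr_natl mulr_natr.
by rewrite -mulrDr rmorphB rmorph_nat [_ + (_ - _)]addrC subrK.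
Qed.

Lemma corner_mx N (H : 'M[T]_N) :
  exists c : 'M[A]_N, forall i j, te * H i j * te = te * iA (c i j).
Proof.
have [c hc] := choice (fun ij : 'I_N * 'I_N => te_corner (H ij.1 ij.2)).
by exists (\matrix_(i, j) c (i, j)) => i j; rewrite mxE -hc.
Qed.

(** Compressing by [e] on both sides turns the equation into [e D c = e], where [c] is the corner of
    [H]. The one-sided form serves the index argument. *)
Lemma phie_rinv N (D : 'M[A]_N) (H : 'M[T]_N) : phie D *m H = 1%:M ->
  exists c, D *m c = 1%:M.
Proof.
move=> DH; have [c hc] := corner_mx H; exists c; apply/matrixP=> i j.
apply/eqP; rewrite -subr_eq0; apply/eqP/te_iA_inj; rewrite rmorphB mulrBr.
have /(congr1 (fun z => te * z * te)) := congr1 (fun Z : 'M_N => Z i j) DH.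
rewrite mxE mulr_sumr mulr_suml => E.
have {1}-> : te * iA ((D *m c) i j) = te * (1%:M : 'M[T]_N) i j * te.
  rewrite -E mxE rmorph_sum mulr_sumr; apply: eq_bigr => k _.
  rewrite mulrA te_phie -[RHS]mulrA -mulrA [te * (_ * te)]mulrA hc.
  by rewrite rmorphM !mulrA te_iA.
by rewrite !mxE rmorph_nat; case: (i == j); rewrite ?mulr1 ?mulr0 ?mul0r ?te_te subrr.
Qed.

Lemma phie_linv N (D : 'M[A]_N) (H : 'M[T]_N) : H *m phie D = 1%:M ->
  exists c, c *m D = 1%:M.
Proof.
move=> DH; have [c hc] := corner_mx H; exists c; apply/matrixP=> i j.
apply/eqP; rewrite -subr_eq0; apply/eqP/te_iA_inj; rewrite rmorphB mulrBr.
have /(congr1 (fun z => te * z * te)) := congr1 (fun Z : 'M_N => Z i j) DH.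
rewrite mxE mulr_sumr mulr_suml => E.
have {1}-> : te * iA ((c *m D) i j) = te * (1%:M : 'M[T]_N) i j * te.
  rewrite -E mxE rmorph_sum mulr_sumr; apply: eq_bigr => k _.
  by rewrite -!mulrA phie_te !mulrA hc rmorphM !mulrA.
by rewrite !mxE rmorph_nat; case: (i == j); rewrite ?mulr1 ?mulr0 ?mul0r ?te_te subrr.
Qed.

Lemma phie_invertibleV N (D : 'M[A]_N) : invertible_mx (phie D) -> invertible_mx D.
Proof.
case=> H [/phie_rinv[c Dc] /phie_linv[c' c'D]]; exists c; split=> //.
by rewrite -(_ : c' = c) // -[c']mulmx1 -Dc mulmxA c'D mul1mx.
Qed.

(** Matrices over the ideal generated by [e], in a factored form to which the swap identity
    applies. *)
Definition inI n m (C : 'M[T]_(n, m)) : Prop :=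
  exists N (U : 'M[T]_(n, N)) (V : 'M[T]_(N, m)), C = U *m te%:M *m V.

Lemma inI_add n m (C C' : 'M[T]_(n, m)) : inI C -> inI C' -> inI (C + C').
Proof.
move=> [N [U [V ->]]] [N' [U' [V' ->]]]; exists (N + N')%N, (row_mx U U'), (col_mx V V').
by rewrite -[RHS]mulmxA (@scalar_mx_block _ N N' te) mul_block_col !mul0mx add0r addr0 mul_row_col !mulmxA.
Qed.

Lemma inI0 n m : inI (0 : 'M[T]_(n, m)).
Proof. by exists 0%N, 0, 0; rewrite mulmx0. Qed.

Lemma inI_mul n m p q (P : 'M[T]_(p, n)) (C : 'M[T]_(n, m)) (Q : 'M[T]_(m, q)) :
  inI C -> inI (P *m C *m Q).
Proof.
by move=> [N [U [V ->]]]; exists N, (P *m U), (V *m Q); rewrite !mulmxA.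
Qed.

Lemma inI_entries n m (C : 'M[T]_(n, m)) :
  (forall i j, inI ((C i j)%:M : 'M_1)) -> inI C.
Proof.
move=> H; rewrite [C]matrix_sum_delta.
apply: (big_ind (@inI n m)) => [||i _]; [exact: inI0|exact: inI_add|].
apply: (big_ind (@inI n m)) => [||j _]; [exact: inI0|exact: inI_add|].
have := inI_mul (delta_mx i 0) (delta_mx 0 j) (H i j).
rewrite (_ : _ *m _ = C i j *: delta_mx i j) //.
apply/matrixP=> k l; rewrite !mxE big_ord1 !mxE big_ord1 !mxE eqxx mulr1n.
by case: eqP; case: eqP; rewrite ?mul1r ?mulr1 ?mul0r ?mulr0.
Qed.

(** By idempotence [U e V = (U e) (e V)], and the swapped product [e V U e] lies in the corner. *)
Lemma inI_phie n (C : 'M[T]_n) : inI C ->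
  exists N (D : 'M[A]_N) (U : 'M[T]_(n, N)) (V : 'M[T]_(N, n)),
    C = U *m V /\ 1%:M + V *m U = phie D.
Proof.
move=> [N [U [V ->]]]; pose W : 'M[T]_N := V *m U.
have [c hc] := corner_mx W.
exists N, (1%:M + c), (U *m te%:M), (te%:M *m V); split.
  by rewrite mulmxA -[_ *m te%:M *m te%:M]mulmxA -scalar_mxM te_te.
rewrite /phie [1%:M + c]addrC addrK; congr (_ + _); apply/matrixP=> i j.
rewrite -[LHS]/((te%:M *m V *m (U *m te%:M)) i j) mulmxA -[te%:M *m V *m U]mulmxA -/W.
rewrite mxE (bigD1 j) //= big1 ?addr0 => [|k /negbTE kj]; last first.
  by rewrite [te%:M k j]mxE kj mulr0n mulr0.
by rewrite [te%:M j j]mxE eqxx mulr1n mul_scalar_mx mxE hc !mxE.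
Qed.

Definition sg_mon (p : (bic * G)%type) : R :=
  mU ((p.1.1%:Z - p.1.2%:Z : int) : zmon) (mU p.2 1).

Fact sg_monM (p q : (bic * G)%type) : sg_mon (p * q)%g = sg_mon p * sg_mon q.
Proof.
case: p q => [[i j] g] [[k l] h]; rewrite /sg_mon mulg_pair /= mU_mul mU_mul mulr1 zmonM.
by congr (mU _ _); rewrite /bic_mul /=; lia.
Qed.

Definition sgT : {rmorphism T -> R} :=
  @mhom K (bic * G)%type R (cKR K G) sg_mon erefl sg_monM (fun a p => cKR_central _ _).

Lemma sgT_mon i j g c : sgT (mon i j g c) = mU ((i%:Z - j%:Z : int) : zmon) (mU g c).
Proof. by rewrite mhomU /= /sg_mon /= mU_mul mU_mul !mul1g mulr1. Qed.

Definition pmon (k : int) : nat * nat := match k with Posz i => (i, 0%N) | Negz j => (0%N, j.+1) end.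

(** An additive section of [sgT]: [t^k] goes to [x^k] for [k >= 0] and to [y^(-k)] for [k < 0]. *)
Definition lamT (r : R) : T :=
  mlin (fun (k : zmon) (a : A) => mon (pmon (k : int)).1 (pmon (k : int)).2 1%g 1 * iA a) r.

Fact lamT_inner (k : zmon) (a b : A) :
  mon (pmon (k : int)).1 (pmon (k : int)).2 1%g 1 * iA (a + b) =
  mon (pmon (k : int)).1 (pmon (k : int)).2 1%g 1 * iA a +
  mon (pmon (k : int)).1 (pmon (k : int)).2 1%g 1 * iA b.
Proof. by rewrite rmorphD mulrDr. Qed.

Lemma lamTD r r' : lamT (r + r') = lamT r + lamT r'.
Proof. exact: (mlinD lamT_inner). Qed.

Lemma lamT_U (k : int) a :
  lamT (mU (k : zmon) a) = mon (pmon k).1 (pmon k).2 1%g 1 * iA a.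
Proof. exact: (mlinU lamT_inner). Qed.

Lemma sgT_lam r : sgT (lamT r) = r.
Proof.
elim/mring_ind: r => [u v e e'|k a]; first by rewrite lamTD rmorphD e e'.
rewrite lamT_U; elim/mring_ind: a => [u v e e'|g c].
  by rewrite rmorphD mulrDr rmorphD e e' mUD.
rewrite iA_U monM mul1g mul1r sgT_mon; congr (mU _ _).
by case: (k : int) => n /=; lia.
Qed.

(** [x^(i+1) y^(j+1)] and [x^i y^j] differ by [x^i e y^j]; the induction lowers both exponents until
    one of them is 0. *)
Lemma inI_mon i j g c :
  inI ((mon i j g c - mon (pmon (i%:Z - j%:Z)).1 (pmon (i%:Z - j%:Z)).2 g c)%:M : 'M_1).
Proof.
elim: i j => [|i IH] j.
  rewrite (_ : pmon _ = (0%N, j)); last by case: j => // j; rewrite sub0r -NegzE.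
  by rewrite subrr raddf0; apply: inI0.
case: j => [|j]; first by rewrite subr0 subrr raddf0; apply: inI0.
have -> : i.+1%:Z - j.+1%:Z = i%:Z - j%:Z by lia.
have := IH j; set r := mon (pmon _).1 _ _ _ => Hr.
have -> : mon i.+1 j.+1 g c - r = - (mon i 0 g c * te * mon 0 j 1%g 1) + (mon i j g c - r).
  have -> : mon i 0 g c * te * mon 0 j 1%g 1 = mon i j g c - mon i.+1 j.+1 g c.
    rewrite teE mulrBr mulr1 mulrBl !monM !mulg1 !mulr1.
    by congr (mon _ _ _ _ - mon _ _ _ _); lia.
  by rewrite opprB addrA subrK.
rewrite raddfD; apply: inI_add => //.
exists 1%N, ((- mon i 0 g c)%:M), ((mon 0 j 1%g 1)%:M).
by rewrite -!scalar_mxM !mulNr.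
Qed.

Lemma inI_lam u : inI ((u - lamT (sgT u))%:M : 'M_1).
Proof.
elim/T_ind: u => [u v e e'|i j g c].
  rewrite (rmorphD sgT) lamTD opprD addrACA raddfD; exact: inI_add.
have := inI_mon i j g c; rewrite sgT_mon lamT_U iA_U monM mul1g mul1r.
by rewrite addn0 add0n subn0.
Qed.

Lemma inI_ker n m (C : 'M[T]_(n, m)) : map_mx sgT C = 0 -> inI C.
Proof.
move=> H; apply: inI_entries => i j; have := inI_lam (C i j).
have -> : sgT (C i j) = 0 by have := congr1 (fun Z : 'M_(n, m) => Z i j) H; rewrite !mxE.
by rewrite (add_fun0 lamTD) subr0.
Qed.

Lemma Eprod_lift n (h : 'M[R]_n) : Eprod h ->
  exists e : 'M[T]_n, Eprod e /\ map_mx sgT e = h.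
Proof.
elim=> [|_ a [i [j [c [ij ->]]]] _ [e [Ee es]]].
  by exists 1%:M; rewrite map_mx1; split=> //; apply: Eprod1.
exists ((1%:M + lamT c *: delta_mx i j) *m e); split.
  by apply: EprodM => //; exists i, j, (lamT c).
by rewrite map_mxM es map_mxD map_mx1 map_mxZ map_delta_mx sgT_lam.
Qed.

Lemma phie_pad N n (D : 'M[A]_n) : (n <= N)%N -> phie (pad N D) = pad N (phie D).
Proof.
case/leq_exists_add=> k ->; rewrite !pad_dsum /phie -[X in _ - X](dsum1 A) opp_block_mx.
rewrite add_block_mx !oppr0 !addr0 subrr map_block_mx !map_mx0 scale_block_mx !scaler0.
by rewrite -[X in X + _](dsum1 T) add_block_mx !addr0.
Qed.

(** The elementary factor lifts along [sgT]; once it is removed, [g] differs from [w] by a matrix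
    over the kernel. *)
Lemma lift_decomp n (g : 'M[T]_n) (w : 'M[T]_1) : k1rel (map_mx sgT g) (map_mx sgT w) ->
  exists N (e C : 'M[T]_N), [/\ (n <= N)%N, (1 <= N)%N, Eprod e, inI C &
    pad N g = e *m (pad N w + C)].
Proof.
move=> [N [e0 [nN mN /Eprod_lift[e [Ee es]] eq]]].
have [e' [Ee' ee' e'e]] := Eprod_inv Ee.
exists N, e, (e' *m pad N g - pad N w); split=> //.
  apply: inI_ker; rewrite map_mxB map_mxM !map_pad eq -es mulmxA -map_mxM e'e map_mx1.
  by rewrite mul1mx subrr.
by rewrite addrC subrK mulmxA ee' mul1mx.
Qed.

Lemma one_side_swap (n m : nat) (U : 'M[T]_(n, m)) (V : 'M[T]_(m, n)) (H : 'M[T]_m) :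
  H *m (1%:M + V *m U) = 1%:M -> (1%:M - U *m H *m V) *m (1%:M + U *m V) = 1%:M.
Proof.
move=> HV; rewrite mulmxBl mul1mx mulmxDr mulmx1.
have -> : U *m H *m V *m (U *m V) = U *m (H *m (V *m U)) *m V by rewrite !mulmxA.
have -> : H *m (V *m U) = 1%:M - H by rewrite -HV mulmxDr mulmx1 addrAC subrr add0r.
by rewrite mulmxBr mulmx1 mulmxBl [X in _ - X]addrC subrK addrK.
Qed.

Lemma one_side_swapr (n m : nat) (U : 'M[T]_(n, m)) (V : 'M[T]_(m, n)) (H : 'M[T]_m) :
  (1%:M + V *m U) *m H = 1%:M -> (1%:M + U *m V) *m (1%:M - U *m H *m V) = 1%:M.
Proof.
move=> HV; rewrite mulmxBr mulmx1 mulmxDl mul1mx.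
have -> : U *m V *m (U *m H *m V) = U *m (V *m U *m H) *m V by rewrite !mulmxA.
have -> : V *m U *m H = 1%:M - H by rewrite -HV mulmxDl mul1mx addrAC subrr add0r.
by rewrite mulmxBr mulmx1 mulmxBl [X in _ - X]addrC subrK addrK.
Qed.

(* If [sgT g] had the class of [l t^j] with [j > 0], then [g] would be, up to
   elementary matrices, a finite-rank perturbation of [diag(l x^j, 1, .., 1)];
   Dedekind-finiteness of the matrices over [A] (index zero) then makes [x^j]
   itself invertible. *)
Lemma index_absurd : (forall N (a b : 'M[A]_N), a *m b = 1%:M -> b *m a = 1%:M) ->
  forall n (g : 'M[T]_n) (l : K) (j : nat), invertible_mx g -> l != 0 ->
  k1rel (map_mx sgT g) (map_mx sgT ((mon j.+1 0 1%g l)%:M : 'M[T]_1)) -> False.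
Proof.
move=> DF n g l j [g' [gg' g'g]] ln0 /lift_decomp.
set w := _%:M => -[N [e [C [nN N1 Ee IC E]]]].
pose w' : 'M[T]_1 := (mon 0 j.+1 1%g l^-1)%:M.
have w'w : w' *m w = 1%:M by rewrite -scalar_mxM monM mulg1 mulVf // subnn.
have [e' [Ee' ee' e'e]] := Eprod_inv Ee.
have w'wN : pad N w' *m pad N w = 1%:M by rewrite -padM // w'w pad1.
have ZE : pad N w' *m (e' *m pad N g) = 1%:M + pad N w' *m C.
  by rewrite E [e' *m _]mulmxA e'e mul1mx mulmxDr w'wN.
have IC' : inI (pad N w' *m C) by rewrite -[_ *m C]mulmx1; apply: inI_mul.
have [N' [D [U [V [CUV VU]]]]] := inI_phie IC'.
pose Y := e' *m pad N g; pose Y' := pad N g' *m e.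
have YY' : Y *m Y' = 1%:M.
  rewrite /Y /Y' mulmxA -[e' *m _ *m _]mulmxA -padM // gg' pad1 mulmx1 e'e //.
have Y'Y : Y' *m Y = 1%:M.
  by rewrite /Y /Y' mulmxA -[pad N g' *m _ *m _]mulmxA ee' mulmx1 -padM // g'g pad1.
(* [w' Y = 1 + U V] is right invertible, hence so are [1 + V U = phie D] and [D]. Over [A] this
   inverse is two-sided, which returns a left inverse [Zl] of [w' Y]. *)
have Zr : (1%:M + U *m V) *m (Y' *m pad N w) = 1%:M.
  by rewrite -CUV -ZE -/Y mulmxA -[_ *m Y *m Y']mulmxA YY' mulmx1 w'wN.
have [c Dc] : exists c, D *m c = 1%:M.
  by apply: (@phie_rinv _ D (1%:M - V *m (Y' *m pad N w) *m U)); rewrite -VU one_side_swapr.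
have : phie c *m (1%:M + V *m U) = 1%:M by rewrite VU -phieM (DF _ _ _ Dc) phie1.
move/one_side_swap; set Zl := 1%:M - _; rewrite -CUV -ZE -/Y => ZlZ.
(* [Y Zl] is a left inverse of [w'] and [w] a right one, so they agree and [w w' = 1]. This reads
   [x^(j+1) y^(j+1) = 1], refuted by the coefficient at the unit. *)
have Bw' : (Y *m Zl) *m pad N w' = 1%:M.
  have : Zl *m pad N w' = Y' by rewrite -[LHS]mulmx1 -YY' mulmxA -[_ *m Y]mulmxA ZlZ mul1mx.
  by move=> H; rewrite -mulmxA H YY'.
have Bw : Y *m Zl = pad N w by rewrite -[LHS]mulmx1 -w'wN mulmxA Bw' mul1mx.
rewrite Bw -padM // -scalar_mxM monM in Bw'.
have := congr1 (fun Z : 'M[T]_N => mc (Z (Ordinal N1) (Ordinal N1)) (bx 0 0, 1%g)) Bw'.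
rewrite !mxE (mxext_ord _ (0 : 'I_1) (0 : 'I_1)) !mxE !eqxx !mulr1n mcU.
by rewrite -mon_one mcU eqxx xpair_eqE /= => /esym/eqP; rewrite oner_eq0.
Qed.

Lemma invertible_scalar (S : pzRingType) (a b : S) : a * b = 1 -> b * a = 1 ->
  invertible_mx (a%:M : 'M_1).
Proof. by move=> ab ba; exists b%:M; rewrite -!scalar_mxM ab ba. Qed.

(* Conjugating [diag(c, 1)] by [W] gives [diag(c x y + e, 1)]. *)
Lemma chi_phie_scalar (l : K) : l != 0 -> chi (phie ((mC K G l)%:M : 'M_1)) = 0.
Proof.
(* With [c = l^-1] and [d = 1 + (l - 1) e] one has [c d = c x y + e], so the conjugation yields [c]
   + [d] = [c]. *)
move=> ln0; pose c : T := mC K _ l^-1; pose c' : T := mC K _ l.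
have cc' : c * c' = 1 by rewrite -rmorphM mulVf // rmorph1.
have c'c : c' * c = 1 by rewrite -rmorphM divff // rmorph1.
have ccen u : c * u = u * c by apply: mC_central.
pose W : 'M[T]_(1 + 1) := block_mx tx%:M te%:M 0 ty%:M.
pose W' : 'M[T]_(1 + 1) := block_mx ty%:M 0 te%:M tx%:M.
have WW' : W *m W' = 1%:M.
  rewrite mulmx_block !mulmx0 !mul0mx !add0r -!scalar_mxM te_tx ty_te tyx txy te_te.
  by rewrite raddf0 -raddfD subrK dsum1.
have W'W : W' *m W = 1%:M.
  rewrite mulmx_block !mulmx0 !mul0mx !addr0 -!scalar_mxM te_tx ty_te tyx txy te_te.
  by rewrite raddf0 -raddfD addrC subrK dsum1.
pose d : T := 1 + te * (c' - 1).
have cd : c * d = tx * c * ty + te.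
  rewrite -mulrA [c * ty]ccen mulrA txy mulrBl mul1r mulrDr mulr1 /d.
  rewrite mulrA [c * te]ccen -mulrA mulrBr cc' mulr1 mulrBr mulr1.
  by rewrite addrA addrAC.
have dE : phie ((mC K G l)%:M : 'M_1) = d%:M.
  apply/matrixP=> i j; rewrite !mxE !ord1 eqxx !mulr1n rmorphB rmorph1 iA_U.
  by [].
have inv1 : invertible_mx (d%:M : 'M_1).
  rewrite -dE; apply: phie_invertible.
  by apply: (@invertible_scalar _ _ (mC K G l^-1)); rewrite -rmorphM ?divff ?mulVf ?rmorph1.
have invc : invertible_mx (c%:M : 'M_1) by apply: (invertible_scalar cc').
have invW : invertible_mx W by exists W'.
have invW' : invertible_mx W' by exists W.
have invcc := invertible_dsum invc (invertible_mx1 T 1).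
have E : W *m (c%:M <+> 1%:M) *m W' = (c%:M *m d%:M) <+> 1%:M.
  rewrite !mulmx_block !(mulmx0, mul0mx, mulmx1, mul1mx, add0r, addr0) -!scalar_mxM cd.
  by rewrite te_tx ty_te tyx te_te raddf0 -raddfD.
rewrite dE; have := congr1 (@chi _ _) E.
rewrite chiM //; last exact: invertible_mulmx.
rewrite chiM // (chiV WW' W'W) addrAC subrr add0r !chi_dsum1 //; last exact: invertible_mulmx.
by rewrite chiM // => /eqP; rewrite -subr_eq0 opprD addrA subrr sub0r oppr_eq0 => /eqP.
Qed.

(** Up to an elementary factor and the scalar [l], [g] is [1 + U V] over the ideal, with the class
    of [1 + V U = phie D]. As [phie] preserves elementary products, [D] may be replaced by a scalar
    [u], whose image has trivial class. *)
Lemma chi_toeplitz n (g : 'M[T]_n) (l : K) : invertible_mx g -> l != 0 ->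
  (forall N (D : 'M[A]_N), invertible_mx D ->
     exists u : K, u != 0 /\ chi D = chi ((mC K G u)%:M : 'M_1)) ->
  chi (map_mx sgT g) = chi ((mC A zmon (mC K G l))%:M : 'M_1) ->
  chi g = chi ((mC K (bic * G)%type l)%:M : 'M_1).
Proof.
move=> invg ln0 goodA; pose c : T := mC K _ l; pose c' : T := mC K _ l^-1.
have cc' : c * c' = 1 by rewrite -rmorphM divff // rmorph1.
have c'c : c' * c = 1 by rewrite -rmorphM mulVf // rmorph1.
have invc : invertible_mx (c%:M : 'M_1) by apply: (invertible_scalar cc').
have -> : (mC A zmon (mC K G l))%:M = map_mx sgT (c%:M : 'M_1).
  by rewrite map_scalar_mx (sgT_mon 0 0 1%g l) subrr.
move/(chi_eqP (invertible_map sgT invg) (invertible_map sgT invc))/lift_decomp.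
case=> N [e [C [nN N1 Ee IC E]]].
have pcc' : pad N (c%:M : 'M_1) *m pad N (c'%:M : 'M_1) = 1%:M.
  by rewrite -padM // -scalar_mxM cc' pad1.
pose C' := pad N (c'%:M : 'M_1) *m C.
have {}E : pad N g = e *m (pad N (c%:M : 'M_1) *m (1%:M + C')).
  by rewrite E mulmxDr mulmx1 mulmxA pcc' mul1mx.
have IC' : inI C' by rewrite -[C']mulmx1; apply: inI_mul.
have invp : invertible_mx (pad N (c%:M : 'M_1)) by apply: invertible_pad.
have inv1 : invertible_mx (1%:M + C').
  have [e' [_ ee' e'e]] := Eprod_inv Ee.
  have -> : 1%:M + C' = pad N (c'%:M : 'M_1) *m (e' *m pad N g).
    rewrite E [e' *m _]mulmxA e'e mul1mx mulmxA -padM // -scalar_mxM c'c pad1 mul1mx //.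
  apply: invertible_mulmx; first by apply: invertible_pad => //; apply: (invertible_scalar c'c).
  by apply: invertible_mulmx; [exists e|apply: invertible_pad].
have [N' [D [U [V [CUV VU]]]]] := inI_phie IC'.
have invD : invertible_mx D.
  by apply: phie_invertibleV; rewrite -VU; apply: invertible_swap; rewrite -CUV.
have -> : chi g = chi (pad N g).
  by apply/chi_eqP => //; [apply: invertible_pad|apply/k1rel_sym/k1rel_pad].
have -> : chi (c%:M : 'M_1) = chi (pad N (c%:M : 'M_1)).
  by apply/chi_eqP => //; apply/k1rel_sym/k1rel_pad.
rewrite E (chi_EprodMl Ee (invertible_mulmx invp inv1)) chiM //.
rewrite CUV chi_swap VU -[RHS]addr0; congr (_ + _).
have [u [un0 Du]] := goodA _ _ invD; rewrite -(chi_phie_scalar un0).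
have invu : invertible_mx ((mC K G u)%:M : 'M_1).
  by apply: (@invertible_scalar _ _ (mC K G u^-1)); rewrite -rmorphM ?divff ?mulVf ?rmorph1.
have /(chi_eqP invD invu)[N0 [e0 [nN0 mN0 Ee0 eq]]] := Du.
apply/chi_eqP; [exact: phie_invertible|exact: phie_invertible|].
exists N0, (phie e0); split=> //; first exact: phie_Eprod.
by rewrite -!phie_pad // eq phieM.
Qed.

End Toeplitz.

(** * Adjoining a bicyclic factor *)

Definition onem : Type := unit.
HB.instance Definition _ := Choice.on onem.
Fact onem_mulA : associative (fun _ _ : onem => tt : onem). Proof. by []. Qed.
Fact onem_mul1 : left_id (tt : onem) (fun _ _ : onem => tt : onem). Proof. by case. Qed.
Fact onem_mulr1 : right_id (tt : onem) (fun _ _ : onem => tt : onem). Proof. by case. Qed.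
HB.instance Definition _ := isMonoid.Build onem onem_mulA onem_mul1 onem_mulr1.

(** Gaussian elimination: a row addition makes the pivot nonzero, and the Schur complement [d]
    carries the induction. *)
Lemma chi_field (K : fieldType) n (a : 'M[K]_n) : invertible_mx a ->
  exists u : K, u != 0 /\ chi a = chi (u%:M : 'M_1).
Proof.
elim: n a => [|n IH] a inva.
  exists 1; rewrite oner_neq0 chi1; split=> //.
  by rewrite (_ : a = 1%:M) ?chi1 // [a]flatmx0 [RHS]flatmx0.
wlog a00 : a inva / a 0 0 != 0 => [H|].
  have [a0|] := eqVneq (a 0 0) 0; last exact: H.
  have [i ai] : exists i, a i 0 != 0.
    case: inva => b [_ ba]; apply/existsP; apply: contraPT (oner_neq0 K) => /existsPn ai.
    have := congr1 (fun Z : 'M_n.+1 => Z 0 0) ba; rewrite !mxE eqxx big1 => [->|k _].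
      by rewrite eqxx.
    by have /negPn/eqP-> := ai k; rewrite mulr0.
  have i0 : 0 != i by apply: contraNneq ai => <-; rewrite a0.
  have Ee : Eprod (1%:M + 1 *: delta_mx 0 i : 'M[K]_n.+1).
    by apply: elementary_Eprod; exists 0, i, 1.
  have := H ((1%:M + 1 *: delta_mx 0 i) *m a).
  rewrite (chi_EprodMl Ee inva); apply.
    by apply: invertible_mulmx => //; apply: invertible_Eprod.
  rewrite scale1r mulmxDl mul1mx mxE a0 add0r mxE (bigD1 i) //= big1 => [|k /negbTE ki].
    by rewrite mxE !eqxx mul1r addr0.
  by rewrite mxE ki andbF mul0r.
pose a' : 'M[K]_(1 + n) := a; pose p : K := a 0 0.
pose b := ursubmx a'; pose c := dlsubmx a'; pose d : 'M[K]_n := drsubmx a' - c *m p^-1%:M *m b.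
have aE : a' = block_mx 1%:M 0 (c *m p^-1%:M) 1%:M
    *m ((p%:M <+> 1%:M) *m (1%:M <+> d) *m block_mx 1%:M (p^-1%:M *m b) 0 1%:M).
  have pp' : p%:M *m p^-1%:M = 1%:M :> 'M[K]_1 by rewrite -scalar_mxM divff.
  have p'p : p^-1%:M *m p%:M = 1%:M :> 'M[K]_1 by rewrite -scalar_mxM mulVf.
  rewrite !mulmx_block !(mul1mx, mulmx1, mul0mx, mulmx0, addr0, add0r) !mulmxA pp'.
  rewrite -(mulmxA c p^-1%:M p%:M) p'p mul1mx mulmx1 /d.
  rewrite [c *m _ *m b + _]addrC subrK -[LHS]submxK; congr block_mx.
  by apply/matrixP=> i j; rewrite !mxE !ord1 eqxx mulr1n /p; congr (a _ _); apply: val_inj.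
have invd : invertible_mx d.
  have dn0 : \det a' != 0.
    case: inva => z [az _]; apply: contraPneq az => da.
    by move/(congr1 (fun Z : 'M_n.+1 => \det Z)); rewrite det_mulmx -/a' da mul0r det1 => /esym/eqP; rewrite oner_eq0.
  have du : d \in unitmx.
    rewrite unitmxE unitfE; apply: contra dn0 => /eqP d0.
    by rewrite aE !det_mulmx !det_ublock d0 mulr0 !(mulr0, mul0r).
  by exists (invmx d); rewrite mulmxV // mulVmx.
have invp : invertible_mx (p%:M : 'M_1).
  by apply: (@invertible_scalar _ _ p^-1); rewrite ?divff ?mulVf.
have [u [un0 eu]] := IH _ invd; exists (p * u); rewrite mulf_neq0 //; split=> //.
have i1 := invertible_dsum invp (invertible_mx1 K n).
have i2 := invertible_dsum (invertible_mx1 K 1) invd.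
have i3 := invertible_mulmx i1 i2.
have EU := Eprod_upper (p^-1%:M *m b : 'M_(1, n)).
rewrite -[a]/a' aE (chi_EprodMl (Eprod_lower _) (invertible_mulmx i3 (invertible_Eprod EU))).
rewrite (chi_EprodMr EU i3) chiM // chi_dsum1 // chi_1dsum // eu scalar_mxM chiM //.
by apply: (@invertible_scalar _ _ u^-1); rewrite ?divff ?mulVf.
Qed.

(** All fields are treated at once because the inductive step over [K] calls the hypothesis over
    [K(t)]. *)
Definition good (G : monoidType) : Prop :=
  forall (K : fieldType) n (a : 'M[mring K G]_n), invertible_mx a ->
  exists u : K, u != 0 /\ chi a = chi ((mC K G u)%:M : 'M_1).

Section TrivialMonoid.
Variable K : fieldType.
Definition aug1 : {rmorphism mring K onem -> K} :=
  @mhom K onem K idfun (fun=> 1) erefl (fun _ _ => esym (mulr1 1))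
    (fun a g => etrans (mulr1 a) (esym (mul1r a))).

Lemma aug1K : cancel aug1 (mC K onem).
Proof.
elim/mring_ind=> [u v e e'|[] a]; first by rewrite !rmorphD e e'.
by rewrite mhomU mulr1.
Qed.

Lemma map_aug1K n m (a : 'M[mring K onem]_(n, m)) : map_mx (mC K onem) (map_mx aug1 a) = a.
Proof. by apply/matrixP=> i j; rewrite 2!mxE; apply: aug1K. Qed.

Lemma onem_dedekind_finite N (a b : 'M[mring K onem]_N) : a *m b = 1%:M -> b *m a = 1%:M.
Proof.
move=> ab; rewrite -[b *m a]map_aug1K map_mxM mulmx1C ?map_mx1 //.
by rewrite -map_mxM ab map_mx1.
Qed.
End TrivialMonoid.

Lemma good_onem : good onem.
Proof.
move=> K n a inva; have [u [un0 eu]] := chi_field (invertible_map (aug1 K) inva).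
exists u; split=> //; rewrite -[a]map_aug1K -map_scalar_mx; apply: chi_map_eq => //.
  exact: invertible_map.
by apply: (@invertible_scalar _ _ u^-1); rewrite ?divff ?mulVf.
Qed.

(** * The index obstruction, by augmentation to the base field *)

Section Augmentation.
Variables (K : fieldType) (G : monoidType).
Local Notation A := (mring K G).
Local Notation A1 := (mring K onem).
Local Notation R := (mring A zmon).
Local Notation R1 := (mring A1 zmon).
Local Notation T := (mring K (bic * G)%type).
Local Notation T1 := (mring K (bic * onem)%type).

Definition augA : {rmorphism A -> A1} :=
  @mhom K G A1 (mC K onem) (fun=> 1) erefl (fun _ _ => esym (mulr1 1))
    (fun a g => etrans (mulr1 _) (esym (mul1r _))).
Definition augAR : {rmorphism A -> R1} := mC A1 zmon \o augA.
Fact tR1D (k l : zmon) : mU (k * l)%g (1 : A1) = mU k 1 * mU l 1.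
Proof. by rewrite mU_mul mulr1. Qed.
Definition augR : {rmorphism R -> R1} :=
  @mhom A zmon R1 augAR (fun k => mU k 1) erefl tR1D (fun a k => esym (sp_central k _)).
Fact augT_M (p q : (bic * G)%type) : mU (((p * q)%g).1, 1%g : onem) (1 : K) =
  mU (p.1, 1%g) 1 * mU (q.1, 1%g) 1.
Proof. by rewrite mU_mul mulr1. Qed.
Definition augT : {rmorphism T -> T1} :=
  @mhom K (bic * G)%type T1 (mC K _) (fun p => mU (p.1, 1%g) 1) erefl augT_M
    (fun a p => mC_central _ _).

Lemma augA_U g c : augA (mU g c) = mU 1%g c.
Proof. by rewrite mhomU mulr1. Qed.
Lemma augR_U k a : augR (mU k a) = mU k (augA a).
Proof. by rewrite mhomU [augAR a]/(mC A1 zmon (augA a)) mU_mul mulr1 mul1g. Qed.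

Lemma augT_sg u : augR (sgT K G u) = sgT K onem (augT u).
Proof.
elim/T_ind: u => [u v e e'|i j g c]; first by rewrite !rmorphD e e'.
rewrite sgT_mon augR_U augA_U.
rewrite [augT _]mhomU /= mU_mul mulr1 mul1g.
by rewrite (sgT_mon i j 1%g c).
Qed.

(** Sending every element of [G] to 1 replaces [A] by a copy of [K], over which square matrices are
    Dedekind-finite, so that [index_absurd] applies. *)
Lemma toeplitz_index n (g : 'M[T]_n) (l : K) (j : nat) : invertible_mx g -> l != 0 ->
  chi (map_mx (sgT K G) g) = chi ((mU (j.+1%:Z : zmon) (mC K G l))%:M : 'M[R]_1) -> False.
Proof.
move=> invg ln0.
have invw : invertible_mx ((mU (j.+1%:Z : zmon) (mC K G l))%:M : 'M[R]_1).
  apply: (@invertible_scalar _ _ (mU ((- j.+1%:Z : int) : zmon) (mC K G l^-1)));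
  by rewrite mU_mul -rmorphM ?divff ?mulVf // rmorph1 zmonM ?subrr ?addNr.
move/(chi_map_eq augR (invertible_map (sgT K G) invg) invw).
have -> : map_mx augR (map_mx (sgT K G) g) = map_mx (sgT K onem) (map_mx augT g).
  by apply/matrixP=> i k; rewrite 2!mxE augT_sg 2!mxE.
have -> : map_mx augR ((mU (j.+1%:Z : zmon) (mC K G l))%:M : 'M[R]_1)
    = map_mx (sgT K onem) ((mon j.+1 0 1%g l)%:M : 'M[T1]_1).
  rewrite !map_scalar_mx sgT_mon augR_U augA_U; congr (_%:M).
  by congr (mU _ _); rewrite subr0.
have E := map_scalar_mx (sgT K onem) 1 (mon j.+1 0 (1%g : onem) l).
move/(chi_eqP (invertible_map (sgT K onem) (invertible_map augT invg))) => H.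
apply: (index_absurd (@onem_dedekind_finite K) (invertible_map augT invg) ln0 (H _)).
rewrite E sgT_mon subr0.
apply: (@invertible_scalar _ _ (mU ((- j.+1%:Z : int) : zmon) (mC K onem l^-1)));
by rewrite mU_mul -rmorphM ?divff ?mulVf // rmorph1 zmonM ?subrr ?addNr.
Qed.

End Augmentation.

Lemma good_bic G : good G -> good (bic * G)%type.
Proof.
move=> goodG K n g invg; have [g' [gg' g'g]] := invg.
pose iF : {rmorphism {poly K} -> {fraction {poly K}}} := @FracField.tofrac {poly K}.
have iF_inj p : iF p = 0 -> p = 0 by move/eqP; rewrite tofrac_eq0 => /eqP.
have [l [k [ln0 E]]] := laurent_class iF_inj (@fraction_clear _)
  (goodG {fraction {poly K}}) (invertible_map (sgT K G) invg).
case: (intP k) E => [|j|j] E.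
- by exists l; split=> //; apply: chi_toeplitz => //; apply: goodG.
- by case: (toeplitz_index invg ln0 E).
(* A negative exponent for [g] is a positive one for its inverse. *)
- have invg' : invertible_mx g' by exists g.
  have lVn0 : l^-1 != 0 by rewrite invr_eq0.
  case: (toeplitz_index (j := j) invg' lVn0).
  rewrite (@chiV _ _ (map_mx (sgT K G) g)) -?map_mxM ?gg' ?g'g ?map_mx1 // E.
  apply/esym/chiV; rewrite -scalar_mxM mU_mul -rmorphM ?divff ?mulVf // rmorph1 zmonM;
  by rewrite ?subrr ?addNr.
Qed.

(** * The algebra S_m *)

Fixpoint bicn (m : nat) : monoidType :=
  if m is m'.+1 then (bic * bicn m')%type else onem.

Lemma good_bicn m : good (bicn m).
Proof. by elim: m => [|m IH]; [apply: good_onem|apply: good_bic]. Qed.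

(** The element [b] in the factor of index [i]; for [i >= m] it degenerates to the unit. *)
Fixpoint bicgen m (b : bic) (i : nat) : bicn m :=
  match m return bicn m with
  | 0 => tt
  | m'.+1 => if i is i'.+1 then (1%g, bicgen m' b i') else (b, 1%g)
  end.

Lemma bicgen_mul m b b' i : (bicgen m b i * bicgen m b' i)%g = bicgen m (b * b')%g i.
Proof.
elim: m i => [|m IH] i; first by [].
by case: i => [|i] /=; rewrite mulg_pair mulg1 ?IH.
Qed.

Lemma bicgen1 m i : bicgen m 1%g i = 1%g.
Proof. by elim: m i => [|m IH] [|i] //=; rewrite IH. Qed.

Lemma bicgen_comm m b b' i j : i != j ->
  (bicgen m b i * bicgen m b' j)%g = (bicgen m b' j * bicgen m b i)%g.
Proof.
elim: m i j => [|m IH] i j ij; first by [].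
case: i j ij => [|i] [|j] //= ij; rewrite !mulg_pair ?mulg1 ?mul1g //.
by rewrite IH.
Qed.

Section Evaluation.
Variable S : pzRingType.
(** Indexing by [nat] lets the recursion on [m] shift the families. *)
Definition nat_relations (x y : nat -> S) : Prop :=
  (forall i, y i * x i = 1) /\
  (forall i j, i != j -> [/\ x i * y j = y j * x i, x i * x j = x j * x i & y i * y j = y j * y i]).

Definition bicval (x y : S) (b : bic) : S := x ^+ b.1 * y ^+ b.2.

Lemma bicvalM x y : y * x = 1 -> {morph bicval x y : b b' / (b * b')%g >-> b * b'}.
Proof.
(* Cancelling adjacent pairs [y x] leaves a power of [x] or of [y], matching the truncated
   subtractions in [bic_mul]. *)
move=> yx; have H j k : y ^+ j * x ^+ k = x ^+ (k - j) * y ^+ (j - k).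
  elim: j k => [|j IH] [|k]; rewrite ?expr0 ?mul1r ?mulr1 ?subn0 ?sub0n ?expr0 ?mulr1 ?mul1r //.
  by rewrite exprSr exprS mulrA -(mulrA _ y) yx mulr1 IH subSS.
move=> [i j] [k l]; rewrite /bicval /= exprD addnC exprD !mulrA; congr (_ * _).
by rewrite -!mulrA; congr (_ * _); rewrite H.
Qed.

Fixpoint bicneval m (x y : nat -> S) : bicn m -> S :=
  match m return bicn m -> S with
  | 0 => fun=> 1
  | m'.+1 => fun p => bicval (x 0) (y 0) p.1 * bicneval (fun i => x i.+1) (fun i => y i.+1) p.2
  end.

Lemma bicneval_comm m x y (z : S) : (forall i, z * x i = x i * z) ->
  (forall i, z * y i = y i * z) -> forall p : bicn m, z * bicneval x y p = bicneval x y p * z.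
Proof.
elim: m x y => [|m IH] x y zx zy p /=; first by rewrite mulr1 mul1r.
have comm (u : S) n : z * u = u * z -> z * u ^+ n = u ^+ n * z.
  by move=> zu; apply: commrX.
rewrite /bicval !mulrA comm // -[x 0 ^+ _ * z * _]mulrA comm // -!mulrA IH //.
Qed.

Lemma bicneval1 m x y : bicneval x y (1%g : bicn m) = 1.
Proof. by elim: m x y => [//|m IH] x y /=; rewrite IH /bicval !expr0 !mulr1. Qed.

Lemma bicnevalM m x y : nat_relations x y ->
  forall p q : bicn m, bicneval x y (p * q)%g = bicneval x y p * bicneval x y q.
Proof.
elim: m x y => [|m IH] x y [yx comm] p q /=; first by rewrite mulr1.
rewrite bicvalM // IH; last by split=> [i|i j ij]; [apply: yx|apply: comm].
have cx i : x 0 * x i.+1 = x i.+1 * x 0 by have [] := comm 0 i.+1 isT.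
have cy i : y 0 * y i.+1 = y i.+1 * y 0 by have [] := comm 0 i.+1 isT.
have cxy i : x 0 * y i.+1 = y i.+1 * x 0 by have [] := comm 0 i.+1 isT.
have cyx i : y 0 * x i.+1 = x i.+1 * y 0 by have [] := comm i.+1 0 isT.
have H u (hu : forall i, u * x i.+1 = x i.+1 * u) (hu' : forall i, u * y i.+1 = y i.+1 * u) n :
    u ^+ n * bicneval (fun i => x i.+1) (fun i => y i.+1) p.2 =
    bicneval (fun i => x i.+1) (fun i => y i.+1) p.2 * u ^+ n.
  by apply/esym/commrX/esym/bicneval_comm.
have : bicval (x 0) (y 0) q.1 * bicneval (fun i => x i.+1) (fun i => y i.+1) p.2 =
    bicneval (fun i => x i.+1) (fun i => y i.+1) p.2 * bicval (x 0) (y 0) q.1.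
  by rewrite /bicval -mulrA [y 0 ^+ _ * _]H // mulrA H // mulrA.
move: (bicval _ _ p.1) (bicval _ _ q.1) (bicneval _ _ p.2) (bicneval _ _ q.2).
by move=> u v w z vw; rewrite -!mulrA [w * (v * z)]mulrA -vw -mulrA.
Qed.

Lemma bicneval_gen m x y b i : (i < m)%N ->
  bicneval x y (bicgen m b i) = bicval (x i) (y i) b.
Proof.
elim: m x y i => [//|m IH] x y [|i] /= im; first by rewrite bicneval1 mulr1.
by rewrite IH // /bicval !expr0 !mul1r.
Qed.

End Evaluation.

(** * Transport from the monoid ring to a model of S_m *)

Section Retract.
Variables (K : fieldType) (m : nat) (S : algType K) (x y : 'I_m -> S).
Hypothesis HS : is_Sm x y.

(** The default 1 outside the range satisfies every relation. *)
Definition extn (z : 'I_m -> S) (i : nat) : S := if insub i is Some i' then z i' else 1.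

Lemma extnE z (i : 'I_m) : extn z i = z i. Proof. by rewrite /extn valK. Qed.

Lemma extn_relations : nat_relations (extn x) (extn y).
Proof.
have [[yx comm] _] := HS; split=> [i|i j ij]; rewrite /extn.
  by case: insubP => [i' _ _|_]; rewrite ?yx ?mulr1.
case: insubP => [i' _ ei|_]; last by rewrite !(mul1r, mulr1).
case: insubP => [j' _ ej|_]; last by rewrite !(mul1r, mulr1).
by apply: comm; rewrite -val_eqE /= ei ej.
Qed.

Fact in_alg_central (a : K) (p : bicn m) :
  GRing.in_alg S a * bicneval (extn x) (extn y) p =
  bicneval (extn x) (extn y) p * GRing.in_alg S a.
Proof. by rewrite mulr_algl mulr_algr. Qed.

Definition psi_rm : {rmorphism mring K (bicn m) -> S} :=
  @mhom K (bicn m) S (GRing.in_alg S) _ (bicneval1 m _ _) (bicnevalM extn_relations) in_alg_central.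

Definition psi : mring K (bicn m) -> S := psi_rm.
HB.instance Definition _ := GRing.RMorphism.on psi.
Fact psi_scalable : scalable psi.
Proof.
move=> a u; rewrite mscaleE /psi rmorphM mhomU bicneval1 mulr1 /=.
by rewrite mulr_algl.
Qed.
HB.instance Definition _ := GRing.isScalable.Build K (mring K (bicn m)) S *:%R psi psi_scalable.

(** [f] comes from the universal property of [S]; its uniqueness clause, for maps from [S] to
    itself, identifies [psi \o f] with the identity. Every matrix over [S] is thus the image of one
    over the monoid ring. *)
Lemma Sm_retract : exists f : {rmorphism S -> mring K (bicn m)}, forall s, psi (f s) = s.
Proof.
pose xs (i : 'I_m) : mring K (bicn m) := mU (bicgen m (bx 1 0) i) 1.
pose ys (i : 'I_m) : mring K (bicn m) := mU (bicgen m (bx 0 1) i) 1.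
have rel : Sm_relations xs ys.
  split=> [i|i j ij]; first by rewrite mU_mul bicgen_mul mulr1 bicgen1.
  by split; rewrite !mU_mul bicgen_comm.
have [f [fxy _]] := HS.2 (mring K (bicn m)) xs ys rel.
exists f => s; have [f0 [_ f0u]] := HS.2 S x y HS.1.
have E1 := f0u idfun (fun i => conj erefl erefl) s.
have E2 := f0u (psi \o f : {lrmorphism S -> S}).
rewrite -[LHS]/((psi \o f) s) E2 -?E1 // => i /=; have [-> ->] := fxy i.
by rewrite /psi !mhomU rmorph1 !mul1r !bicneval_gen // /bicval !expr0 !expr1 mulr1 mul1r !extnE.
Qed.

Lemma chi_Sm n (a : 'M[S]_n) : invertible_mx a ->
  exists l : K, l != 0 /\ chi a = chi ((l%:A)%:M : 'M[S]_1).
Proof.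
move=> inva; have [f psif] := Sm_retract.
have [l [ln0 E]] := good_bicn (invertible_map f inva).
exists l; split=> //.
have -> : a = map_mx psi (map_mx f a) by apply/matrixP=> i j; rewrite 2!mxE psif.
have -> : ((l%:A)%:M : 'M[S]_1) = map_mx psi ((mC K (bicn m) l)%:M).
  have psiC : psi (mU 1%g l) = l%:A by rewrite /psi mhomU bicneval1 mulr1.
  by rewrite map_scalar_mx -psiC.
apply: chi_map_eq => //; first exact: invertible_map.
by apply: (@invertible_scalar _ _ (mC K (bicn m) l^-1)); rewrite -rmorphM ?divff ?mulVf ?rmorph1.
Qed.

Lemma mu_dsum n (l : K) : mu S n l = ((l%:A)%:M <+> 1%:M : 'M[S]_(1 + n)).
Proof.
have H (i j : 'I_(1 + n)) : mu S n l i j = ((l%:A)%:M <+> 1%:M : 'M[S]_(1 + n)) i j.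
  rewrite mxE; case: (split_ordP i) => i' ->; case: (split_ordP j) => j' ->.
  - by rewrite block_mxEul !ord1 mxE eqxx.
  - by rewrite block_mxEur mxE -!val_eqE !ord1.
  - by rewrite block_mxEdl mxE -!val_eqE !ord1.
  - by rewrite block_mxEdr mxE -!val_eqE /= !add1n eqSS; case: eqP.
by apply/matrixP => i j; apply: H.
Qed.

Lemma muV n (l : K) : l != 0 -> mu S n l *m mu S n l^-1 = 1%:M.
Proof.
move=> ln0; rewrite !mu_dsum; apply: etrans (dsum1 S 1 n).
apply: etrans (mulmx_dsum _ _ _ _) _; rewrite mulmx1 -scalar_mxM.
by rewrite -(rmorphM (GRing.in_alg S)) divff // rmorph1.
Qed.

Lemma muVl n (l : K) : l != 0 -> mu S n l^-1 *m mu S n l = 1%:M.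
Proof. by move=> ln0; rewrite -{2}[l]invrK muV // invr_eq0. Qed.

Lemma chi_mu n (a : 'M[S]_n.+1) : invertible_mx a ->
  exists l : K, l != 0 /\ chi a = chi (mu S n l).
Proof.
move=> /chi_Sm[l [ln0 E]]; exists l; split=> //.
have invl : invertible_mx ((l%:A)%:M : 'M[S]_1).
  apply: (@invertible_scalar _ _ (l^-1)%:A);
  by rewrite -(rmorphM (GRing.in_alg S)) ?divff ?mulVf // rmorph1.
rewrite mu_dsum E; exact: esym (chi_dsum1 n invl).
Qed.

End Retract.

(** * The determinant over L_m, and the theorem *)

Lemma detbar_mu (K : fieldType) (S : algType K) (L : comUnitAlgType K)
  (pi : {lrmorphism S -> L}) n (l : K) : detbar pi (mu S n l) = l%:A.
Proof.
rewrite /detbar mu_dsum.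
apply: etrans (congr1 (fun Z : 'M_(1 + n) => \det Z) (map_block_mx pi _ _ _ _)) _.
rewrite !map_mx0 map_mx1 map_scalar_mx det_ublock det1 mulr1 det_scalar1.
exact: (rmorph_alg pi l).
Qed.

Theorem theorem4p5 (K : fieldType) (m : nat) (m_ge1 : (1 <= m)%N)
    (S : algType K) (x y : 'I_m -> S) (HS : is_Sm x y)
    (L : comUnitAlgType K) (X : 'I_m -> L) (HL : is_Laurent X)
    (pi : {lrmorphism S -> L})
    (Hpix : forall i, pi (x i) = X i) (Hpiy : forall i, pi (y i) = (X i)^-1) :
  (* (1) detbar : GL_oo(S_m) -> L_m^* takes values in K^* ... *)
  (forall (n : nat) (a : 'M[S]_n.+1), invertible_mx a ->
     exists l : K, l != 0 /\ detbar pi a = l%:A) /\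
  (* ... is well defined on GL_oo (compatible with a |-> diag(a,1)) ... *)
  (forall (n k : nat) (a : 'M[S]_n.+1), invertible_mx a ->
     detbar pi (block_mx a 0 0 1%:M : 'M[S]_(n.+1 + k)) = detbar pi a) /\
  (* ... is a group homomorphism ... *)
  (forall (n : nat) (a b : 'M[S]_n.+1), invertible_mx a -> invertible_mx b ->
     detbar pi (a *m b) = detbar pi a * detbar pi b) /\
  (* ... is surjective onto K^* ... *)
  (forall l : K, l != 0 ->
     exists (n : nat) (a : 'M[S]_n.+1), invertible_mx a /\ detbar pi a = l%:A) /\
  (* ... with kernel E_oo(S_m) ... *)
  (forall (n : nat) (a : 'M[S]_n.+1), invertible_mx a ->
     (in_Einf a <-> detbar pi a = 1)) /\
  (* ... and every a is uniquely a = mu(l) e with l = detbar a in K^*, e in E_oo. *)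
  (forall (n : nat) (a : 'M[S]_n.+1), invertible_mx a ->
     exists (l : K) (e : 'M[S]_n.+1),
       [/\ l != 0, detbar pi a = l%:A, in_Einf e, a = mu S n l *m e &
         forall (l' : K) (e' : 'M[S]_n.+1),
           l' != 0 -> in_Einf e' -> a = mu S n l' *m e' -> l' = l /\ e' = e]) /\
  (* (2) K_1(S_m) = GL_oo/E_oo is isomorphic to K^* via detbar: two elements of
     GL_oo have the same class in K_1 iff they have the same detbar. *)
  (forall (n : nat) (a b b' : 'M[S]_n.+1), invertible_mx a ->
     b *m b' = 1%:M -> b' *m b = 1%:M ->
     (in_Einf (a *m b') <-> detbar pi a = detbar pi b)).
Proof.
have invmu n l : l != 0 -> invertible_mx (mu S n l).
  by move=> ln0; exists (mu S n l^-1); rewrite muV // muVl.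
have dM n (a b : 'M[S]_n) : detbar pi (a *m b) = detbar pi a * detbar pi b.
  by rewrite /detbar map_mxM det_mulmx.
have d1 n : detbar pi (1%:M : 'M[S]_n) = 1 by rewrite /detbar map_mx1 det1.
have dchi n (a b : 'M[S]_n) : invertible_mx a -> invertible_mx b ->
    chi a = chi b -> detbar pi a = detbar pi b.
  move=> inva invb ab; apply: chi_det; try exact: invertible_map.
  exact: chi_map_eq.
(* The class of [a] is that of some [mu S n l], and [detbar], an invariant of the class, recovers
   [l]. *)
have dval n (a : 'M[S]_n.+1) : invertible_mx a ->
    exists l, [/\ l != 0, detbar pi a = l%:A & chi a = chi (mu S n l)].
  move=> inva; have [l [ln0 E]] := chi_mu HS inva; exists l; split=> //.
  by rewrite (dchi _ _ _ inva (invmu n l ln0) E) detbar_mu.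
have algI (l l' : K) : l%:A = l'%:A :> L -> l = l' by apply: (fmorph_inj (GRing.in_alg L)).
have Einf n (a : 'M[S]_n.+1) : invertible_mx a -> in_Einf a <-> detbar pi a = 1.
  move=> inva; rewrite -(chi_eq0 inva); split=> [a0|].
    by rewrite -(d1 n.+1); apply: dchi; rewrite ?chi1 //; apply: invertible_mx1.
  (* A determinant equal to 1 forces [l = 1], so the class is that of the identity. *)
  have [l [ln0 -> ->]] := dval _ _ inva => dl.
  have {dl}-> : l = 1 by apply: algI; rewrite dl scale1r.
  rewrite mu_dsum scale1r; apply: etrans (congr1 (@chi S _) (dsum1 S 1 n)) (chi1 S _).
have Einf_det n (a : 'M[S]_n.+1) : in_Einf a -> detbar pi a = 1.
  case=> k Ek; have := det_Eprod (Eprod_map pi Ek).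
  by rewrite map_block_mx !map_mx0 map_mx1 det_ublock det1 mulr1.
split; first by move=> n a /dval[l [ln0 da _]]; exists l.
split; first by move=> n k a _; rewrite /detbar map_block_mx !map_mx0 map_mx1 det_ublock det1 mulr1.
split; first by move=> n a b _ _; apply: dM.
split; first by move=> l ln0; exists 0%N, (mu S 0 l); rewrite detbar_mu; split=> //; apply: invmu.
split; first exact: Einf.
split.
  move=> n a inva; have [l [ln0 da E]] := dval _ _ inva.
  exists l, (mu S n l^-1 *m a); split=> //.
  - have inve : invertible_mx (mu S n l^-1 *m a).
      by apply: invertible_mulmx => //; apply: invmu; rewrite invr_eq0.
    apply/(Einf _ _ inve); rewrite dM da detbar_mu -(rmorphM (GRing.in_alg L)) mulVf //.
    exact: rmorph1.
  - by rewrite mulmxA muV // mul1mx.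
  - move=> l' e' l'n0 Ee' aE.
    (* [detbar] is 1 on E_oo, so applying it to the second factorisation recovers [l']. *)
    have ll' : l' = l.
      by apply: algI; rewrite -da aE dM detbar_mu Einf_det // mulr1.
    by split=> //; rewrite aE ll' mulmxA muVl // mul1mx.
move=> n a b b' inva bb' b'b; rewrite Einf; last by apply: invertible_mulmx => //; exists b.
rewrite dM; split=> [ab'|->]; last by rewrite -dM bb' d1.
by rewrite -[LHS]mulr1 -(d1 n.+1) -b'b dM mulrA ab' mul1r.
Qed.
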